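(* Let $\mathbb{K}=\mathbb{R}$ or $\mathbb{K}=\mathbb{C}$. Let $X\subset\mathbb{K}^N$ be a closed semialgebraic set with $0\in X$, of dimension $\dim_{\mathbb{R},0}X=n$, let $F:(X,0)\to(\mathbb{K}^m,0)$ be a continuous semialgebraic mapping, and let $n\le k\le m$. Then for any $L\in\mathbf{L}^{\mathbb{K}}(m,k)$ such that $$F^{-1}(0)\cap U_L=(L\circ F)^{-1}(0)\cap U_L\quad\text{for a neighbourhood } U_L\subset X \text{ of } 0,\qquad( * )$$ we have $$\mathcal{L}^{\mathbb{K}}_0(F|X)\le\mathcal{L}^{\mathbb{K}}_0(L\circ F|X).$$ Moreover, for the generic $L\in\mathbf{L}^{\mathbb{K}}(m,k)$ the condition $( * )$ holds and $$\mathcal{L}^{\mathbb{K}}_0(F|X)=\mathcal{L}^{\mathbb{K}}_0(L\circ F|X).\qquad( ** )$$ In particular, for the generic $L\in\Delta^{\mathbb{K}}(m,k)$ both $( * )$ and $( ** )$ hold.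
   Context: If $\mathbb{K}=\mathbb{C}$, then $\mathbb{K}^N$ and $\mathbb{K}^m$ are identified with $\mathbb{R}^{2N}$ and $\mathbb{R}^{2m}$ when speaking of semialgebraic sets and mappings and of real dimension. $F:(X,0)\to(\mathbb{K}^m,0)$ denotes a mapping of a neighbourhood of $0$ in $X$ into $\mathbb{K}^m$ with $F(0)=0$. It is assumed that $0$ is an accumulation point of $X$. Dimension: $\dim_{\mathbb{R},0}X$ is the infimum of the (real) dimensions at $0$ of local real analytic sets $V\ni 0$ such that $X\cap U\subset V$ for some neighbourhood $U$ of $0$. Linear mappings: $\mathbf{L}^{\mathbb{K}}(m,k)$ is the set of all $\mathbb{K}$-linear mappings $\mathbb{K}^m\to\mathbb{K}^k$ (with $\mathbb{K}^0=\{0\}$). For $m\ge k$, $\Delta^{\mathbb{K}}(m,k)$ is the set of those $L=(L_1,\dots,L_k)\in\mathbf{L}^{\mathbb{K}}(m,k)$ of the form $L_i(y_1,\dots,y_m)=y_i+\sum_{j=k+1}^m\alpha_{i,j}y_j$, $i=1,\dots,k$, with $\alpha_{i,j}\in\mathbb{K}$. Generic: ''for the generic $x\in A$'' means that there exists an algebraic set $V$ such that $A\setminus V$ is a dense subset of $A$ and the property holds for all $x\in A\setminus V$. Łojasiewicz exponent at $0$: $\mathcal{L}^{\mathbb{K}}_0(G|X)$ is the smallest exponent $\eta$ for which there exist $C,\varepsilon>0$ such that $|G(x)|\ge C\operatorname{dist}(x,G^{-1}(0)\cap X)^{\eta}$ for $x\in X$, $|x|<\varepsilon$ (Euclidean norm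 and distance). If $0$ is not an accumulation point of $X\setminus G^{-1}(0)$, one puts $\mathcal{L}^{\mathbb{K}}_0(G|X)=0$. *)

(* Defs.v *)
From mathcomp Require Import all_boot all_order all_algebra.
From mathcomp Require Import finmap.
(* The notations of mpoly clash with those of the analysis library. *)
From mathcomp Require Import -(notations) mpoly.
From mathcomp Require Import all_classical all_reals all_analysis.
From mathcomp Require Import complex.

Set Implicit Arguments.
Unset Strict Implicit.
Unset Printing Implicit Defensive.

Import Order.TTheory GRing.Theory Num.Theory.
Import numFieldNormedType.Exports.

Local Open Scope classical_set_scope.
Local Open Scope ring_scope.

Section RealSpace.
Variable R : realType.

Definition enorm d (x : 'rV[R]_d) : R := Num.sqrt (\sum_i x 0 i ^+ 2).

Definition basic_semialgebraic d (ps qs : seq (mpoly d R)) :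
    set 'rV[R]_d :=
  [set x | (forall p, p \in ps -> meval (fun i => x 0 i) p = 0) /\
           (forall q, q \in qs -> 0 < meval (fun i => x 0 i) q)].

Definition semialgebraic d (A : set 'rV[R]_d) : Prop :=
  exists S : seq (seq (mpoly d R) * seq (mpoly d R)),
    A = [set x | exists2 s, s \in S & basic_semialgebraic s.1 s.2 x].

(* Unconditional convergence of a family of real numbers, that is, absolute
   convergence. *)
Definition has_sum (I : choiceType) (u : I -> R) (l : R) : Prop :=
  forall e : R, 0 < e -> exists A : {fset I}, forall B : {fset I},
    fsubset A B -> `|\sum_(i <- B) u i - l| < e.

Definition analytic_at d (f : 'rV[R]_d -> R) (a : 'rV[R]_d) : Prop :=
  exists c : {ffun 'I_d -> nat} -> R,
    nbhs a [set x : 'rV[R]_d |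
      has_sum (fun al : {ffun 'I_d -> nat} =>
                 c al * \prod_(i < d) (x 0 i - a 0 i) ^+ al i) (f x)].

Definition analytic_on d q (U : set 'rV[R]_d) (f : 'rV[R]_d -> 'rV[R]_q) :
    Prop :=
  forall a, U a -> forall j, analytic_at (fun x => f x 0 j) a.

Definition local_analytic_set d (V : set 'rV[R]_d) : Prop :=
  exists (U : set 'rV[R]_d) (q : nat) (f : 'rV[R]_d -> 'rV[R]_q),
    [/\ open U, U 0, analytic_on U f & V = U `&` f @^-1` [set 0]].

(* Analytic submanifolds of dimension p, as local zero sets of analytic
   submersions; the empty set is not excluded. *)
Definition analytic_submanifold d (p : nat) (M : set 'rV[R]_d) : Prop :=
  (p <= d)%N /\
  forall a, M a ->
    exists (U : set 'rV[R]_d) (h : 'rV[R]_d -> 'rV[R]_(d - p)),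
      [/\ open U, U a, analytic_on U h, \rank ('J h a) = (d - p)%N
        & M `&` U = U `&` h @^-1` [set 0]].

(* The dimension at 0 of a set V containing 0: the largest p such that every
   neighbourhood of 0 contains a nonempty p-dimensional analytic submanifold
   lying in V; equivalently, the minimum over the neighbourhoods U of 0 of the
   largest dimension of a submanifold included in V `&` U. *)
Definition analytic_dim0 d (V : set 'rV[R]_d) : nat :=
  \max_(p < d.+1 | `[< forall U, nbhs (0 : 'rV[R]_d) U ->
      exists M, [/\ M !=set0, analytic_submanifold p M & M `<=` V `&` U] >]) p.

(* V = 'rV[R]_d is always admissible and has dimension d, whence the default
   value of the minimum. *)
Definition real_dim0 d (X : set 'rV[R]_d) : nat :=
  \big[minn/d]_(p < d.+1 | `[< exists V U : set 'rV[R]_d,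
      [/\ local_analytic_set V, V 0, nbhs (0 : 'rV[R]_d) U, X `&` U `<=` V
        & analytic_dim0 V = p] >]) p.

End RealSpace.

Inductive scalars := RealScalars | ComplexScalars.

Definition scalar_field (R : realType) (s : scalars) : numFieldType :=
  match s with RealScalars => R | ComplexScalars => R[i] end.

Definition real_size (s : scalars) (d : nat) : nat :=
  match s with RealScalars => d | ComplexScalars => (d + d)%N end.

Definition realify (R : realType) (s : scalars) (d : nat) :
    'rV[scalar_field R s]_d -> 'rV[R]_(real_size s d) :=
  match s with
  | RealScalars => fun x => x
  | ComplexScalars => fun z =>
      row_mx (map_mx (@complex.Re R) z) (map_mx (@complex.Im R) z)
  end.

Section Lojasiewicz.
Variables (R : realType) (s : scalars).
Local Notation K := (scalar_field R s).

Definition knorm d (x : 'rV[K]_d) : R := enorm (realify x).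

Definition dist_to d (A : set 'rV[K]_d) (x : 'rV[K]_d) : R :=
  inf [set knorm (x - a) | a in A].

Definition is_nbhd_in N (X U : set 'rV[K]_N) : Prop :=
  U `<=` X /\ exists2 W, nbhs (0 : 'rV[K]_N) W & X `&` W `<=` U.

(* A mapping defined on a subset D of K^N is represented by a total function,
   of which only the values on D are used. *)
Definition zeros N m (D : set 'rV[K]_N) (G : 'rV[K]_N -> 'rV[K]_m) :
    set 'rV[K]_N :=
  D `&` G @^-1` [set 0].

Definition map_graph N m (D : set 'rV[K]_N) (G : 'rV[K]_N -> 'rV[K]_m) :
    set 'rV[R]_(real_size s N + real_size s m) :=
  [set row_mx (realify x) (realify (G x)) | x in D].

Definition loj_exponents N m (X D : set 'rV[K]_N)
    (G : 'rV[K]_N -> 'rV[K]_m) : set R :=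
  [set eta | exists C e : R, [/\ 0 < C, 0 < e &
     forall x, X x -> knorm x < e ->
       D x /\ C * dist_to (zeros D G) x `^ eta <= knorm (G x)]].

(* l is the Lojasiewicz exponent at 0 of G : D -> K^m on X, where D is a
   neighbourhood of 0 in X. *)
Definition is_loj_exponent N m (X D : set 'rV[K]_N)
    (G : 'rV[K]_N -> 'rV[K]_m) (l : R) : Prop :=
  (limit_point (X `\` zeros D G) 0 ->
     loj_exponents X D G l /\ lbound (loj_exponents X D G) l) /\
  (~ limit_point (X `\` zeros D G) 0 -> l = 0).

(* A K-linear mapping K^m -> K^k is represented by the matrix L acting on row
   vectors, so that L j i is the coefficient of y_j in L_i. *)
Definition lin_comp N m k (L : 'M[K]_(m, k)) (F : 'rV[K]_N -> 'rV[K]_m) :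
    'rV[K]_N -> 'rV[K]_k :=
  fun x => F x *m L.

Definition Delta m k : set 'M[K]_(m, k) :=
  [set L | forall (j : 'I_m) (i : 'I_k), (j < k)%N ->
     L j i = ((j : nat) == i)%:R].

Definition algebraic_set m k (V : set 'M[K]_(m, k)) : Prop :=
  exists ps : seq (mpoly (m * k) K),
    V = [set L | forall p, p \in ps ->
           meval (fun i => mxvec L 0 i) p = 0].

Definition for_generic m k (A : set 'M[K]_(m, k))
    (P : 'M[K]_(m, k) -> Prop) : Prop :=
  exists V, [/\ algebraic_set V, A `<=` closure (A `\` V)
              & forall L, (A `\` V) L -> P L].

Definition same_zeros_near0 N m k (X D : set 'rV[K]_N)
    (F : 'rV[K]_N -> 'rV[K]_m) (L : 'M[K]_(m, k)) : Prop :=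
  exists2 U, is_nbhd_in X U &
    zeros D F `&` U = zeros D (lin_comp L F) `&` U.

Definition same_loj_exponent N m k (X D : set 'rV[K]_N)
    (F : 'rV[K]_N -> 'rV[K]_m) (L : 'M[K]_(m, k)) : Prop :=
  exists2 l, is_loj_exponent X D F l & is_loj_exponent X D (lin_comp L F) l.

End Lojasiewicz.

(* Main.v *)
(* Real coordinates identify K^d with R^d or R^(2d), and everything below 0 is
   local.

   Existence of the exponent.  For E > 0 let nu(E, A) be the infimum of |G|^2 on
   the points of X with |x|^2 <= E and dist(x, G^-1(0))^2 >= A.  Quantifier
   elimination shows that nu(E, A) is a root of one of finitely many polynomials
   in A and B whose degrees do not depend on E.  In a vanishing sum of monomials
   two terms are comparable, so, for fixed E, nu(E, A) is comparable to some A^q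
   with q in a finite set that does not depend on E.  The largest q recurring as A
   tends to 0 is the best exponent on the ball |x|^2 <= E, and the least of these
   over all E is attained.

   Generic mappings.  Suppose that a nonzero polynomial g satisfies
   g(L, L F(x) / F_j(x), F_j(x)) = 0 for all L and all x near 0 with F_j(x) <> 0.
   After division by a power of the last variable, g(L', c, 0) is not identically
   zero for a suitable constant c; applying the relation to L' = L + (c in the
   column of F_j), for which L' F / F_j = L F / F_j + c, one gets by continuity
   |L F| >= delta |F_j| near 0 as soon as g(L', c, 0) <> 0.  Hence L F and F are
   comparable for generic L.

   To find g, it suffices by compactness to do so on a set of a given ultrafilter.
   Along the ultrafilter, list the coordinates of x and then of F(x), and call a
   coordinate free when it is not algebraic over the preceding ones.  Minimal
   relations of the other coordinates have simple roots, and pseudo-division by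
   them shows that their common zeros near a typical point lie in X or in the
   graph of F.  Thus X contains near 0 a submanifold whose dimension is the number
   of free coordinates of x, which is therefore at most n, and no coordinate of
   F(x) is free, since otherwise it could be moved along the graph with x fixed.
   Adjoining an algebraic element does not change the order of growth of the
   dimensions of the spaces of polynomials of bounded degree, so the mk + k + 1
   functions L, L F / F_j and F_j lie in a ring of growth at most mk + n, and are
   algebraically dependent. *)

Require Import Defs.
From HB Require Import structures.
From mathcomp Require Import all_boot all_order all_algebra.
From mathcomp Require Import perm finmap.
From mathcomp Require Import -(notations) mpoly.
From mathcomp Require Import all_classical all_reals all_analysis.
From mathcomp Require Import complex polyrcf ordered_qelim qe_rcf.
From mathcomp Require Import zify ring lra.
Set Implicit Arguments.
Unset Strict Implicit.
Unset Printing Implicit Defensive.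
Import Order.TTheory GRing.Theory Num.Theory.
Import numFieldNormedType.Exports.
Local Open Scope classical_set_scope.
Local Open Scope ring_scope.

(** * Definable predicates and quantifier elimination *)

Section Definable.
Variable R : realType.
Implicit Types (e : seq R) (P Q : seq R -> Prop).

Definition definable P := exists f, forall e, P e <-> ord.holds e f.

Definition term_fun (u : seq R -> R) := exists t, forall e, u e = GRing.eval e t.

Lemma definable_ext P Q : definable P -> (forall e, P e <-> Q e) -> definable Q.
Proof. by move=> [f Pf] PQ; exists f => e; rewrite -PQ. Qed.

Lemma definable_and P Q : definable P -> definable Q ->
  definable (fun e => P e /\ Q e).
Proof.
by move=> [f Pf] [g Qg]; exists (ord.And f g) => e /=; rewrite Pf Qg.
Qed.

Lemma definable_or P Q : definable P -> definable Q ->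
  definable (fun e => P e \/ Q e).
Proof.
by move=> [f Pf] [g Qg]; exists (ord.Or f g) => e /=; rewrite Pf Qg.
Qed.

Lemma definable_imp P Q : definable P -> definable Q ->
  definable (fun e => P e -> Q e).
Proof.
by move=> [f Pf] [g Qg]; exists (ord.Implies f g) => e /=; rewrite Pf Qg.
Qed.

Lemma definable_const (b : bool) : definable (fun=> b).
Proof. by exists (ord.Bool b). Qed.

Lemma definable_forall i P : definable P ->
  definable (fun e => forall x, P (set_nth 0 e i x)).
Proof.
by move=> [f Pf]; exists (ord.Forall i f) => e /=; split=> h x; apply/Pf.
Qed.

Lemma definable_le u v : term_fun u -> term_fun v ->
  definable (fun e => u e <= v e).
Proof. by move=> [s us] [t vt]; exists (ord.Le s t) => e; rewrite us vt. Qed.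

Lemma definable_lt u v : term_fun u -> term_fun v ->
  definable (fun e => u e < v e).
Proof. by move=> [s us] [t vt]; exists (ord.Lt s t) => e; rewrite us vt. Qed.

Lemma definable_eq u v : term_fun u -> term_fun v ->
  definable (fun e => u e = v e).
Proof. by move=> [s us] [t vt]; exists (ord.Equal s t) => e; rewrite us vt. Qed.

Lemma definable_all (T : eqType) (s : seq T) (P : T -> seq R -> Prop) :
  (forall x, definable (P x)) ->
  definable (fun e => forall x, x \in s -> P x e).
Proof.
move=> dP; elim: s => [|y s IH].
  by apply: (definable_ext (definable_const true)) => e; split.
apply: (definable_ext (definable_and (dP y) IH)) => e; split.
  by move=> [Py Ps] x; rewrite inE => /orP[/eqP->//|/Ps].
by move=> h; split=> [|x xs]; apply: h; rewrite inE ?eqxx ?xs ?orbT.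
Qed.

Lemma definable_has (T : eqType) (s : seq T) (P : T -> seq R -> Prop) :
  (forall x, definable (P x)) ->
  definable (fun e => exists2 x, x \in s & P x e).
Proof.
move=> dP; elim: s => [|y s IH].
  by apply: (definable_ext (definable_const false)) => e; split=> // -[].
apply: (definable_ext (definable_or (dP y) IH)) => e; split.
  by move=> [Py|[x xs Px]]; [exists y|exists x]; rewrite // inE ?eqxx ?xs ?orbT.
by move=> [x]; rewrite inE => /orP[/eqP->|xs Px]; [left|right; exists x].
Qed.

Lemma definable_same_env P e e' :
  definable P -> GRing.same_env e e' -> P e -> P e'.
Proof. by move=> [f Pf] ee' /Pf h; apply/Pf; apply: ord.eq_holds ee' h. Qed.

Definition agree_outside o n e e' :=
  forall i, ~~ (o <= i < o + n)%N -> e`_i = e'`_i.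

(** A vector is quantified through its n entries, one after the other; ranging over the environments
    that agree outside the block avoids any substitution. *)
Lemma definable_forall_block o n P : definable P ->
  definable (fun e => forall e', agree_outside o n e e' -> P e').
Proof.
move=> dP; elim: n => [|n IH].
  apply: (definable_ext dP) => e; split=> [Pe e' ee'|]; last by apply.
  by apply: definable_same_env Pe => // i; apply: ee'; lia.
apply: (definable_ext (definable_forall (o + n) IH)) => e; split=> h.
  move=> e' ee'; apply: (h e'`_(o + n)) => i hi; rewrite nth_set_nth /=.
  by case: eqP => [->//|ne]; apply: ee'; lia.
move=> x e' ee'; apply: h => i hi; rewrite -ee' ?nth_set_nth /=; last by lia.
by case: eqP hi => // ->; lia.
Qed.

Lemma term_fun_var i : term_fun (fun e => e`_i).
Proof. by exists (GRing.Var _ i). Qed.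

Lemma term_fun_cst c : term_fun (fun=> c).
Proof. by exists (GRing.Const c). Qed.

Lemma term_funD u v : term_fun u -> term_fun v -> term_fun (fun e => u e + v e).
Proof. by move=> [s us] [t vt]; exists (GRing.Add s t) => e; rewrite us vt. Qed.

Lemma term_funN u : term_fun u -> term_fun (fun e => - u e).
Proof. by move=> [s us]; exists (GRing.Opp s) => e; rewrite us. Qed.

Lemma term_funM u v : term_fun u -> term_fun v -> term_fun (fun e => u e * v e).
Proof. by move=> [s us] [t vt]; exists (GRing.Mul s t) => e; rewrite us vt. Qed.

Lemma term_funX u n : term_fun u -> term_fun (fun e => u e ^+ n).
Proof. by move=> [s us]; exists (GRing.Exp s n) => e; rewrite us. Qed.

Lemma term_fun_sum I (r : seq I) (u : I -> seq R -> R) :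
  (forall i, term_fun (u i)) -> term_fun (fun e => \sum_(i <- r) u i e).
Proof.
move=> du; elim: r => [|i r [t rt]].
  by exists (GRing.Const 0) => e; rewrite big_nil.
have [s us] := du i.
by exists (GRing.Add s t) => e; rewrite big_cons us rt.
Qed.

Lemma term_fun_prod I (r : seq I) (u : I -> seq R -> R) :
  (forall i, term_fun (u i)) -> term_fun (fun e => \prod_(i <- r) u i e).
Proof.
move=> du; elim: r => [|i r [t rt]].
  by exists (GRing.Const 1) => e; rewrite big_nil.
have [s us] := du i.
by exists (GRing.Mul s t) => e; rewrite big_cons us rt.
Qed.

Definition block o n e : 'rV[R]_n := \row_i e`_(o + i).

Lemma term_fun_meval o n (p : mpoly n R) :
  term_fun (fun e => meval (fun i => block o n e 0 i) p).
Proof.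
have [t ht] := @term_fun_sum _ (msupp p)
  (fun m e => mcoeff m p * \prod_(i < n) e`_(o + i) ^+ m i)
  (fun m => term_funM (term_fun_cst _) (term_fun_prod _ (fun i =>
     term_funX _ (term_fun_var _)))).
exists t => e; rewrite -ht mevalE; apply: eq_bigr => m _; congr (_ * _).
by apply: eq_bigr => i _; rewrite mxE.
Qed.

Lemma definable_semialgebraic o n (A : set 'rV[R]_n) :
  semialgebraic A -> definable (fun e => A (block o n e)).
Proof.
move=> [S ->].
apply: (@definable_has _ S (fun s e => basic_semialgebraic s.1 s.2 (block o n e))).
move=> s; apply: definable_and; apply: definable_all => p.
  by apply: definable_eq (term_fun_meval _ _) (term_fun_cst _).
exact: definable_lt (term_fun_cst _) (term_fun_meval _ _).
Qed.

Definition set_block o n e (v : 'rV[R]_n) : seq R :=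
  mkseq (fun i => if (o <= i)%N then
    (if insub (i - o)%N is Some j then v 0 j else e`_i) else e`_i)
    (maxn (size e) (o + n)).

Lemma nth_set_block o n e v i : (set_block o e v)`_i =
  if (o <= i)%N then
    (if insub (i - o)%N is Some j then v 0 (j : 'I_n) else e`_i) else e`_i.
Proof.
have [lt|le] := ltnP i (maxn (size e) (o + n)); first by rewrite nth_mkseq.
rewrite nth_default ?size_mkseq //.
move: le; rewrite geq_max => /andP[le1 le2].
rewrite (nth_default 0 le1).
case: ifP => // oi; case: insubP => //= j _ ij; case: j ij => j /= ltj; lia.
Qed.

Lemma agree_set_block o n e v : agree_outside o n e (@set_block o n e v).
Proof.
move=> i hi; rewrite nth_set_block; case: ifP => // oi.
by case: insubP => //= j ltj _; move: hi; lia.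
Qed.

Lemma block_set_block o n e v : block o n (@set_block o n e v) = v.
Proof.
apply/rowP => j; rewrite mxE nth_set_block leq_addr addKn.
by rewrite valK.
Qed.

Lemma block_agree o n o' n' e e' : agree_outside o n e e' ->
  (o' + n' <= o)%N || (o + n <= o')%N -> block o' n' e = block o' n' e'.
Proof.
move=> ee' h; apply/rowP => j; rewrite !mxE; apply: ee'.
by case: j => j /= ltj; lia.
Qed.

End Definable.

(** * Sign conditions in two variables with a parameter *)

Section SignConditions.
Variable R : realType.
Implicit Types (E A B : R) (q : {poly {poly R}}) (t : GRing.term R).

(** [E] is frozen into the coefficients; the inner indeterminate stands for A and the outer one for
    B. *)
Fixpoint bipoly_of_term E t : {poly {poly R}} :=
  match t with
  | GRing.Var 0 => E%:P%:P
  | GRing.Var 1 => 'X%:P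
  | GRing.Var 2 => 'X
  | GRing.Var _ => 0
  | GRing.Const c => c%:P%:P
  | GRing.NatConst n => n%:R
  | GRing.Add t1 t2 => bipoly_of_term E t1 + bipoly_of_term E t2
  | GRing.Opp t1 => - bipoly_of_term E t1
  | GRing.NatMul t1 n => bipoly_of_term E t1 *+ n
  | GRing.Mul t1 t2 => bipoly_of_term E t1 * bipoly_of_term E t2
  | GRing.Inv _ => 0
  | GRing.Exp t1 n => bipoly_of_term E t1 ^+ n
  end.

Definition horner2 q A B : R := q.[B%:P].[A].

Lemma eval_bipoly E A B t : GRing.rterm t ->
  GRing.eval [:: E; A; B] t = horner2 (bipoly_of_term E t) A B.
Proof.
rewrite /horner2; elim: t => //=.
- by move=> [|[|[|i]]] _ /=; rewrite ?nth_nil !hornerE.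
- by move=> c _; rewrite !hornerE.
- by move=> n _; rewrite -!polyC_natr !hornerE.
- by move=> t1 IH1 t2 IH2 /andP[/IH1-> /IH2->]; rewrite !hornerE.
- by move=> t IH /IH->; rewrite !hornerE.
- by move=> t IH n /IH->; rewrite !hornerMn.
- by move=> t1 IH1 t2 IH2 /andP[/IH1-> /IH2->]; rewrite !hornerE.
- by move=> t IH n /IH->; rewrite !horner_exp.
Qed.

Definition bidegree_le D q := (size q <= D.+1)%N /\ forall l, (size (q`_l)%R <= D.+1)%N.

Lemma bidegree_le_mono D D' q : (D <= D')%N -> bidegree_le D q -> bidegree_le D' q.
Proof.
by move=> DD [h1 h2]; split=> [|l]; [move: h1|move: (h2 l)] => h; apply: leq_trans h _.
Qed.

Lemma bidegree_leC D (p : {poly R}) : (size p <= D.+1)%N -> bidegree_le D p%:P.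
Proof.
move=> sp; split; first by apply: leq_trans (size_polyC_leq1 _) _.
by move=> l; rewrite coefC; case: eqP => // _; rewrite size_poly0.
Qed.

Lemma bidegree_leM D1 D2 q1 q2 :
  bidegree_le D1 q1 -> bidegree_le D2 q2 -> bidegree_le (D1 + D2) (q1 * q2).
Proof.
move=> [s1 c1] [s2 c2]; split=> [|l].
  apply: leq_trans (size_polyMleq _ _) _; lia.
rewrite coefM; apply: leq_trans (size_sum _ _ _) _; apply/bigmax_leqP => i _.
apply: leq_trans (size_polyMleq _ _) _.
by move: (c1 i) (c2 (l - i)%N); lia.
Qed.

(** [E] enters only as a constant, so the degrees in A and B are bounded before [E] is chosen. *)
Lemma bidegree_bipoly t : exists D, forall E, bidegree_le D (bipoly_of_term E t).
Proof.
have b0 D : bidegree_le D 0 by rewrite -polyC0; apply: bidegree_leC; rewrite size_poly0.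
have cst (c : R) D : bidegree_le D c%:P%:P.
  by apply: bidegree_leC; apply: leq_trans (size_polyC_leq1 _) _.
elim: t => /=.
- move=> [|[|[|i]]]; exists 1%N => E //.
    by apply: bidegree_leC; rewrite size_polyX.
  split=> [|l]; first by rewrite size_polyX.
  by rewrite coefX; case: eqP => _; rewrite ?size_poly0 ?size_poly1.
- by move=> c; exists 0%N => E.
- by move=> n; exists 0%N => E; rewrite -!polyC_natr.
- move=> t1 [D1 IH1] t2 [D2 IH2]; exists (D1 + D2)%N => E.
  have [s1 c1] := bidegree_le_mono (leq_addr D2 D1) (IH1 E).
  have [s2 c2] := bidegree_le_mono (leq_addl D1 D2) (IH2 E).
  split=> [|l]; rewrite ?coefD; apply: leq_trans (size_polyD _ _) _.
    by rewrite geq_max s1.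
  by rewrite geq_max c1 c2.
- move=> t [D IH]; exists D => E; have [s c] := IH E.
  by split=> [|l]; rewrite ?coefN size_polyN.
- move=> t [D IH] n; exists D => E; have [s c] := IH E.
  have sizeMn (S : nzRingType) (p : {poly S}) : (size (p *+ n)%R <= size p)%N.
    by apply/leq_sizeP => j hj; rewrite coefMn nth_default ?mul0rn.
  by split=> [|l]; rewrite ?coefMn; apply: leq_trans (sizeMn _ _) _.
- by move=> t1 [D1 IH1] t2 [D2 IH2]; exists (D1 + D2)%N => E; apply: bidegree_leM.
- by move=> t _; exists 0%N.
- move=> t [D IH]; elim=> [|n [D' IHn]].
    by exists 0%N => E; rewrite expr0; apply: cst 1 _.
  by exists (D + D')%N => E; rewrite exprS; apply: bidegree_leM.
Qed.

Fixpoint atoms (f : ord.formula R) : seq (GRing.term R) :=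
  match f with
  | ord.Equal t1 t2 | ord.Lt t1 t2 | ord.Le t1 t2 => [:: GRing.Add t1 (GRing.Opp t2)]
  | ord.And f1 f2 | ord.Or f1 f2 | ord.Implies f1 f2 => atoms f1 ++ atoms f2
  | ord.Not f1 => atoms f1
  | _ => [::]
  end.

Lemma rterm_atoms f t : ord.rformula f -> List.In t (atoms f) -> GRing.rterm t.
Proof.
elim: f => //= [t1 t2|t1 t2|t1 t2|f1 IH1 f2 IH2|f1 IH1 f2 IH2|f1 IH1 f2 IH2].
all: try by move=> h [<-|].
all: by move=> /andP[/IH1 h1 /IH2 h2] /List.in_app_iff[/h1|/h2].
Qed.

Lemma qf_eval_signs f e e' : ord.qf_form f -> ord.rformula f ->
  (forall t, List.In t (atoms f) -> Num.sg (GRing.eval e t) = Num.sg (GRing.eval e' t)) ->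
  ord.qf_eval e f = ord.qf_eval e' f.
Proof.
elim: f => //= [t1 t2|t1 t2|t1 t2|f1 IH1 f2 IH2|f1 IH1 f2 IH2|f1 IH1 f2 IH2|f1 IH1].
1,2,3: move=> _ _ /(_ _ (or_introl erefl)) /= h.
- by rewrite -!(subr_eq0 (GRing.eval _ t1)) -sgr_eq0 h sgr_eq0.
- by rewrite -!(subr_lt0 _ (GRing.eval _ t1)) -sgr_lt0 h sgr_lt0.
- by rewrite -!(subr_le0 _ (GRing.eval _ t1)) -sgr_le0 h sgr_le0.
1,2,3: move=> /andP[q1 q2] /andP[r1 r2] h; rewrite IH1 ?IH2 // => t tf;
  by apply: h; apply/List.in_app_iff; (by left) || (by right).
by move=> q1 r1 h; rewrite IH1.
Qed.

(** Quantifier elimination leaves a Boolean combination of sign conditions on the atoms. [D] is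
    chosen before [E], which later gives the same finite set of slopes for all radii. *)
Lemma definable_signs (P : seq R -> Prop) : definable P ->
  exists D (hs : R -> seq {poly {poly R}}),
    (forall E h, h \in hs E -> bidegree_le D h) /\
    forall E A B B',
      (forall h, h \in hs E -> Num.sg (horner2 h A B) = Num.sg (horner2 h A B')) ->
      P [:: E; A; B] -> P [:: E; A; B'].
Proof.
move=> [f0 Pf]; pose f := ord.to_rform f0.
have rf : ord.rformula f by apply: ord.to_rform_rformula.
pose g := ord.quantifier_elim (@wproj R) f.
have /andP[qg rg] : ord.qf_form g && ord.rformula g.
  exact: (ord.quantifier_elim_wf (@wf_QE_wproj R)).
have Pg e : P e <-> ord.qf_eval e g.
  rewrite Pf -ord.to_rformP.
  by split=> [/(ord.quantifier_elim_rformP (@wf_QE_wproj R) (@valid_QE_wproj R) e rf)|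
              /(ord.quantifier_elim_rformP (@wf_QE_wproj R) (@valid_QE_wproj R) e rf)].
have [D bD] : exists D, forall E t, List.In t (atoms g) -> bidegree_le D (bipoly_of_term E t).
  elim: (atoms g) => [|t s [D IH]]; first by exists 0%N.
  have [D' h] := bidegree_bipoly t; exists (D + D')%N => E u [<-|us]; first exact: bidegree_le_mono (leq_addl _ _) (h E).
  exact: bidegree_le_mono (leq_addr _ _) (IH E u us).
exists D, (fun E => map (bipoly_of_term E) (atoms g)); split.
  move=> E h; elim: (atoms g) (bD E) => //= t s IH bs; rewrite inE.
  by move=> /orP[/eqP->|]; [apply: bs; left|apply: IH => u us; apply: bs; right].
move=> E A B B' h /Pg Pe; apply/Pg; rewrite -(@qf_eval_signs g [:: E; A; B]) //.
move=> t tg; rewrite !eval_bipoly ?(rterm_atoms rg tg) //.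
apply: h; elim: (atoms g) tg => //= u s IH [->|/IH]; rewrite inE ?eqxx //.
by move=> ->; rewrite orbT.
Qed.

End SignConditions.

(** * Newton polygons *)

Section Newton.
Variable R : realType.

Lemma horner2E D (h : {poly {poly R}}) A B : bidegree_le D h ->
  horner2 h A B = \sum_(i : 'I_D.+1 * 'I_D.+1) h`_i.2`_i.1 * (A ^+ i.1 * B ^+ i.2).
Proof.
move=> [sh ch]; rewrite /horner2 (horner_coef_wide _ sh) horner_sum.
rewrite -(pair_bigA _ (fun j l : 'I_D.+1 => h`_l`_j * (A ^+ j * B ^+ l))) /=.
rewrite exchange_big; apply: eq_bigr => l _.
rewrite !hornerE (horner_coef_wide _ (ch l)) mulr_suml.
by apply: eq_bigr => j _; rewrite mulrA.
Qed.

(** If A^i B^l and A^j B^l' are comparable with l <> l', then ln B is within a constant of (j - i) /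
    (l - l') times ln A. Equal exponents of B contribute 0, by the convention on division by 0. *)
Definition slopes D : seq R :=
  [seq (p.1.1%:R - p.1.2%:R) / (p.2.1%:R - p.2.2%:R) |
    p : ('I_D.+1 * 'I_D.+1) * ('I_D.+1 * 'I_D.+1)].

(** A term of largest modulus is cancelled by the other terms, so these cannot all be smaller than
    it by the factor [#|I|]. *)
Lemma sum0_comparable (I : finType) (t : I -> R) (i0 : I) :
  \sum_i t i = 0 -> t i0 != 0 ->
  exists i j, [/\ i != j, t i != 0, t j != 0, `|t j| <= `|t i| &
                  `|t i| <= #|I|%:R * `|t j|].
Proof.
move=> t0 ti0.
have [i _ imax] := @arg_maxP _ _ I i0 xpredT (fun i => `|t i|) isT.
have ti : t i != 0.
  by rewrite -normr_gt0; apply: lt_le_trans (imax i0 isT); rewrite normr_gt0.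
have [/existsP[j /andP[ji tij]]|/existsPn nex] :=
  boolP [exists j, (j != i) && (`|t i| <= #|I|%:R * `|t j|)].
  exists i, j; split=> //; first by rewrite eq_sym.
    by apply: contraTneq tij => ->; rewrite normr0 mulr0 -ltNge normr_gt0.
  exact: imax.
have I0 : (0 < #|I|%:R :> R) by rewrite ltr0n; apply/card_gt0P; exists i.
move: t0; rewrite (bigD1 i) //= => /eqP; rewrite addr_eq0 => /eqP tiE.
have : `|t i| <= \sum_(j | j != i) `|t j|.
  by rewrite tiE normrN ler_norm_sum.
rewrite leNgt => /negP[].
apply: (@le_lt_trans _ _ (\sum_(j | j != i) (`|t i| / #|I|%:R))).
  apply: ler_sum => j ji; move: (nex j); rewrite ji /= -ltNge => /ltW.
  by rewrite ler_pdivlMr // mulrC.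
rewrite sumr_const -(mulr_natr (_ / _)) mulrAC -mulrA gtr_pMr ?normr_gt0 //.
rewrite ltr_pdivrMr // mul1r ltr_nat.
rewrite [X in (_ < X)%N](cardD1 i) inE /= add1n ltnS.
by apply: subset_leq_card; apply/fintype.subsetP => j; rewrite !inE andbT.
Qed.

(** Two comparable monomials of [h] give, after taking logarithms, an almost linear relation between
    ln A and ln B; the coefficients and the number of monomials only affect the constant. *)
Lemma newton_slope D (h : {poly {poly R}}) : h != 0 -> bidegree_le D h ->
  exists C delta, 0 < delta /\ forall A B, 0 < A -> A < delta -> 0 < B ->
    horner2 h A B = 0 -> exists2 q, q \in slopes D & `|ln B - q * ln A| <= C.
Proof.
move=> h0 hD; pose I := ('I_D.+1 * 'I_D.+1)%type.
pose c (i : I) := h`_i.2`_i.1.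
have [i0 ci0] : exists i, c i != 0.
  have [sh ch] := hD; move: (h0); rewrite -lead_coef_eq0 lead_coefE => l0.
  have lt2 : ((size h).-1 < D.+1)%N.
    by apply: leq_trans sh; rewrite prednK // size_poly_gt0.
  have lt1 : ((size (h`_(size h).-1)%R).-1 < D.+1)%N.
    by apply: leq_trans (ch (size h).-1); rewrite prednK // size_poly_gt0.
  by exists (Ordinal lt1, Ordinal lt2); rewrite /c /= -lead_coefE lead_coef_eq0.
pose K := ln (#|{: I}|%:R : R) + \sum_(i : I) `|ln `|c i| |
   + \sum_(i : I) `|ln `|c i| |.
have cK i : `|ln `|c i| | <= \sum_(i : I) `|ln `|c i| |.
  by rewrite (bigD1 i) //= lerDl sumr_ge0.
(* Below this radius |ln A| exceeds [K], so the two comparable monomials cannot have the same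
   exponent in B. *)
exists K, (expR (- K - 1)); split=> [|A B A0 Ad B0 hAB]; first exact: expR_gt0.
have lnA : ln A < - K - 1 by rewrite -(expRK (- K - 1)) ltr_ln ?posrE ?expR_gt0.
pose t (i : I) := c i * (A ^+ i.1 * B ^+ i.2).
have AB0 (i : I) : 0 < A ^+ i.1 * B ^+ i.2 by rewrite mulr_gt0 ?exprn_gt0.
have t0 i : (t i == 0) = (c i == 0) by rewrite mulf_eq0 (gt_eqF (AB0 i)) orbF.
have lnt i : t i != 0 -> ln `|t i| = ln `|c i| + (i.1%:R * ln A + i.2%:R * ln B).
  rewrite t0 => ci; rewrite normrM lnM ?posrE ?normr_gt0 ?(gt_eqF (AB0 i)) //.
  rewrite (gtr0_norm (AB0 i)) lnM ?posrE ?exprn_gt0 //.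
  by rewrite !lnXn // !mulr_natl.
have [||i [j [ij ti tj]]] := @sum0_comparable _ t i0.
- by rewrite -horner2E.
- by rewrite t0.
have I0 : (0 < #|{: I}|%:R :> R) by rewrite ltr0n; apply/card_gt0P; exists i.
rewrite -ler_ln ?posrE ?normr_gt0 // => le1.
rewrite -ler_ln ?posrE ?mulr_gt0 ?normr_gt0 //.
rewrite lnM ?posrE ?normr_gt0 //.
move: le1; rewrite !lnt // => le1 le2.
have {le1 le2} : `|(i.2%:R - j.2%:R) * ln B + (i.1%:R - j.1%:R) * ln A| <= K.
  have := cK i; have := cK j; rewrite !ler_norml /K => /andP[? ?] /andP[? ?].
  apply/andP; lra.
have natr_dist (a b : nat) : a != b -> 1 <= `|a%:R - b%:R : R|.
  rewrite neq_ltn => /orP[] ab.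
    by rewrite distrC ger0_norm -?natrB ?ler0n // 1?ltnW // ler1n subn_gt0.
  by rewrite ger0_norm -?natrB ?ler0n // 1?ltnW // ler1n subn_gt0.
have [eq2|ne2] := eqVneq i.2 j.2.
  have ne1 : i.1 != j.1.
    apply: contraNneq ij => eq1; apply/eqP.
    by rewrite (surjective_pairing i) eq1 eq2 -surjective_pairing.
  rewrite eq2 subrr mul0r add0r normrM => le; exfalso.
  have : `|ln A| <= K.
    apply: le_trans le; rewrite ler_peMl //; exact: natr_dist.
  by rewrite ler_norml => /andP[+ _]; lra.
move=> le; exists ((j.1%:R - i.1%:R) / (i.2%:R - j.2%:R)).
  by apply/mapP; exists ((j.1, i.1), (i.2, j.2)); rewrite ?mem_enum.
have d1 : 1 <= `|i.2%:R - j.2%:R : R| by apply: natr_dist.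
have d0 : (i.2%:R - j.2%:R : R) != 0.
  by rewrite -normr_gt0; apply: lt_le_trans d1.
apply: le_trans le.
have -> : (i.2%:R - j.2%:R) * ln B + (i.1%:R - j.1%:R) * ln A =
  (i.2%:R - j.2%:R) * (ln B - (j.1%:R - i.1%:R) / (i.2%:R - j.2%:R) * ln A).
  by field.
by rewrite [leRHS]normrM ler_peMl.
Qed.

Lemma horner2_slice (h : {poly {poly R}}) A B :
  horner2 h A B = (map_poly (horner_eval A) h).[B].
Proof.
rewrite -[X in _ = _.[X]](hornerC B A) -[X in _ = _.[X]]/(horner_eval A B%:P).
by rewrite horner_map.
Qed.

Lemma sgr_near (x y : R) : `|y - x| < `|x| -> Num.sg y = Num.sg x.
Proof.
have [x0|x0|->] := ltrgtP x 0; last by rewrite normr0 ltNge normr_ge0.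
  rewrite (ltr0_norm x0) ltr_norml => /andP[h1 h2].
  by rewrite !ltr0_sg //; lra.
rewrite (gtr0_norm x0) ltr_norml => /andP[h1 h2].
by rewrite !gtr0_sg //; lra.
Qed.

(** A slice that vanishes identically keeps the sign 0; any other slice is nonzero at [nu] and keeps
    its sign by continuity. *)
Lemma slices_sign_near (hs : seq {poly {poly R}}) A nu :
  (forall h, h \in hs -> map_poly (horner_eval A) h != 0 -> horner2 h A nu != 0) ->
  exists2 d, 0 < d & forall B, `|B - nu| < d -> forall h, h \in hs ->
    Num.sg (horner2 h A B) = Num.sg (horner2 h A nu).
Proof.
elim: hs => [|h hs IH] h0; first by exists 1.
have [|d d0 hd] := IH; first by move=> g gs; apply: h0; rewrite inE gs orbT.
have [sl0|sl0] := eqVneq (map_poly (horner_eval A) h) 0.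
  exists d => // B Bd g; rewrite inE => /orP[/eqP->|]; last exact: hd.
  by rewrite !horner2_slice sl0 !horner0.
have := h0 h (mem_head _ _) sl0; rewrite horner2_slice -normr_gt0 => v0.
have [d' d'0 hd'] := @poly_cont R nu (map_poly (horner_eval A) h) _ v0.
exists (Num.min d d') => [|B]; first by rewrite lt_min d0.
rewrite lt_min => /andP[Bd Bd'] g; rewrite inE => /orP[/eqP->|]; last exact: hd.
by rewrite !horner2_slice; apply: sgr_near; exact: hd'.
Qed.

Lemma newton_slopes D' (hs : seq {poly {poly R}}) :
  (forall h, h \in hs -> bidegree_le D' h) ->
  exists C delta, 0 < delta /\ forall h, h \in hs -> h != 0 ->
    forall A B, 0 < A -> A < delta -> 0 < B -> horner2 h A B = 0 ->
    exists2 q, q \in slopes D' & `|ln B - q * ln A| <= C.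
Proof.
elim: hs => [|h hs IH] hD; first by exists 0, 1.
have [|C [d [d0 hd]]] := IH; first by move=> g gs; apply: hD; rewrite inE gs orbT.
have [->|h0] := eqVneq h 0.
  exists C, d; split=> // g; rewrite inE => /orP[/eqP->|]; last exact: hd.
  by rewrite eqxx.
have [C' [d' [d'0 hd']]] := newton_slope h0 (hD h (mem_head _ _)).
exists (Num.max C C'), (Num.min d d'); split=> [|g]; first by rewrite lt_min d0.
rewrite inE => /orP[/eqP-> _|gs g0] A B A0; rewrite lt_min => /andP[Ad Ad'] B0 hAB.
  have [q qs hq] := hd' A B A0 Ad' B0 hAB.
  by exists q => //; rewrite le_max hq orbT.
have [q qs hq] := hd g gs g0 A B A0 Ad B0 hAB.
by exists q => //; rewrite le_max hq.
Qed.

Lemma seq_max (s : seq R) : s != [::] -> exists2 q, q \in s & forall x, x \in s -> x <= q.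
Proof.
case: s => // x s _; elim: s x => [|y s IH] x.
  by exists x; rewrite ?mem_head // => z; rewrite inE => /eqP->.
have [q qs hq] := IH y; have [xq|/ltW qx] := leP x q.
  exists q; first by rewrite inE qs orbT.
  by move=> z; rewrite inE => /orP[/eqP->|/hq].
exists x; first exact: mem_head.
by move=> z; rewrite inE => /orP[/eqP->//|/hq /le_trans]; apply.
Qed.

(* The exponent is the largest slope that recurs as A tends to 0. *)
Lemma dominant_slope (dom : set R) (nu : R -> R) (Q : seq R) C d0 : 0 < d0 ->
  (forall d, 0 < d -> exists A, [/\ dom A, 0 < A & A < d]) ->
  (forall A, dom A -> 0 < A -> A < d0 ->
     exists2 q, q \in Q & `|ln (nu A) - q * ln A| <= C) ->
  exists q, [/\ q \in Q,
    (exists C' d, 0 < d /\ forall A, dom A -> 0 < A -> A < d ->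
       q * ln A - C' <= ln (nu A)) &
    (forall eta K d, eta < q -> 0 < d ->
       exists A, [/\ dom A, 0 < A, A < d & ln (nu A) < eta * ln A - K])].
Proof.
move=> d0_gt0 acc hQ.
pose freq q := forall d, 0 < d ->
  exists A, [/\ dom A, 0 < A, A < d & `|ln (nu A) - q * ln A| <= C].
(* As [Q] is finite, all slopes that stop occurring near 0 are excluded below a common bound
   [d1]. *)
have [d1 d1_gt0 hd1] : exists2 d, 0 < d & forall q A, q \in Q -> dom A -> 0 < A ->
    A < d -> `|ln (nu A) - q * ln A| <= C -> freq q.
  elim: (Q) => [|q s [d dgt0 IH]]; first by exists 1.
  have [fq|nfq] := pselect (freq q).
    by exists d => // q' A; rewrite inE => /orP[/eqP->//|]; apply: IH.
  have [d' nd'] : exists d', ~ (0 < d' -> exists A,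
      [/\ dom A, 0 < A, A < d' & `|ln (nu A) - q * ln A| <= C]).
    by apply/existsNP.
  have [d'gt0|] := ltP 0 d'; last by move=> le; case: nd'; rewrite ltNge le.
  exists (Num.min d d'); first by rewrite lt_min dgt0.
  move=> q' A; rewrite inE lt_min => /orP[/eqP->|q's] domA A0 /andP[Ad Ad'] le.
    by case: nd' => _; exists A.
  exact: IH le.
pose Qf := [seq q <- Q | `[< freq q >]].
have [|q qQf qmax] := @seq_max Qf.
  have [|A [domA A0]] := acc (Num.min d0 d1); first by rewrite lt_min d0_gt0.
  rewrite lt_min => /andP[Ad0 Ad1]; have [q qQ hq] := hQ A domA A0 Ad0.
  have : q \in Qf by rewrite mem_filter qQ andbT; apply/asboolP; apply: hd1 hq.
  by case: (Qf).
move: qQf; rewrite mem_filter => /andP[/asboolP fq qQ]; exists q; split=> //.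
  exists C, (Num.min 1 (Num.min d0 d1)); split; first by rewrite !lt_min ltr01 d0_gt0.
  move=> A domA A0; rewrite !lt_min => /and3P[A1 Ad0 Ad1].
  have [q' q'Q hq'] := hQ A domA A0 Ad0.
  have q'q : q' <= q.
    by apply: qmax; rewrite mem_filter q'Q andbT; apply/asboolP; apply: hd1 hq'.
  have lnA : ln A < 0 by rewrite ln_lt0 // A0.
  move: hq'; rewrite ler_norml => /andP[h1 h2].
  have : q * ln A <= q' * ln A by rewrite ler_nM2r.
  lra.
move=> eta K d etaq d_gt0.
(* [A < z] means (q - eta) ln A < - (|C + K| + 1), which absorbs both additive constants. *)
pose z := expR (- (`|C + K| + 1) / (q - eta)).
have [|A [domA A0 + hA]] := fq (Num.min d z).
  by rewrite lt_min d_gt0 expR_gt0.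
rewrite lt_min => /andP[Ad Az]; exists A; split=> //.
have lnA : ln A < - (`|C + K| + 1) / (q - eta).
  by rewrite -(expRK (_ / _)) ltr_ln ?posrE ?expR_gt0.
move: lnA; rewrite ltr_pdivlMr ?subr_gt0 // => lnA.
move: hA; rewrite ler_norml => /andP[h1 h2].
have := ler_norm (C + K); lra.
Qed.

End Newton.

(** * Euclidean norms *)

Section Norms.
Variables (R : realType) (s : scalars).
Local Notation K := (scalar_field R s).

(** Being polynomial in the real coordinates, the squared modulus fits into first-order formulas;
    [knormE] leads back to the norm. *)
Definition abs2 : K -> R :=
  match s return scalar_field R s -> R with
  | RealScalars => fun x => x ^+ 2
  | ComplexScalars => fun z => complex.Re z ^+ 2 + complex.Im z ^+ 2
  end.

Definition knorm2 d (x : 'rV[K]_d) : R := \sum_j abs2 (x 0 j).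

Lemma abs2_ge0 x : 0 <= abs2 x.
Proof.
rewrite /abs2; case: s x => [x|z]; first exact: sqr_ge0.
by rewrite addr_ge0 ?sqr_ge0.
Qed.

Lemma abs2_eq0 x : abs2 x = 0 -> x = 0.
Proof.
rewrite /abs2; case: s x => [x /eqP|[a b] /eqP] /=.
  by rewrite sqrf_eq0 => /eqP.
by rewrite paddr_eq0 ?sqr_ge0 // !sqrf_eq0 => /andP[/eqP-> /eqP->].
Qed.

Lemma abs20 : abs2 0 = 0.
Proof. by rewrite /abs2; case: s => /=; rewrite expr0n /= ?addr0. Qed.

Lemma abs2N x : abs2 (- x) = abs2 x.
Proof. by rewrite /abs2; case: s x => [x|[a b]] /=; rewrite !sqrrN. Qed.

Lemma abs2D x y : abs2 (x + y) <= 2 * (abs2 x + abs2 y).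
Proof.
rewrite /abs2; case: s x y => [x y|[a b] [c d]] /=.
  by rewrite -subr_ge0 [leRHS](_ : _ = (x - y) ^+ 2) ?sqr_ge0 //; ring.
rewrite -subr_ge0 [leRHS](_ : _ = (a - c) ^+ 2 + (b - d) ^+ 2); last by ring.
by rewrite addr_ge0 ?sqr_ge0.
Qed.

Lemma abs2M x y : abs2 (x * y) = abs2 x * abs2 y.
Proof.
by rewrite /abs2; case: s x y => [x y|[a b] [c d]] /=; ring.
Qed.

Lemma abs2_lt_norm (e : K) : 0 < e ->
  exists2 d, 0 < d & forall x, abs2 x < d -> `|x| < e.
Proof.
rewrite /abs2; case: s e => [e e0|e e0] /=.
  exists (e ^+ 2) => [|x]; first exact: exprn_gt0.
  by rewrite -real_normK ?num_real // ltr_pXn2r ?nnegrE // ltW.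
have [r r0 ->] : exists2 r, 0 < r & e = r%:C%C.
  by case: e e0 => a b; rewrite ltcE /= => /andP[/eqP-> a0]; exists a.
exists (r ^+ 2) => [|x hx]; first exact: exprn_gt0.
rewrite normc_def ltcR -(ltr_pXn2r (_ : 0 < 2)%N) ?nnegrE ?sqrtr_ge0 ?ltW //.
by rewrite sqr_sqrtr // addr_ge0 ?sqr_ge0.
Qed.

Lemma norm_lt_abs2 d : 0 < d ->
  exists2 e : K, 0 < e & forall x, `|x| < e -> abs2 x < d.
Proof.
move=> d0; have sd0 : 0 < Num.sqrt d by rewrite sqrtr_gt0.
have sd2 : Num.sqrt d ^+ 2 = d by rewrite sqr_sqrtr // ltW.
rewrite /abs2; case: s => /=.
  exists (Num.sqrt d) => // x.
  by rewrite -[X in _ -> X < _]real_normK ?num_real // -[in X in _ -> X]sd2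
     ltr_pXn2r ?nnegrE // ltW.
exists (Num.sqrt d)%:C%C => [|x]; first by rewrite ltcR.
rewrite normc_def ltcR -(ltr_pXn2r (_ : 0 < 2)%N) ?nnegrE ?sqrtr_ge0 //.
by rewrite sd2 sqr_sqrtr // addr_ge0 ?sqr_ge0.
Qed.

Lemma knormE d (x : 'rV[K]_d) : knorm x = Num.sqrt (knorm2 x).
Proof.
rewrite /knorm /enorm /knorm2 /abs2 /realify; case: s x => //= x.
congr Num.sqrt; rewrite big_split_ord /= -big_split /=.
by apply: eq_bigr => j _; rewrite row_mxEl row_mxEr !mxE.
Qed.

Lemma knorm2_ge0 d (x : 'rV[K]_d) : 0 <= knorm2 x.
Proof. by apply: sumr_ge0 => j _; apply: abs2_ge0. Qed.

Lemma knorm_ge0 d (x : 'rV[K]_d) : 0 <= knorm x.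
Proof. by rewrite knormE sqrtr_ge0. Qed.

Lemma sqr_knorm d (x : 'rV[K]_d) : knorm x ^+ 2 = knorm2 x.
Proof. by rewrite knormE sqr_sqrtr ?knorm2_ge0. Qed.

Lemma knorm_lt d (x : 'rV[K]_d) e : 0 < e -> (knorm x < e) = (knorm2 x < e ^+ 2).
Proof. by move=> e0; rewrite -sqr_knorm ltr_pXn2r ?nnegrE ?knorm_ge0 ?ltW. Qed.

Lemma knorm_le d (x : 'rV[K]_d) e : 0 <= e -> (knorm x <= e) = (knorm2 x <= e ^+ 2).
Proof. by move=> e0; rewrite -sqr_knorm ler_pXn2r ?nnegrE ?knorm_ge0. Qed.

Lemma knorm2_eq0 d (x : 'rV[K]_d) : knorm2 x = 0 -> x = 0.
Proof.
move=> /eqP; rewrite psumr_eq0 => [/allP h|j _]; last exact: abs2_ge0.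
apply/rowP => j; rewrite mxE; apply: abs2_eq0; apply/eqP.
by move: (h j); rewrite mem_index_enum => /(_ isT).
Qed.

Lemma knorm2_gt0 d (y : 'rV[K]_d) : y != 0 -> 0 < knorm2 y.
Proof.
move=> y0; rewrite lt_def knorm2_ge0 andbT.
by apply: contraNneq y0 => /knorm2_eq0/eqP.
Qed.

Lemma knorm20 d : knorm2 (0 : 'rV[K]_d) = 0.
Proof. by rewrite /knorm2 big1 // => j _; rewrite mxE abs20. Qed.

Lemma knorm2N d (x : 'rV[K]_d) : knorm2 (- x) = knorm2 x.
Proof. by apply: eq_bigr => j _; rewrite mxE abs2N. Qed.

Lemma knorm2D d (x y : 'rV[K]_d) : knorm2 (x + y) <= 2 * (knorm2 x + knorm2 y).
Proof.
rewrite /knorm2 -big_split /= mulr_sumr; apply: ler_sum => j _.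
by rewrite mxE abs2D.
Qed.

Lemma abs2_le_knorm2 d (x : 'rV[K]_d) j : abs2 (x 0 j) <= knorm2 x.
Proof.
by rewrite /knorm2 (bigD1 j) //= lerDl sumr_ge0 // => i _; apply: abs2_ge0.
Qed.

(** Each addition costs a factor 2 by [abs2D], whence the power of 2 in the constant. *)
Lemma abs2_sum (I : finType) (u : I -> K) :
  exists2 C, 0 < C & forall P : pred I, forall v : I -> K,
    abs2 (\sum_(i | P i) u i * v i) <= C * \sum_(i | P i) abs2 (v i).
Proof.
pose C0 := 1 + \sum_i abs2 (u i).
have C00 : 0 < C0 by rewrite ltr_wpDr // sumr_ge0 // => i _; apply: abs2_ge0.
exists (C0 * 2 ^+ size (index_enum I)) => [|P v]; first by rewrite mulr_gt0 // exprn_gt0.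
suff : forall r : seq I, abs2 (\sum_(i <- r | P i) u i * v i) <=
    2 ^+ size r * (C0 * \sum_(i <- r | P i) abs2 (v i)).
  by move=> /(_ (index_enum I)); rewrite mulrCA mulrA.
elim=> [|i r IH]; first by rewrite !big_nil abs20 !mulr0.
have S0 : 0 <= \sum_(i <- r | P i) abs2 (v i).
  by apply: sumr_ge0 => j _; apply: abs2_ge0.
rewrite !big_cons; case: (P i) => /=; last first.
  apply: le_trans IH _; apply: ler_wpM2r; first by rewrite mulr_ge0 // ltW.
  by rewrite /= exprS ler_peMl ?exprn_ge0 // ler1n.
apply: le_trans (abs2D _ _) _; rewrite exprS -mulrA ler_pM2l //.
rewrite mulrDr mulrDr lerD // abs2M.
rewrite -[leLHS]mul1r ler_pM ?mulr_ge0 ?abs2_ge0 ?exprn_ege1 ?ler1n //.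
rewrite ler_wpM2r ?abs2_ge0 // /C0 (bigD1 i) //= addrCA lerDl addr_ge0 //.
by rewrite sumr_ge0 // => j _; apply: abs2_ge0.
Qed.

Lemma knorm2_mulmx m k (L : 'M[K]_(m, k)) :
  exists2 C, 0 < C & forall y : 'rV_m, knorm2 (y *m L) <= C * knorm2 y.
Proof.
have /choice[C hC] (j : 'I_k) : exists C, 0 < C /\ forall y : 'rV[K]_m,
    abs2 ((y *m L) 0 j) <= C * knorm2 y.
  have [C C0 hC] := abs2_sum (fun i => L i j); exists C; split=> // y.
  rewrite mxE; under eq_bigr do rewrite mulrC; exact: hC.
exists (1 + \sum_j C j) => [|y].
  by rewrite ltr_wpDr // sumr_ge0 // => j _; rewrite ltW //; case: (hC j).
rewrite mulrDl mul1r -[leLHS]add0r lerD ?knorm2_ge0 // mulr_suml.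
by apply: ler_sum => j _; case: (hC j).
Qed.

Lemma knorm_nbhsP d (x : 'rV[K]_d) (U : set 'rV[K]_d) :
  nbhs x U <-> exists2 e, 0 < e & forall y, knorm (y - x) < e -> U y.
Proof.
split=> [/nbhs_ballP[e /= e0 hU]|[e e0 hU]].
  have [r r0 hr] := abs2_lt_norm e0; exists (Num.sqrt r) => [|y].
    by rewrite sqrtr_gt0.
  rewrite knorm_lt ?sqrtr_gt0 // sqr_sqrtr ?ltW // => yx.
  apply: hU; rewrite /ball /= /mx_ball; split=> // i j.
  rewrite -ball_normE /= distrC ord1; apply: hr.
  by have := abs2_le_knorm2 (y - x) j; rewrite !mxE => /le_lt_trans; apply.
(* Dividing by [d.+1] rather than by [d] keeps the sum of the d terms strictly below e^2, also when
   d = 0. *)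
have d0 : 0 < e ^+ 2 / d.+1%:R by rewrite divr_gt0 ?exprn_gt0 ?ltr0n.
have [r r0 hr] := norm_lt_abs2 d0.
apply/nbhs_ballP; exists r => // y /= [_ yx]; apply: hU.
rewrite knorm_lt //; apply: le_lt_trans (_ : \sum_(j < d) e ^+ 2 / d.+1%:R < _).
  apply: ler_sum => j _; apply: ltW; apply: hr; rewrite !mxE.
  by move: (yx 0 j); rewrite -ball_normE /= distrC.
rewrite sumr_const card_ord -(mulr_natr (_ / _)) mulrAC -mulrA.
by rewrite gtr_pMr ?exprn_gt0 // ltr_pdivrMr ?ltr0n // mul1r ltr_nat.
Qed.

Lemma realify_add d (x y : 'rV[K]_d) : realify (x + y) = realify x + realify y.
Proof.
rewrite /realify; case: s x y => // x y /=.
rewrite add_row_mx; congr row_mx; apply/rowP => j; rewrite !mxE //.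
  by case: (x 0 j) (y 0 j) => [a b] [].
by case: (x 0 j) (y 0 j) => [a b] [].
Qed.

Lemma realifyN d (x : 'rV[K]_d) : realify (- x) = - realify x.
Proof.
rewrite /realify; case: s x => // x /=.
by rewrite opp_row_mx; congr row_mx; apply/rowP => j; rewrite !mxE //;
  case: (x 0 j).
Qed.

Lemma realifyB d (x y : 'rV[K]_d) : realify (x - y) = realify x - realify y.
Proof. by rewrite realify_add realifyN. Qed.

Lemma realify_bij d : exists g : 'rV[R]_(real_size s d) -> 'rV[K]_d,
  cancel (@realify R s d) g /\ cancel g (@realify R s d).
Proof.
rewrite /realify; case: s => /=; first by exists id.
exists (fun v : 'rV[R]_(d + d) => \row_j (v 0 (lshift d j) +i* v 0 (rshift d j))%C).
split=> [x|v].
  by apply/rowP => j; rewrite mxE row_mxEl row_mxEr !mxE; case: (x 0 j).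
apply/rowP => j; case: (split_ordP j) => k ->; by rewrite ?row_mxEl ?row_mxEr !mxE.
Qed.

Lemma realify_inj d : injective (@realify R s d).
Proof. by have [g [gK _]] := realify_bij d; apply: can_inj gK. Qed.

(* The matrix of a K-linear mapping in the real coordinates given by realify. *)
Definition realify_mx m k (L : 'M[K]_(m, k)) : 'M[R]_(real_size s m, real_size s k) :=
  match s return 'M[scalar_field R s]_(m, k) -> 'M[R]_(real_size s m, real_size s k) with
  | RealScalars => id
  | ComplexScalars => fun L =>
      block_mx (map_mx (@complex.Re R) L) (map_mx (@complex.Im R) L)
        (- map_mx (@complex.Im R) L) (map_mx (@complex.Re R) L)
  end L.

Lemma realify_mulmx m k (L : 'M[K]_(m, k)) (y : 'rV_m) :
  realify (y *m L) = realify y *m realify_mx L.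
Proof.
rewrite /realify /realify_mx; case: s L y => // L y /=.
rewrite mul_row_block; congr row_mx; apply/rowP => j; rewrite !mxE.
  rewrite (raddf_sum (@complex.Re R)) -big_split /=; apply: eq_bigr => i _.
  by rewrite !mxE; case: (y 0 i) (L i j) => [a b] [c e] /=; rewrite mulrN.
rewrite (raddf_sum (@complex.Im R)) -big_split /=; apply: eq_bigr => i _.
by rewrite !mxE; case: (y 0 i) (L i j) => [a b] [c e] /=; rewrite addrC.
Qed.

End Norms.

(** * Existence of the Lojasiewicz exponent *)

Section LojasiewiczExponent.
Variables (R : realType) (s : scalars).
Local Notation K := (scalar_field R s).

Lemma realify_inv_continuous d (g : 'rV[R]_(real_size s d) -> 'rV[K]_d) :
  cancel g (@realify R s d) -> continuous g.
Proof.
move=> gK v U /knorm_nbhsP[e e0 hU].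
apply/(@knorm_nbhsP R RealScalars); exists e => // w hw; apply: hU.
by move: hw; rewrite /knorm (realifyB (g w)) !gK.
Qed.

Lemma closed_realify d (X : set 'rV[K]_d) : closed X -> closed (@realify R s d @` X).
Proof.
move=> cX v cv; have [g [gK gK']] := realify_bij R s d.
exists (g v) => //; apply: cX => U /knorm_nbhsP[e e0 hU].
have [|_ [[x Xx <-] xv]] := cv [set w | enorm (w - v) < e].
  by apply/(@knorm_nbhsP R RealScalars); exists e.
exists x; split=> //; apply: hU.
by rewrite /knorm realifyB gK'.
Qed.

Lemma compact_knorm_le d (X : set 'rV[K]_d) r : closed X ->
  compact (X `&` [set x | knorm x <= r]).
Proof.
move=> cX; have [g [gK gK']] := realify_bij R s d.
pose Y := @realify R s d @` (X `&` [set x | knorm x <= r]).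
have -> : X `&` [set x | knorm x <= r] = g @` Y.
  apply/seteqP; split=> [x Ax|_ [_ [x Ax <-] <-]].
    by exists (realify x); [exists x|rewrite gK].
  by rewrite gK.
apply: continuous_compact.
  by apply: continuous_subspaceT; apply: realify_inv_continuous.
apply: bounded_closed_compact.
  exists r; split; first exact: num_real.
  move=> M rM _ [x [_ /= xr] <-].
  have r0 : 0 <= r by apply: le_trans xr; apply: knorm_ge0.
  rewrite /Num.norm /= mx_normrE; apply: bigmax_le; first by rewrite ltW // (le_lt_trans r0).
  move=> [i j] _ /=; rewrite ord1; apply: ltW; apply: le_lt_trans rM.
  apply: le_trans xr; rewrite /knorm /enorm -[leLHS]sqrtr_sqr ler_wsqrtr //.
  by rewrite (bigD1 j) //= lerDl sumr_ge0 // => l _; apply: sqr_ge0.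
have -> : Y = (@realify R s d @` X) `&` [set v | enorm v <= r].
  apply/seteqP; split=> [_ [x [Xx xr] <-]|_ [[x Xx <-] xr]]; last by exists x.
  by split=> //; exists x.
apply: closedI; first exact: closed_realify.
have [r0|r0] := leP 0 r; last first.
  rewrite (_ : mkset _ = set0); first exact: closed0.
  apply/seteqP; split=> // v /= vr; suff : 0 <= r by rewrite leNgt r0.
  exact: le_trans (sqrtr_ge0 _) vr.
rewrite (_ : mkset _ = (fun v : 'rV[R]_(real_size s d) => \sum_i v 0 i ^+ 2) @^-1` [set y | y <= r ^+ 2]).
  apply: preimage_closed; last exact: closed_le.
  move=> v _; apply: continuous_big v => [|i _ v]; first exact: add_continuous.
  apply: (@continuousM _ _ (fun v : 'rV[R]_(real_size s d) => v 0 i) (fun v : 'rV[R]_(real_size s d) => v 0 i));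
    exact: (@coord_continuous R 1 _ 0 i v).
apply/seteqP; split=> v /=.
  by rewrite (@knorm_le R RealScalars).
by rewrite -(@knorm_le R RealScalars).
Qed.


Section Distance.
Variables (d : nat) (Z : set 'rV[K]_d).

Lemma dist_to_ge0 x : 0 <= dist_to Z x.
Proof.
rewrite /dist_to; have [->|/set0P[z Zz]] := eqVneq Z set0.
  by rewrite image_set0 inf0.
by apply: lb_le_inf => [|_ [a _ <-]]; [exists (knorm (x - z)), z|apply: knorm_ge0].
Qed.

Lemma dist_to_le x z : Z z -> dist_to Z x <= knorm (x - z).
Proof.
move=> Zz; apply: ge_inf; last by exists z.
by exists 0 => _ [a _ <-]; apply: knorm_ge0.
Qed.

Lemma le_dist_to x r z0 : Z z0 -> (forall z, Z z -> r <= knorm (x - z)) ->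
  r <= dist_to Z x.
Proof.
move=> Zz0 h; apply: lb_le_inf => [|_ [a /h + <-]] //.
by exists (knorm (x - z0)), z0.
Qed.

(** This removes the infimum from the distance and leaves a universally quantified polynomial
    inequality, which a formula can express. *)
Lemma le_dist_to_sqr x A z0 : Z z0 ->
  (A <= dist_to Z x ^+ 2 <-> forall z, Z z -> A <= knorm2 (x - z)).
Proof.
move=> Zz0; split=> [h z Zz|h].
  apply: le_trans h _; rewrite -sqr_knorm ler_pXn2r ?nnegrE ?dist_to_ge0 ?knorm_ge0 //.
  exact: dist_to_le.
have [A0|A0] := leP A 0; first exact: le_trans A0 (sqr_ge0 _).
have sA : Num.sqrt A ^+ 2 = A by rewrite sqr_sqrtr // ltW.
rewrite -sA ler_pXn2r ?nnegrE ?sqrtr_ge0 ?dist_to_ge0 //.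
apply: (le_dist_to Zz0) => z /h; rewrite knormE; exact: ler_wsqrtr.
Qed.

End Distance.

Section Setting.
Variables (N m k : nat) (X D : set 'rV[K]_N) (F : 'rV[K]_N -> 'rV[K]_m).
Hypothesis X_closed : closed X.
Hypothesis X0 : X 0.
Hypothesis D_nbhd : is_nbhd_in X D.
Hypothesis F_continuous : {within D, continuous F}.
Hypothesis F_semialgebraic : semialgebraic (map_graph D F).
Hypothesis F0 : F 0 = 0.
Variable L : 'M[K]_(m, k).
Local Notation G := (lin_comp L F).
Local Notation Z := (zeros D G).

Lemma domain_radius : exists2 e0, 0 < e0 & forall x, X x -> knorm x < e0 -> D x.
Proof.
have [_ [W /knorm_nbhsP[e e0 hW] XW]] := D_nbhd.
by exists e => // x Xx xe; apply: XW; split=> //; apply: hW; rewrite subr0.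
Qed.

Lemma zeros0 : Z 0.
Proof.
have [e0 e00 he0] := domain_radius; split.
  by apply: he0 => //; rewrite knormE knorm20 sqrtr0.
by rewrite /= /lin_comp F0 mul0mx.
Qed.

Lemma continuous_lin_comp a e : D a -> 0 < e -> exists2 r, 0 < r &
  forall x, D x -> knorm (x - a) < r -> knorm2 (G x - G a) < e.
Proof.
move=> Da e0; have [C C0 hC] := knorm2_mulmx L.
have eC0 : 0 < e / C by rewrite divr_gt0.
have /subspace_continuousP/(_ a Da) cF := F_continuous.
have /knorm_nbhsP[r r0 hr] : nbhs a [set x | D x -> knorm (F x - F a) < Num.sqrt (e / C)].
  apply: (cF [set y | knorm (y - F a) < Num.sqrt (e / C)]).
  by apply/knorm_nbhsP; exists (Num.sqrt (e / C)); rewrite ?sqrtr_gt0.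
exists r => // x Dx xa; rewrite /lin_comp -mulmxBl; apply: le_lt_trans (hC _) _.
rewrite mulrC -ltr_pdivlMr //.
by have := hr x xa Dx; rewrite knorm_lt ?sqrtr_gt0 // sqr_sqrtr // ltW.
Qed.

Lemma continuous_lin_comp_neq0 a : D a -> G a != 0 -> exists2 r, 0 < r &
  forall x, D x -> knorm (x - a) < r -> knorm2 (G a) / 4 <= knorm2 (G x).
Proof.
move=> Da Ga.
have Ga0 := knorm2_gt0 Ga.
(* Once |G a - G x|^2 < |G a|^2 / 4, the inequality |G a|^2 <= 2 (|G a - G x|^2 + |G x|^2) leaves at
   least |G a|^2 / 4 for |G x|^2. *)
have [|r r0 hr] := continuous_lin_comp Da (_ : 0 < knorm2 (G a) / 4); first by lra.
exists r => // x Dx /(hr x Dx) h.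
have := knorm2D (G a - G x) (G x); rewrite subrK -(knorm2N (G a - G x)) opprB.
lra.
Qed.

Lemma dist_zeros_gt0 x : D x -> G x != 0 -> 0 < dist_to Z x.
Proof.
move=> Dx Gx; have [r r0 hr] := continuous_lin_comp_neq0 Dx Gx.
apply: lt_le_trans r0 _; apply: (le_dist_to zeros0) => z [Dz Gz].
rewrite leNgt; apply/negP => xz; move: Gx => /eqP; apply.
apply: knorm2_eq0; apply/eqP; rewrite eq_le knorm2_ge0 andbT.
have := hr z Dz; rewrite Gz knorm20 knormE -knorm2N opprB -knormE => /(_ xz).
by rewrite pmulr_lle0 // invr_gt0.
Qed.

(** This says that B is at most the infimum nu(E, A) without naming the infimum, and hence is
    definable. *)
Definition lower_bound E A B := forall x, D x -> knorm2 x <= E ->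
  A <= dist_to Z x ^+ 2 -> B <= knorm2 (G x).

Let nN := real_size s N.
Let nm := real_size s m.
Let Lr := realify_mx L.

Let nrm2 d (v : 'rV[R]_d) := \sum_i v 0 i ^+ 2.

Let nrm2_realify d (x : 'rV[K]_d) : nrm2 (realify x) = knorm2 x.
Proof.
rewrite -sqr_knorm /knorm /enorm sqr_sqrtr // sumr_ge0 // => i _; exact: sqr_ge0.
Qed.

Let xpart o (e : seq R) := lsubmx (block o (nN + nm) e).
Let ypart o (e : seq R) := rsubmx (block o (nN + nm) e) *m Lr.

Let term_fun_ext u v : @term_fun R u -> (forall e, u e = v e) -> term_fun v.
Proof. by move=> [t ht] uv; exists t => e; rewrite -uv. Qed.

Let term_fun_xpart o : term_fun (fun e => nrm2 (xpart o e)).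
Proof.
apply: term_fun_sum => i; apply: term_funX.
by apply: (term_fun_ext (term_fun_var _ (o + i))) => e; rewrite !mxE.
Qed.

Let term_fun_xdiff o o' : term_fun (fun e => nrm2 (xpart o e - xpart o' e)).
Proof.
apply: term_fun_sum => i; apply: term_funX.
apply: (term_fun_ext (term_funD (term_fun_var _ (o + i))
  (term_funN (term_fun_var _ (o' + i))))) => e; by rewrite !mxE.
Qed.

Let term_fun_ypart o : term_fun (fun e => nrm2 (ypart o e)).
Proof.
apply: term_fun_sum => j; apply: term_funX.
apply: (@term_fun_ext (fun e : seq R => \sum_(i < nm) e`_(o + (nN + i)) * Lr i j)) => [|e].
  by apply: term_fun_sum => i; apply: term_funM (term_fun_var _ _) (term_fun_cst _).
by rewrite mxE; apply: eq_bigr => i _; rewrite !mxE.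
Qed.

Let o2 := (3 + (nN + nm))%N.

(** Entries 0, 1 and 2 of the environment hold E, A and B, the block at 3 a point (x, F x) of the
    graph, and the block at [o2] a point (z, F z) with G z = 0. A point and its value are quantified
    together because the graph is what is known to be semialgebraic. *)
Lemma definable_lower_bound :
  exists2 P, definable P & forall E A B, P [:: E; A; B] <-> lower_bound E A B.
Proof.
pose n := (nN + nm)%N.
pose Gamma : set 'rV[R]_n := map_graph D F.
pose P3 (e : seq R) := Gamma (block o2 n e) -> nrm2 (ypart o2 e) = 0 ->
  e`_1 <= nrm2 (xpart 3 e - xpart o2 e).
pose P2 (e : seq R) := forall e', agree_outside o2 n e e' -> P3 e'.
pose P1 (e : seq R) := Gamma (block 3 n e) -> nrm2 (xpart 3 e) <= e`_0 ->
  P2 e -> e`_2 <= nrm2 (ypart 3 e).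
exists (fun e => forall e', agree_outside 3 n e e' -> P1 e').
  apply: definable_forall_block; apply: definable_imp.
    exact: definable_semialgebraic.
  apply: definable_imp; first exact: definable_le (term_fun_xpart _) (term_fun_var _ _).
  apply: definable_imp; last exact: definable_le (term_fun_var _ _) (term_fun_ypart _).
  apply: definable_forall_block; apply: definable_imp.
    exact: definable_semialgebraic.
  apply: definable_imp; first exact: definable_eq (term_fun_ypart _) (term_fun_cst _).
  exact: definable_le (term_fun_var _ _) (term_fun_xdiff _ _).
move=> E A B; have part_graph o e x : block o n e = row_mx (realify x) (realify (F x)) ->
    xpart o e = realify x /\ nrm2 (ypart o e) = knorm2 (G x).
  move=> be; rewrite /xpart /ypart be row_mxKl row_mxKr -nrm2_realify; split=> //.
  by rewrite realify_mulmx.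
split=> [h x Dx xE hA|h e' ee' [x Dx be'] xE hP2].
  pose e := [:: E; A; B]; pose v := row_mx (realify x) (realify (F x)).
  pose e' := @set_block R 3 n e v.
  have ee' : agree_outside 3 n e e' by apply: agree_set_block.
  have be' : block 3 n e' = v by apply: block_set_block.
  have [xe' ye'] := part_graph _ _ _ be'.
  have := h _ ee'; rewrite /P1 -(ee' 0%N) // -(ee' 2%N) // ye' xe'; apply.
  - by exists x.
  - by rewrite nrm2_realify.
  move=> e'' ee'' [z Dz /esym be'']; have [xe'' ye''] := part_graph _ _ _ be''.
  rewrite -(ee'' 1%N) // -(ee' 1%N) // ye'' xe'' => /knorm2_eq0 Gz.
  have be3 : block 3 n e'' = v.
    by rewrite -be'; apply/esym; apply: block_agree ee'' _; rewrite leqnn.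
  have [-> _] := part_graph _ _ _ be3; rewrite -realifyB nrm2_realify.
  by have /(le_dist_to_sqr x A zeros0) := hA; apply.
have [xe' ye'] := part_graph _ _ _ (esym be').
rewrite ye' -(ee' 2%N) //; apply: h => //.
  by move: xE; rewrite xe' nrm2_realify -(ee' 0%N).
apply/(le_dist_to_sqr x A zeros0) => z [Dz Gz].
pose v := row_mx (realify z) (realify (F z)).
pose e'' := @set_block R o2 n e' v.
have ee'' : agree_outside o2 n e' e'' by apply: agree_set_block.
have be'' : block o2 n e'' = v by apply: block_set_block.
have [xe'' ye''] := part_graph _ _ _ be''.
have be3 : block 3 n e'' = row_mx (realify x) (realify (F x)).
  by rewrite be'; apply/esym; apply: block_agree ee'' _; rewrite leqnn.
have [xe3 _] := part_graph _ _ _ be3.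
have := hP2 _ ee''; rewrite /P3 -(ee'' 1%N) // -(ee' 1%N) // ye'' xe'' xe3.
rewrite -realifyB nrm2_realify; apply; first by exists z.
by rewrite Gz knorm20.
Qed.

Lemma near_zeros e : 0 < e -> exists2 r, 0 < r &
  forall x, X x -> knorm x < r -> D x /\ knorm2 (G x) < e.
Proof.
move=> e0; have [r0 r00 hr0] := domain_radius; have [D0 G0] := zeros0.
have [r r_gt0 hr] := continuous_lin_comp D0 e0.
exists (Num.min r r0) => [|x Xx]; first by rewrite lt_min r_gt0.
rewrite lt_min => /andP[xr xr0]; have Dx := hr0 x Xx xr0; split=> //.
by have := hr x Dx; rewrite G0 !subr0; apply.
Qed.

(** By compactness it suffices to argue near each point x. If G x = 0, nearby points are too close
    to [Z] for the condition on the distance; otherwise continuity bounds |G| from below. *)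
Lemma lower_bound_pos e0 A r : (forall x, X x -> knorm x < e0 -> D x) ->
  0 < r -> r < e0 -> 0 < A -> exists2 B, 0 < B & lower_bound (r ^+ 2) A B.
Proof.
move=> hD r0 re0 A0.
have DX : D `<=` X by have [] := D_nbhd.
have /compact_near_coveringP cK := compact_knorm_le (r := r) X_closed.
pose P (B : R) (x : 'rV[K]_N) := D x -> A <= dist_to Z x ^+ 2 -> B <= knorm2 (G x).
have nearP : \forall B \near 0^'+, X `&` [set x | knorm x <= r] `<=` P B.
  apply: cK => x [Xx /= xr]; have Dx := hD x Xx (le_lt_trans xr re0).
  have [Gx|Gx] := eqVneq (G x) 0.
    exists ([set y | knorm (y - x) < Num.sqrt A], setT) => /=.
      split; last exact: filterT.
      by apply/knorm_nbhsP; exists (Num.sqrt A); rewrite ?sqrtr_gt0.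
    move=> [y B] [/= yx _] Dy; rewrite leNgt => /negP[].
    rewrite -(sqr_sqrtr (ltW A0)) ltr_pXn2r ?nnegrE ?dist_to_ge0 ?sqrtr_ge0 //.
    by apply: le_lt_trans yx; apply: dist_to_le.
  have [d d0 hd] := continuous_lin_comp_neq0 Dx Gx.
  have Gx0 := knorm2_gt0 Gx.
  exists ([set y | knorm (y - x) < d], [set B | B < knorm2 (G x) / 4]) => /=.
    split; first by apply/knorm_nbhsP; exists d.
    by apply: nbhs_right_lt; rewrite divr_gt0.
  by move=> [y B] [/= yx Bx] Dy _; apply: le_trans (ltW Bx) (hd y Dy yx).
have [B [B0 hB]] : exists B, 0 < B /\ X `&` [set x | knorm x <= r] `<=` P B.
  near (0 : R)^'+ => B; exists B; split; first by near: B; apply: nbhs_right_gt.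
  by near: B.
exists B => // x Dx xr; apply: hB => //; split; first exact: DX.
by rewrite /= knorm_le // ltW.
Unshelve. all: by end_near.
Qed.

Hypothesis X_acc : limit_point (X `\` Z) 0.

Lemma acc_nonzero e : 0 < e -> exists x, [/\ X x, D x, G x != 0 & knorm x < e].
Proof.
move=> e0; have [r r0 hr] := domain_radius.
have [|x [_ [Xx nZx] xe]] := X_acc (_ : nbhs (0 : 'rV[K]_N) [set x : 'rV[K]_N | knorm x < Num.min e r]).
  apply/knorm_nbhsP; exists (Num.min e r) => [|y]; first by rewrite lt_min e0.
  by rewrite subr0.
move: xe => /=; rewrite lt_min => /andP[xe xr]; have Dx := hr x Xx xr.
by exists x; split=> //; apply/negP => /eqP Gx; apply: nZx.
Qed.

(** Near 0 the distance is below 1, so a power of it with exponent at most 0 is at least 1, whereas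
    G tends to 0. *)
Lemma exponent_gt0 C e eta : 0 < C -> 0 < e ->
  (forall x, X x -> knorm x < e -> G x != 0 ->
     C * dist_to Z x `^ eta <= knorm (G x)) -> 0 < eta.
Proof.
move=> C0 e0 h; rewrite ltNge; apply/negP => eta0.
have [r r0 hr] := near_zeros (exprn_gt0 2 C0).
have [|x [Xx Dx Gx]] := @acc_nonzero (Num.min 1 (Num.min e r)).
  by rewrite !lt_min ltr01 e0.
rewrite !lt_min => /and3P[x1 xe xr]; have [_] := hr x Xx xr.
rewrite -knorm_lt // ltNge => /negP; apply.
apply: le_trans (h x Xx xe Gx); rewrite ler_peMr //; first exact: ltW.
have d0 := dist_zeros_gt0 Dx Gx.
have d1 : dist_to Z x < 1.
  by apply: le_lt_trans x1; have := dist_to_le x zeros0; rewrite subr0.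
rewrite /powR gt_eqF // -[leLHS]expR0 ler_expR mulr_le0 // ltW // ln_lt0 //.
by rewrite d0.
Qed.

Lemma lower_bound_le E A B B' : B' <= B -> lower_bound E A B -> lower_bound E A B'.
Proof. by move=> BB h x Dx xE /(h x Dx xE); apply: le_trans. Qed.

(** The supremum of [S A] separates the B that satisfy the formula from those that do not, so some
    polynomial of [hs E] vanishes there without vanishing identically in B. Its slopes lie in
    [slopes R D'], and [D'] does not depend on r. *)
Lemma radius_slope : exists (Q : seq R) e0, 0 < e0 /\
  forall r, 0 < r -> r < e0 -> exists q, [/\ q \in Q,
    (exists C d, 0 < d /\ forall x, D x -> knorm x <= r -> G x != 0 ->
       dist_to Z x ^+ 2 < d ->
       q * ln (dist_to Z x ^+ 2) - C <= ln (knorm2 (G x))) &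
    (forall eta C, eta < q -> exists x A, [/\ D x, knorm x <= r, 0 < A,
       A <= dist_to Z x ^+ 2 & ln (knorm2 (G x)) < eta * ln A - C])].
Proof.
have [P dP hP] := definable_lower_bound.
have [D' [hs [hD hsgn]]] := definable_signs dP.
have [e0 e00 he0] := domain_radius; exists (slopes R D'), e0; split=> // r r0 re0.
pose E := r ^+ 2; have [C [d [d0 hC]]] := newton_slopes (hD E).
pose dom : set R := [set A | exists x, [/\ D x, knorm x <= r & A <= dist_to Z x ^+ 2]].
pose S A : set R := [set B | lower_bound E A B].
have S_le A x B : D x -> knorm x <= r -> A <= dist_to Z x ^+ 2 -> S A B -> B <= knorm2 (G x).
  by move=> Dx xr hA hB; apply: (hB x Dx) => //; rewrite /E -knorm_le // ltW.
have S_sup A : dom A -> 0 < A -> has_sup (S A) /\ 0 < sup (S A).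
  move=> [x [Dx xr xA]] A0; have [B B0 hB] := lower_bound_pos he0 r0 re0 A0.
  have hs_ : has_sup (S A).
    split; first by exists B.
    by exists (knorm2 (G x)) => B' /S_le; apply.
  by split=> //; apply: lt_le_trans B0 _; apply: ub_le_sup => //; case: hs_.
have [|A domA A0 Ad|q [qQ qlow qup]] :=
  @dominant_slope R dom (fun A => sup (S A)) (slopes R D') C d d0.
- move=> d' d'0; have [x [Xx Dx Gx xr]] := acc_nonzero r0.
  have d2 : 0 < dist_to Z x ^+ 2 by rewrite exprn_gt0 // dist_zeros_gt0.
  (* [dom] is closed downwards, so the squared distance may be cut off at d' / 2 to fall below
     d'. *)
  exists (Num.min (dist_to Z x ^+ 2) (d' / 2)); split.
  + by exists x; rewrite ge_min lexx ltW.
  + by rewrite lt_min d2 divr_gt0.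
  + by rewrite gt_min orbC; apply/orP; left; lra.
- have [hsup nu0] := S_sup A domA A0; set nu := sup (S A) in nu0 *.
  have [h [hE slh hnu]] : exists h, [/\ h \in hs E,
      map_poly (horner_eval A) h != 0 & horner2 h A nu = 0].
    (* Otherwise all signs are constant near [nu]; the formula holds just below [nu], hence also at
       nu + d' / 2, above the supremum. *)
    apply: contrapT => nex.
    have [h hE slh|d' d'0 hd'] := @slices_sign_near R (hs E) A nu.
      by apply/negP => /eqP hnu; apply: nex; exists h.
    have /ub_le_sup : has_ubound (S A) by case: hsup.
    move=> /(_ (nu + d' / 2)); apply/not_implyP; split; last first.
      by rewrite -/nu => le; lra.
    have d20 : 0 < d' / 2 by lra.
    have [B SB Blt] := sup_adherent d20 hsup.
    apply/hP; apply: (hsgn E A (nu - d' / 2)) => [h hE|]; last first.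
      apply/hP; apply: lower_bound_le SB; apply: ltW; apply: Blt.
    by rewrite !hd' // ltr_norml; apply/andP; split; lra.
  apply: (hC h hE _ A nu) => //.
  by apply: contraNneq slh => ->; rewrite rmorph0.
exists q; split=> //.
  have [C' [d' [d'0 hd']]] := qlow; exists C', d'; split=> // x Dx xr Gx xd.
  have d2 : 0 < dist_to Z x ^+ 2 by rewrite exprn_gt0 // dist_zeros_gt0.
  have domx : dom (dist_to Z x ^+ 2) by exists x.
  apply: le_trans (hd' _ domx d2 xd) _.
  have [hsup nu0] := S_sup _ domx d2; rewrite ler_ln ?posrE ?knorm2_gt0 //.
  by apply: ge_sup => [|B]; [case: hsup|apply: S_le].
move=> eta C' /qup-/(_ C' 1 ltr01)[A [domA A0 _ lnA]].
have [hsup nu0] := S_sup A domA A0.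
pose B := expR (eta * ln A - C'); have nuB : sup (S A) < B.
  by rewrite -ltr_ln ?posrE ?expR_gt0 // expRK.
have : ~ S A B.
  by move=> /(ub_le_sup _) h; have := h (proj2 hsup); rewrite leNgt nuB.
move=> /existsNP[x /not_implyP[Dx /not_implyP[xE /not_implyP[xA /negP]]]].
rewrite -ltNge => GB; exists x, A; split=> //.
  by rewrite knorm_le // ltW.
rewrite -[ltRHS]expRK ltr_ln ?posrE ?expR_gt0 //; apply: knorm2_gt0.
apply/negP => /eqP Gx; have : dist_to Z x <= 0.
  have Zx : Z x by [].
  by have := dist_to_le x Zx; rewrite subrr knormE knorm20 sqrtr0.
move=> le0; have d0' : dist_to Z x = 0 by apply/eqP; rewrite eq_le le0 dist_to_ge0.
by move: xA; rewrite d0' expr0n leNgt A0.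
Qed.

(** [Q] is finite, so the least slope over all radii below [e0] is attained, and it is an exponent
    on the corresponding ball. An admissible eta is at least the slope of some ball inside its own
    range, hence at least this minimum. *)
Lemma exists_exponent : exists l,
  loj_exponents X D G l /\ lbound (loj_exponents X D G) l.
Proof.
have [Q [e0 [e00 hQ]]] := radius_slope.
have DX : D `<=` X by have [] := D_nbhd.
pose q_of r q := [/\ q \in Q,
    (exists C d, 0 < d /\ forall x, D x -> knorm x <= r -> G x != 0 ->
       dist_to Z x ^+ 2 < d ->
       q * ln (dist_to Z x ^+ 2) - C <= ln (knorm2 (G x))) &
    (forall eta C, eta < q -> exists x A, [/\ D x, knorm x <= r, 0 < A,
       A <= dist_to Z x ^+ 2 & ln (knorm2 (G x)) < eta * ln A - C])].
pose good q := exists2 r, 0 < r < e0 & q_of r q.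
(* The minimum is obtained as the opposite of a maximum of opposites. *)
have [|l lQ lmin] := @seq_max R [seq - q | q <- Q & `[< good q >]].
  have [||q hq] := hQ (e0 / 2); [by lra|by lra|].
  have : q \in [seq q <- Q | `[< good q >]].
    rewrite mem_filter; case: (hq) => -> _ _; rewrite andbT; apply/asboolP.
    by exists (e0 / 2) => //; apply/andP; split; lra.
  by case: [seq q <- Q | _].
have [q lE gq] : exists2 q, l = - q & good q.
  move: lQ => /mapP[q +] ->; rewrite mem_filter => /andP[/asboolP gq _].
  by exists q.
have {}lmin q' : good q' -> q <= q'.
  move=> gq'; rewrite -lerN2 -lE; apply: lmin; apply: map_f.
  by rewrite mem_filter; case: (gq') => r _ [-> _ _]; rewrite andbT; apply/asboolP.
have [r /andP[r0 re0] [qQ [C [d [d0 qlow]]] _]] := gq.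
have [R1 R10 hR1] := domain_radius.
pose e := Num.min r (Num.min R1 (Num.sqrt d)).
have e_gt0 : 0 < e by rewrite !lt_min r0 R10 sqrtr_gt0.
(* The slope estimate concerns squares, so its additive constant is halved before exponentiation. *)
pose C1 := expR (- C / 2); have C10 : 0 < C1 by apply: expR_gt0.
have low x : X x -> knorm x < e -> G x != 0 -> C1 * dist_to Z x `^ q <= knorm (G x).
  move=> Xx; rewrite !lt_min => /and3P[xr xR1 xd] Gx.
  have Dx := hR1 x Xx xR1; have d_gt0 := dist_zeros_gt0 Dx Gx.
  have lt_d : dist_to Z x ^+ 2 < d.
    rewrite -(sqr_sqrtr (ltW d0)) ltr_pXn2r ?nnegrE ?dist_to_ge0 ?sqrtr_ge0 //.
    by apply: le_lt_trans xd; have := dist_to_le x zeros0; rewrite subr0.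
  have := qlow x Dx (ltW xr) Gx lt_d.
  have G0 : 0 < knorm (G x) by rewrite knormE sqrtr_gt0 knorm2_gt0.
  rewrite -sqr_knorm !lnXn // => le.
  rewrite -ler_ln ?posrE ?mulr_gt0 ?powR_gt0 // lnM ?posrE ?powR_gt0 // ln_powR.
  by rewrite expRK; lra.
(* At a zero of G the distance is 0, and its q-th power is 0 only because q is nonzero: the 0-th
   power of 0 is 1. *)
have q0 : 0 < q by apply: (exponent_gt0 C10 e_gt0).
exists q; split.
  exists C1, e; split=> // x Xx xe; have Dx : D x.
    by apply: hR1 => //; move: xe; rewrite !lt_min => /and3P[].
  split=> //; have [Gx|Gx] := eqVneq (G x) 0; last exact: low.
  have /dist_to_le : Z x by [].
  move=> /(_ x); rewrite subrr knormE knorm20 sqrtr0 => le0.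
  have -> : dist_to Z x = 0 by apply/eqP; rewrite eq_le le0 dist_to_ge0.
  by rewrite powR0 ?gt_eqF // mulr0 knorm_ge0.
move=> eta [C' [e' [C'0 e'0 heta]]].
have eta0 : 0 < eta.
  by apply: (exponent_gt0 C'0 e'0) => x Xx /(heta x Xx)[].
pose r' := Num.min (e0 / 2) (e' / 2).
have [||q' gq'] := hQ r'; [by rewrite lt_min !divr_gt0|by rewrite gt_min; apply/orP; left; lra|].
apply: le_trans (_ : q' <= eta).
  by apply: lmin; exists r' => //; rewrite lt_min !divr_gt0 //= gt_min; apply/orP; left; lra.
(* The constant is - 2 ln C' because the slope estimate compares the logarithms of squares. *)
rewrite leNgt; apply/negP => etaq'; have [_ _ /(_ eta (- 2 * ln C') etaq')] := gq'.
move=> [x [A [Dx xr' A0 xA lnG]]].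
have [|_ le] := heta x (DX x Dx).
  by apply: le_lt_trans xr' _; rewrite gt_min; apply/orP; right; lra.
have d_gt0 : 0 < dist_to Z x.
  by rewrite lt_def dist_to_ge0 andbT; apply: contraTneq xA => ->; rewrite expr0n /= -ltNge.
have G0 : 0 < knorm (G x).
  by apply: lt_le_trans le; rewrite mulr_gt0 ?powR_gt0.
move: le lnG; rewrite -ler_ln ?posrE ?mulr_gt0 ?powR_gt0 // lnM ?posrE ?powR_gt0 //.
rewrite ln_powR -sqr_knorm lnXn // => le.
have : eta * ln A <= eta * ln (dist_to Z x ^+ 2).
  by rewrite ler_pM2l // ler_ln ?posrE ?exprn_gt0.
rewrite lnXn //; lra.
Qed.

End Setting.

End LojasiewiczExponent.

(** * Algebraic relations along an ultrafilter *)

Section Tower.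
Variable R : realType.

(** The polynomial ring in n variables is built with the last variable outermost, so that an element
    of [tower n.+1] is a univariate polynomial over the preceding coordinates. *)
Fixpoint tower n : idomainType :=
  match n with
  | 0 => R
  | n.+1 => {poly tower n}
  end.

Fixpoint tower_rmorphism (v : nat -> R) n : {rmorphism tower n -> R} :=
  match n return {rmorphism tower n -> R} with
  | 0 => idfun
  | n.+1 => (horner_eval (v n) \o map_poly (tower_rmorphism v n))%FUN
  end.

Definition tower_eval v n : tower n -> R := tower_rmorphism v n.
Arguments tower_eval : clear implicits.

HB.instance Definition _ v n :=
  GRing.RMorphism.copy (tower_eval v n) (tower_rmorphism v n).

Lemma tower_evalS v n (p : tower n.+1) :
  tower_eval v n.+1 p = (map_poly (tower_eval v n) p).[v n].
Proof. by []. Qed.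

Arguments tower_eval v n p : simpl never.

Lemma tower_eval_sum v n (p : {poly tower n}) k : (size p <= k)%N ->
  tower_eval v n.+1 p = \sum_(j < k) tower_eval v n p`_j * v n ^+ j.
Proof.
move=> sp; rewrite tower_evalS (@horner_coef_wide _ k).
  by apply: eq_bigr => j _; rewrite coef_map.
by apply: leq_trans sp; apply: size_poly.
Qed.

Lemma tower_eval_polyC v n (c : tower n) :
  tower_eval v n.+1 (c%:P : {poly tower n}) = tower_eval v n c.
Proof. by rewrite tower_evalS map_polyC hornerC. Qed.

Lemma eq_tower_eval v w n (p : tower n) : (forall i, (i < n)%N -> v i = w i) ->
  tower_eval v n p = tower_eval w n p.
Proof.
elim: n p => [//|n IH] p vw; rewrite !(tower_eval_sum _ (leqnn _)).
apply: eq_bigr => j _; rewrite vw // (IH p`_j) // => i lti; apply: vw; lia.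
Qed.

Definition tower_fun n (f : (nat -> R) -> R) :=
  exists p : tower n, forall v, tower_eval v n p = f v.

Lemma tower_fun_cst n c : tower_fun n (fun=> c).
Proof.
elim: n => [|n [p hp]]; first by exists c.
by exists (p%:P : {poly tower n}) => v; rewrite tower_eval_polyC.
Qed.

Lemma tower_fun_var n i : (i < n)%N -> tower_fun n (fun v => v i).
Proof.
elim: n => // n IH; rewrite ltnS leq_eqVlt => /orP[/eqP->|/IH[p hp]].
  exists ('X : {poly tower n}) => v.
  by rewrite tower_evalS map_polyX hornerX.
by exists (p%:P : {poly tower n}) => v; rewrite tower_eval_polyC.
Qed.

Lemma tower_funM n f g : tower_fun n f -> tower_fun n g ->
  tower_fun n (fun v => f v * g v).
Proof. by move=> [p hp] [q hq]; exists (p * q) => v; rewrite rmorphM /= hp hq. Qed.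

Lemma tower_fun_sum n I (r : seq I) f : (forall i, tower_fun n (f i)) ->
  tower_fun n (fun v => \sum_(i <- r) f i v).
Proof.
move=> hf; elim: r => [|i r [q hq]].
  by exists 0 => v; rewrite rmorph0 big_nil.
by have [p hp] := hf i; exists (p + q) => v; rewrite rmorphD /= hp hq big_cons.
Qed.

Lemma tower_fun_prod n I (r : seq I) f : (forall i, tower_fun n (f i)) ->
  tower_fun n (fun v => \prod_(i <- r) f i v).
Proof.
move=> hf; elim: r => [|i r [q hq]].
  by exists 1 => v; rewrite rmorph1 big_nil.
by have [p hp] := hf i; exists (p * q) => v; rewrite rmorphM /= hp hq big_cons.
Qed.

Lemma tower_fun_meval d n (p : mpoly d R) : (d <= n)%N ->
  tower_fun n (fun v => meval (fun i : 'I_d => v i) p).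
Proof.
move=> dn; have : tower_fun n (fun v => \sum_(m <- msupp p)
    mcoeff m p * \prod_(i < d) v i ^+ m i).
  apply: tower_fun_sum => m; apply: tower_funM; first exact: tower_fun_cst.
  apply: tower_fun_prod => i; have [q hq] := tower_fun_var (leq_trans (ltn_ord i) dn).
  by exists (q ^+ m i) => v; rewrite rmorphXn /= hq.
by move=> [q hq]; exists q => v; rewrite hq mevalE.
Qed.

End Tower.

Arguments tower_eval {R} v n p : simpl never.

Section Chain.
Variables (R : realType) (T : Type) (U : set_system T) (v : T -> nat -> R).
Hypothesis U_ultra : UltraFilter U.

(** For an ultrafilter these polynomials form a prime ideal, the ideal of a generic point;
    computations are done modulo it without forming the quotient. *)
Definition ae_zero n (p : tower R n) := U [set t | tower_eval (v t) n p = 0].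

Lemma not_ae_zero n (p : tower R n) :
  ~ ae_zero p <-> U [set t | tower_eval (v t) n p != 0].
Proof.
split=> [np|h0 h1].
  have [//|h] := in_ultra_setVsetC [set t | tower_eval (v t) n p = 0] U_ultra.
  by apply: filterS h => t /= /eqP.
by have [t [/= /eqP h /h]] := filter_ex (filterI h0 h1).
Qed.

Lemma ae_zero0 n : ae_zero (0 : tower R n).
Proof. by apply: filterS filterT => t _ /=; rewrite rmorph0. Qed.

(* An algebraic relation for the coordinate i over the preceding ones. *)
Definition relation i (Q : {poly tower R i}) :=
  @ae_zero i.+1 Q /\ ~ ae_zero (lead_coef Q).

(** Leading terms whose coefficient vanishes along [U] are dropped one by one; the coefficient of
    index l stops this before everything is lost. *)
Lemma relation_truncate i (p : {poly tower R i}) l :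
  @ae_zero i.+1 p -> ~ ae_zero p`_l ->
  exists2 q : {poly tower R i}, relation q & (size q <= size p)%N.
Proof.
have [n] := ubnP (size p); elim: n p => // n IH p /ltnSE sp p0 pl.
have [lc|lc] := pselect (ae_zero (lead_coef p)); last by exists p.
have pn0 : p != 0 by apply/eqP => pE; apply: pl; rewrite pE coef0; apply: ae_zero0.
pose q := \poly_(j < (size p).-1) p`_j.
have sq : (size q < size p)%N.
  by apply: leq_ltn_trans (size_poly _ _) _; rewrite prednK // size_poly_gt0.
have [|||r rr sr] := IH q.
- exact: leq_trans sq sp.
- apply: filterS (filterI p0 lc) => t /= [e1 e2].
  rewrite (@tower_eval_sum _ _ _ q _ (size_poly _ _)).
  move: e1; rewrite (tower_eval_sum _ (leqnn _)).
  have sE : size p = (size p).-1.+1 by rewrite prednK // size_poly_gt0.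
  rewrite sE big_ord_recr /= -lead_coefE e2 mul0r addr0 => {2}<-.
  by apply: eq_bigr => j _; rewrite coef_poly ltn_ord.
- rewrite coef_poly; case: ltnP => // le; exfalso; apply: pl.
  move: le; rewrite leq_eqVlt => /orP[/eqP<-|lt]; first by rewrite -lead_coefE.
  rewrite nth_default; first exact: ae_zero0.
  by rewrite -ltnS; move: lt; case: (size p).
by exists r => //; apply: leq_trans sr (ltnW sq).
Qed.

Definition dependent i := exists Q : {poly tower R i}, relation Q.

Lemma minimal_relation i : exists Q : {poly tower R i}, dependent i ->
  relation Q /\ forall Q' : {poly tower R i}, relation Q' -> (size Q <= size Q')%N.
Proof.
have [[Q0 rQ0]|nd] := pselect (dependent i); last by exists 0.
have exn : exists n, `[< exists2 Q : {poly tower R i}, relation Q & size Q = n >].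
  by exists (size Q0); apply/asboolP; exists Q0.
case: (ex_minnP exn) => n /asboolP[Q rQ sQ] nmin; exists Q => _; split=> // Q' rQ'.
by rewrite sQ; apply: nmin; apply/asboolP; exists Q'.
Qed.

Definition min_rel i : {poly tower R i} := projT1 (cid (minimal_relation i)).

Lemma min_relP i : dependent i -> relation (min_rel i).
Proof. by rewrite /min_rel; case: cid => Q /= h /h[]. Qed.

Lemma min_rel_size i (Q : {poly tower R i}) : relation Q ->
  (size (min_rel i) <= size Q)%N.
Proof.
by move=> rQ; rewrite /min_rel; case: cid => P /= [|_]; [exists Q|apply].
Qed.

Definition regular_at (w : nat -> R) i :=
  tower_eval w i.+1 (min_rel i) = 0 /\ tower_eval w i (lead_coef (min_rel i)) != 0.

(* Pseudo-division by the minimal relations. *)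
Lemma ae_zero_regular i (p : tower R i) (w : nat -> R) : ae_zero p ->
  (forall j, (j < i)%N -> dependent j -> regular_at w j) -> tower_eval w i p = 0.
Proof.
elim: i p => [p p0 _|i IH p p0 reg].
  by have [t] := filter_ex p0.
have [dep|ndep] := pselect (dependent i); last first.
  rewrite (tower_eval_sum _ (leqnn _)) big1 // => j _.
  rewrite IH ?mul0r // => [|l ltl]; last by apply: reg; lia.
  apply: contrapT => nz; apply: ndep.
  by have [q rq _] := relation_truncate p0 nz; exists q.
have [w0 wl] := reg i (leqnn _) dep; set Q := min_rel i in w0 wl.
have [Q0 Ql] := min_relP dep.
have Qn0 : Q != 0 by apply/eqP => QE; apply: Ql; rewrite -/Q QE lead_coef0; apply: ae_zero0.
have dE := Pdiv.Idomain.divp_eq (p : {poly tower R i}) Q.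
set r := (p %% Q)%R in dE.
have r0 : @ae_zero i.+1 r.
  apply: filterS (filterI p0 Q0) => t /= [e1 e2].
  move: (congr1 (tower_eval (v t) i.+1) dE).
  by rewrite -mul_polyC rmorphM rmorphD rmorphM /= e1 mulr0 e2 mulr0 add0r.
(* Otherwise truncating the remainder would give a relation shorter than the minimal one. *)
have rc l : ae_zero r`_l.
  apply: contrapT => nz; have [q rq sq] := relation_truncate r0 nz.
  have := leq_trans (min_rel_size rq) sq; rewrite leqNgt => /negP; apply.
  by rewrite Pdiv.Idomain.ltn_modp.
have rw : tower_eval w i.+1 r = 0.
  rewrite (tower_eval_sum _ (leqnn _)) big1 // => j _.
  by rewrite IH ?mul0r // => l ltl; apply: reg; lia.
move: (congr1 (tower_eval w i.+1) dE); rewrite -mul_polyC rmorphM /= tower_eval_polyC.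
rewrite rmorphXn rmorphD rmorphM /= w0 rw mulr0 addr0 => /eqP.
by rewrite mulf_eq0 expf_eq0 (negbTE wl) andbF => /eqP.
Qed.

(** In characteristic 0 the derivative has a leading coefficient that is nonzero along [U], so if it
    vanished along [U] it would yield a shorter relation. *)
Lemma min_rel_deriv i : dependent i -> ~ @ae_zero i.+1 (min_rel i)^`().
Proof.
move=> dep; have [Q0 Ql] := min_relP dep; set Q := min_rel i in Q0 Ql *.
have s2 : (1 < size Q)%N.
  rewrite ltnNge; apply/negP => s1; apply: Ql.
  move: Q0; rewrite (size1_polyC s1) lead_coefC.
  by apply: filterS => t /=; rewrite tower_eval_polyC.
move=> d0; have [|q rq sq] := @relation_truncate i Q^`() (size Q).-2 d0.
  rewrite not_ae_zero; move: Ql; rewrite not_ae_zero; apply: filterS => t /=.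
  have p1 : (0 < (size Q).-1)%N by rewrite -subn1 subn_gt0.
  rewrite lead_coefE coef_deriv (prednK p1) => lc.
  by rewrite rmorphMn /= mulrn_eq0 negb_or lc andbT -lt0n.
have := leq_trans (min_rel_size rq) sq; rewrite leqNgt => /negP; apply.
by apply: lt_size_deriv; rewrite -size_poly_gt0 (ltn_trans _ s2).
Qed.

Lemma ae_regular n : U [set t | forall i, (i < n)%N -> dependent i ->
  regular_at (v t) i /\ tower_eval (v t) i.+1 (min_rel i)^`() != 0].
Proof.
elim: n => [|n IH]; first by apply: filterS filterT.
have [dep|ndep] := pselect (dependent n); last first.
  apply: filterS IH => t ht i; rewrite ltnS leq_eqVlt => /orP[/eqP->|/ht//].
  by move/ndep.
have [Q0 /not_ae_zero Ql] := min_relP dep.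
have /not_ae_zero Qd := min_rel_deriv dep.
apply: filterS (filterI IH (filterI Q0 (filterI Ql Qd))) => t /= [ht [e0 [e1 e2]]] i.
by rewrite ltnS leq_eqVlt => /orP[/eqP->|/ht//].
Qed.

End Chain.

(** * Polynomial functions and submanifolds *)

Section PolynomialFunctions.
Variables (R : fieldType) (d : nat).
Implicit Types (f g : 'rV[R]_d -> R) (a x : 'rV[R]_d).

Definition polynomial_fun f :=
  exists p : mpoly d R, forall x, f x = meval (fun i => x 0 i) p.

Lemma polynomial_fun_cst c : polynomial_fun (fun=> c).
Proof. by exists (mpolyC d c) => x; rewrite mevalC. Qed.

Lemma polynomial_fun_coord i : polynomial_fun (fun x => x 0 i).
Proof. by exists (mpolyX R (mnm1 i)) => x; rewrite mevalXU. Qed.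

Lemma polynomial_funD f g : polynomial_fun f -> polynomial_fun g ->
  polynomial_fun (fun x => f x + g x).
Proof. by move=> [p hp] [q hq]; exists (p + q) => x; rewrite mevalD hp hq. Qed.

Lemma polynomial_funM f g : polynomial_fun f -> polynomial_fun g ->
  polynomial_fun (fun x => f x * g x).
Proof. by move=> [p hp] [q hq]; exists (p * q) => x; rewrite mevalM hp hq. Qed.

Lemma polynomial_funX f n : polynomial_fun f -> polynomial_fun (fun x => f x ^+ n).
Proof.
move=> hf; elim: n => [|n [q hq]]; first by exists 1 => x; rewrite meval1 expr0.
by have [p hp] := hf; exists (p * q) => x; rewrite exprS mevalM -hp -hq.
Qed.

Lemma polynomial_fun_sum I (r : seq I) (f : I -> 'rV[R]_d -> R) :
  (forall i, polynomial_fun (f i)) -> polynomial_fun (fun x => \sum_(i <- r) f i x).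
Proof.
move=> hf; elim: r => [|i r [q hq]]; first by exists 0 => x; rewrite big_nil meval0.
by have [p hp] := hf i; exists (p + q) => x; rewrite big_cons mevalD hp hq.
Qed.

Lemma polynomial_fun_prod I (r : seq I) (f : I -> 'rV[R]_d -> R) :
  (forall i, polynomial_fun (f i)) -> polynomial_fun (fun x => \prod_(i <- r) f i x).
Proof.
move=> hf; elim: r => [|i r [q hq]]; first by exists 1 => x; rewrite big_nil meval1.
by have [p hp] := hf i; exists (p * q) => x; rewrite big_cons mevalM hp hq.
Qed.

Lemma polynomial_fun_comp d' (p : mpoly d' R) (u : 'I_d' -> 'rV[R]_d -> R) :
  (forall i, polynomial_fun (u i)) ->
  polynomial_fun (fun x => meval (fun i => u i x) p).
Proof.
move=> hu; have : polynomial_fun (fun x => \sum_(m <- msupp p)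
    mcoeff m p * \prod_(i < d') u i x ^+ m i).
  apply: polynomial_fun_sum => m; apply: polynomial_funM; first exact: polynomial_fun_cst.
  by apply: polynomial_fun_prod => i; apply: polynomial_funX.
by move=> [q hq]; exists q => x; rewrite -hq mevalE.
Qed.

End PolynomialFunctions.

Section RealPolynomialFunctions.
Variables (R : realType) (d : nat).
Implicit Types (f g : 'rV[R]_d -> R) (a x : 'rV[R]_d).

Lemma polynomial_fun_differentiable f x : polynomial_fun f -> differentiable f x.
Proof.
move=> [p hp]; have -> : f = (fun x => \sum_(m <- msupp p)
    mcoeff m p * \prod_(i < d) x 0 i ^+ m i).
  by apply/funext => y; rewrite hp mevalE.
elim: (msupp p) => [|m r IH].
  by under eq_fun do rewrite big_nil; apply: differentiable_cst.
under eq_fun do rewrite big_cons; apply: differentiableD => //.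
apply: differentiableM; first exact: differentiable_cst.
elim: (index_enum _) => [|i s IHs].
  by under eq_fun do rewrite big_nil; apply: differentiable_cst.
under eq_fun do rewrite big_cons; apply: differentiableM => //.
elim: (m i) => [|n IHn].
  by under eq_fun do rewrite expr0; apply: differentiable_cst.
under eq_fun do rewrite exprS; apply: differentiableM => //.
exact: differentiable_coord.
Qed.

Lemma polynomial_fun_continuous f : polynomial_fun f -> continuous f.
Proof.
by move=> hf x; apply: differentiable_continuous; apply: polynomial_fun_differentiable.
Qed.

Lemma polynomial_fun_analytic f a : polynomial_fun f -> analytic_at f a.
Proof.
move=> [p0 hp0].
(* The coefficients of the translated polynomial are those of the power series at a; only finitely
   many are nonzero. *)
have [p hp] : polynomial_fun (fun x => f (x + a)).
  have [p hp] := @polynomial_fun_comp R d d p0 (fun i x => x 0 i + a 0 i) (fun i =>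
    polynomial_funD (polynomial_fun_coord _ i) (polynomial_fun_cst _ _)).
  exists p => x; rewrite -hp hp0; apply: meval_eq => i; by rewrite mxE.
pose c (al : {ffun 'I_d -> nat}) := mcoeff (Multinom [tuple al i | i < d]) p.
exists c; apply: filterS filterT => x _ e e0.
pose g (m : multinom d) : {ffun 'I_d -> nat} := [ffun i => m i].
have gK m : Multinom [tuple g m i | i < d] = m.
  by apply/mnmP => i; rewrite mnmE ffunE.
pose A := [fset g m | m in msupp p]%fset.
exists A => B AB; rewrite -(big_fset_incl _ AB) => [|al _ alA]; last first.
  have -> : c al = 0; last by rewrite mul0r.
  apply/eqP; rewrite mcoeff_eq0; apply: contra alA => alp.
  apply/imfsetP; exists (Multinom [tuple al i | i < d]) => //.
  by apply/ffunP => i; rewrite ffunE mnmE.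
rewrite (perm_big _ (enum_imfset _ _)) /=; last first.
  by move=> m m' _ _ /(congr1 (fun al : {ffun _ -> _} => (Multinom [tuple al i | i < d]))); rewrite !gK.
rewrite big_map (undup_id (msupp_uniq p)) -[x in f x](subrK a) hp mevalE.
have -> : \sum_(m <- msupp p) c (g m) * \prod_(i < d) (x 0 i - a 0 i) ^+ g m i =
    \sum_(m <- msupp p) mcoeff m p * \prod_(i < d) (x - a) 0 i ^+ m i.
  apply: eq_bigr => m _; rewrite /c gK; congr (_ * _).
  by apply: eq_bigr => i _; rewrite ffunE !mxE.
by rewrite subrr normr0.
Qed.

End RealPolynomialFunctions.

(** Padding by 0 turns a point into a valuation indexed by all natural numbers, as [tower_eval]
    expects. *)
Definition coords (R : realType) d (x : 'rV[R]_d) (i : nat) : R :=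
  if insub i is Some j then x 0 (j : 'I_d) else 0.

Lemma coordsE (R : realType) d (x : 'rV[R]_d) (i : 'I_d) : coords x i = x 0 i.
Proof. by rewrite /coords valK. Qed.

Lemma polynomial_fun_tower (R : realType) d n (p : tower R n) :
  polynomial_fun (fun x : 'rV[R]_d => tower_eval (coords x) n p).
Proof.
elim: n p => [|n IH] p; first exact: (polynomial_fun_cst _ p).
have [q hq] : polynomial_fun (fun x : 'rV[R]_d => \sum_(j < size (p : {poly tower R n}))
    tower_eval (coords x) n (p : {poly tower R n})`_j * coords x n ^+ j).
  apply: polynomial_fun_sum => j; apply: polynomial_funM => //.
  apply: polynomial_funX; rewrite /coords.
  by case: insubP => [i _ _|_]; [apply: polynomial_fun_coord|apply: polynomial_fun_cst].
by exists q => x; rewrite -hq (tower_eval_sum _ (leqnn _)).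
Qed.

(** * Submanifolds parametrized by free coordinates *)

Section Submanifold.
Variables (R : realType) (d : nat).

Lemma coords_line (b : 'rV[R]_d) (i : 'I_d) h j :
  coords (h *: delta_mx 0 i + b) j = if j == i :> nat then h + b 0 i else coords b j.
Proof.
rewrite /coords; case: insubP => [k _ <-|]; last first.
  by rewrite -leqNgt => dj; case: eqP => // ji; move: dj; rewrite ji leqNgt ltn_ord.
rewrite !mxE eqxx /=; case: (eqVneq k i) => [->|ki].
  by rewrite eqxx mulr1.
by rewrite val_eqE (negbTE ki) mulr0 add0r.
Qed.

Lemma derive_tower_const n (p : tower R n) (i : 'I_d) (b : 'rV[R]_d) : (n <= i)%N ->
  'D_(delta_mx 0 i) (fun x => tower_eval (coords x) n p) b = 0.
Proof.
move=> ni; rewrite /derive.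
rewrite (_ : (fun h : R => _) = cst 0); first exact: lim_cst.
apply/funext => h /=; rewrite (@eq_tower_eval _ _ (coords b)) ?subrr ?scaler0 //.
by move=> j jn; rewrite coords_line ltn_eqF // (leq_trans jn).
Qed.

Lemma derive_tower (i : 'I_d) (p : {poly tower R i}) (b : 'rV[R]_d) :
  'D_(delta_mx 0 i) (fun x => tower_eval (coords x) i.+1 p) b =
  tower_eval (coords b) i.+1 p^`().
Proof.
pose P := map_poly (tower_eval (coords b) i) p.
have PE h : tower_eval (coords (h *: delta_mx 0 i + b)) i.+1 p = P.[h + b 0 i].
  rewrite tower_evalS coords_line eqxx; congr (_.[_]).
  apply/polyP => j; rewrite !coef_map /=; apply: eq_tower_eval => l li.
  by rewrite coords_line ltn_eqF.
rewrite tower_evalS -deriv_map -/P coordsE derivE derive1E /derive.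
have P0 : tower_eval (coords b) i.+1 p = P.[b 0 i].
  by have := PE 0; rewrite scale0r !add0r.
rewrite (_ : (fun h : R => _) = (fun h : R =>
  h^-1 *: ((horner P \o shift (b 0 i)) (h *: (1 : R^o)) - P.[b 0 i]))) //.
apply/funext => h /=.
by rewrite PE P0 /GRing.scale /= mulr1.
Qed.

Lemma open_polynomial_gt0 (f : 'rV[R]_d -> R) : polynomial_fun f ->
  open [set x | 0 < f x].
Proof.
by move=> /polynomial_fun_continuous/continuousP/(_ _ (@open_gt R 0)).
Qed.

Lemma open_polynomial_neq0 (f : 'rV[R]_d -> R) : polynomial_fun f ->
  open [set x | f x != 0].
Proof.
move=> hf; rewrite (_ : mkset _ = [set x | 0 < f x * f x]).
  by apply: open_polynomial_gt0; apply: polynomial_funM.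
by apply/seteqP; split=> x /=; rewrite -expr2 exprn_even_gt0.
Qed.

Lemma exists_subset_card (A : {set 'I_d}) p : (p <= #|A|)%N ->
  exists2 B : {set 'I_d}, B \subset A & #|B| = p.
Proof.
move=> pA; exists [set x in take p (enum A)].
  by apply/fintype.subsetP => x; rewrite inE => /mem_take; rewrite mem_enum.
rewrite cardsE (card_uniqP _) ?take_uniq ?enum_uniq // size_takel // -cardE //.
Qed.

Lemma open_bigcap_fin (I : finType) (A : I -> set 'rV[R]_d) :
  (forall i, open (A i)) -> open [set x | forall i, A i x].
Proof.
move=> oA; rewrite openE => x Ax; rewrite /interior.
have nA i : nbhs x (A i) by apply: open_nbhs_nbhs; split=> //; apply: Ax.
exact: (@filter_forall _ I A (nbhs x) (nbhs_filter x) nA).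
Qed.

Lemma differentiable_row q (h : 'rV[R]_d -> 'rV[R]_q) b :
  (forall j, differentiable (fun y => h y 0 j) b) -> differentiable h b.
Proof.
move=> hj.
have -> : h = \sum_(j < q) (fun y => h y 0 j *: (delta_mx 0 j : 'rV[R]_q)).
  by apply/funext => y; rewrite fct_sumE -row_sum_delta.
apply: differentiable_sum => j.
apply: (@differentiable_comp _ _ _ _ (fun y => h y 0 j)
  (fun c : R => c *: (delta_mx 0 j : 'rV[R]_q))) => //.
Qed.

(* The last equation that involves a coordinate is the only one, among those
   with a nonzero coefficient in a linear combination of the differentials, that
   varies with this coordinate. *)
Lemma triangular_rank q (e : 'I_q -> 'I_d) (h : 'rV[R]_d -> 'rV[R]_q) b :
  injective e -> differentiable h b ->
  (forall j (i : 'I_d), (e j < i)%N -> 'D_(delta_mx 0 i) (fun x => h x 0 j) b = 0) ->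
  (forall j, 'D_(delta_mx 0 (e j)) (fun x => h x 0 j) b != 0) ->
  \rank ('J h b) = q.
Proof.
move=> einj dh tri diag.
have JE i j : 'J h b i j = 'D_(delta_mx 0 i) (fun x => h x 0 j) b.
  have := deriveEjacobian (delta_mx 0 i) dh; rewrite derive_mx; last first.
    exact: diff_derivable.
  by rewrite -rowE => /rowP/(_ j); rewrite !mxE.
rewrite -mxrank_tr; apply/eqP; apply: inj_row_free => u uJ.
apply/rowP => j0; rewrite mxE; apply/eqP; apply: contraT => uj0.
pose P j := u 0 j != 0.
have [j Pj jmax] := @arg_maxnP _ j0 P (fun j => e j : nat) uj0.
move: uJ => /rowP/(_ (e j)); rewrite !mxE (bigD1 j) //= big1 ?addr0.
  by move=> /eqP; rewrite mulf_eq0 mxE JE (negbTE Pj) (negbTE (diag j)).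
move=> k kj; rewrite mxE JE; have [->|uk] := eqVneq (u 0 k) 0; first by rewrite mul0r.
rewrite tri ?mulr0 // ltn_neqAle (jmax k uk : (e k <= e j)%N) andbT.
by rewrite val_eqE (inj_eq einj).
Qed.

Section Chain.
Variables (T : Type) (U : set_system T) (v : T -> nat -> R).
Hypothesis U_ultra : UltraFilter U.
Variables (x : T -> 'rV[R]_d) (ps qs : seq (mpoly d R)) (O : set 'rV[R]_d).
Hypothesis v_coords : forall t i, (i < d)%N -> v t i = coords (x t) i.
Hypothesis U_basic : U [set t | basic_semialgebraic ps qs (x t) /\ O (x t)].
Hypothesis O_open : open O.

Definition free_coords : {set 'I_d} := [set i : 'I_d | ~~ `[< dependent U v i >]].

(** At a typical point a, p of the free coordinates are left to vary, the other free ones are fixed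
    at their values at a, and the minimal relations are imposed on the rest. These d - p equations
    are triangular with nonzero diagonal derivatives. Near a the strict inequalities persist, and
    the equations of [ps] follow by [ae_zero_regular]. *)
Lemma free_submanifold p : (p <= #|free_coords|)%N -> exists M,
  [/\ M !=set0, analytic_submanifold p M & M `<=` basic_semialgebraic ps qs `&` O].
Proof.
move=> /exists_subset_card[B Bfree cB].
have [t0 [[bt0 Ot0] reg0]] := filter_ex (filterI U_basic (ae_regular v U_ultra d)).
pose a := x t0.
have regE (w : nat -> R) (b : 'rV[R]_d) i : (i < d)%N ->
    (forall j, (j < d)%N -> w j = coords b j) ->
    regular_at U v w i <-> regular_at U v (coords b) i.
  move=> lti wb; rewrite /regular_at.
  rewrite (@eq_tower_eval _ w (coords b) i.+1) => [|j ltj]; last by apply: wb; lia.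
  by rewrite (@eq_tower_eval _ w (coords b) i) // => j ltj; apply: wb; lia.
have rega (i : 'I_d) : i \notin free_coords -> regular_at U v (coords a) i /\
    tower_eval (coords a) i.+1 (min_rel U v i)^`() != 0.
  rewrite inE negbK => /asboolP dep.
  have [r1 r2] := reg0 i (ltn_ord i) dep; split.
    by apply/(regE (v t0)) => // j; apply: v_coords.
  rewrite -(@eq_tower_eval _ (v t0)) // => j ltj; apply: v_coords.
  by apply: leq_trans ltj _.
have [cst0 cst0E] : exists f : forall i : nat, tower R i, forall i w,
    tower_eval w i (f i) = coords a i.
  by have := fun i => cid (tower_fun_cst i (coords a i)); move=> /all_sig[f fE]; exists f.
pose eqn (i : 'I_d) : {poly tower R i} :=
  if i \in free_coords then 'X - (cst0 i)%:P else min_rel U v i.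
have eqn_a (i : 'I_d) : tower_eval (coords a) i.+1 (eqn i) = 0.
  rewrite /eqn; case: ifPn => [_|/rega[[]]//].
  by rewrite tower_evalS rmorphB /= map_polyX map_polyC /= !hornerE cst0E subrr.
have deqn_a (i : 'I_d) : tower_eval (coords a) i.+1 (eqn i)^`() != 0.
  rewrite /eqn; case: ifPn => [_|/rega[]//].
  by rewrite derivB derivX derivC subr0 rmorph1 oner_eq0.
pose E := ~: B.
have cE : #|E| = (d - p)%N by rewrite cardsCs finset.setCK cB card_ord.
pose e (j : 'I_(d - p)) : 'I_d := enum_val (cast_ord (esym cE) j).
have einj : injective e by move=> j k /enum_val_inj/cast_ord_inj.
pose h (y : 'rV[R]_d) : 'rV[R]_(d - p) :=
  \row_j tower_eval (coords y) (e j).+1 (eqn (e j)).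
have h_poly j : polynomial_fun (fun y => h y 0 j).
  have [q hq] := @polynomial_fun_tower R d (e j).+1 (eqn (e j)).
  by exists q => y; rewrite mxE hq.
pose O1 : set 'rV[R]_d := [set y | forall q : 'I_(size qs),
  0 < meval (fun i => y 0 i) (nth 0 qs q)].
pose O2 : set 'rV[R]_d := [set y | forall i : 'I_d,
  i \notin free_coords -> tower_eval (coords y) i (lead_coef (min_rel U v i)) != 0].
pose O3 : set 'rV[R]_d := [set y | forall i : 'I_d,
  tower_eval (coords y) i.+1 (eqn i)^`() != 0].
pose V := O `&` (O1 `&` (O2 `&` O3)).
have oV : open V.
  apply: openI => //; apply: openI; last apply: openI.
  - apply: open_bigcap_fin => q; apply: open_polynomial_gt0.
    by exists (nth 0 qs q).
  - apply: (@open_bigcap_fin _ (fun i => [set y | i \notin free_coords ->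
      tower_eval (coords y) i (lead_coef (min_rel U v i)) != 0])) => i.
    have [ifree|nfree] := boolP (i \in free_coords).
      by rewrite (_ : mkset _ = setT); [exact: openT|apply/seteqP].
    rewrite (_ : mkset _ = [set y |
      tower_eval (coords y) i (lead_coef (min_rel U v i)) != 0]).
      by apply: open_polynomial_neq0; apply: polynomial_fun_tower.
    by apply/seteqP; split=> y /=; [apply|].
  - apply: open_bigcap_fin => i; apply: open_polynomial_neq0.
    exact: polynomial_fun_tower.
have Va : V a.
  split=> //; split=> [q|].
    by case: bt0 => _; apply; apply: mem_nth.
  by split=> [i /rega[[]]|i] //.
exists (V `&` h @^-1` [set 0]); split.
- exists a; split=> //; apply/rowP => j; by rewrite !mxE eqn_a.
- split; first by rewrite -cB -[leqRHS]card_ord max_card.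
  move=> b [Vb hb]; exists V, h; split=> //.
  + by move=> c _ j; apply: polynomial_fun_analytic.
  + apply: (triangular_rank einj).
    * apply: differentiable_row => j; exact: polynomial_fun_differentiable.
    * move=> j i ji; rewrite (_ : (fun _ => _) =
        (fun y => tower_eval (coords y) (e j).+1 (eqn (e j)))).
        exact: derive_tower_const.
      by apply/funext => y; rewrite mxE.
    * move=> j; rewrite (_ : (fun _ => _) =
        (fun y => tower_eval (coords y) (e j).+1 (eqn (e j)))).
        by rewrite derive_tower; case: Vb => _ [_ [_]]; apply.
      by apply/funext => y; rewrite mxE.
  + by rewrite setIAC setIid.
move=> y [Vy hy]; have [yO [yO1 [yO2 yO3]]] := Vy; split=> //; split=> [p' p'ps|q qqs]; last first.
  have ltq : (index q qs < size qs)%N by rewrite index_mem.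
  by have := yO1 (Ordinal ltq); rewrite /= nth_index.
have [P hP] := tower_fun_meval p' (leqnn d).
have -> : meval (fun i => y 0 i) p' = tower_eval (coords y) d P.
  by rewrite hP; apply: meval_eq => i; rewrite coordsE.
apply: (@ae_zero_regular R T U v U_ultra d) => [|j ltj dep].
  apply: filterS U_basic => t /= [[h0 _] _]; rewrite hP -[RHS](h0 p' p'ps).
  by apply: meval_eq => i; rewrite v_coords // coordsE.
pose i := Ordinal ltj; have nfree : i \notin free_coords by rewrite inE negbK; apply/asboolP.
split; last exact: (yO2 i nfree).
have iE : i \in E by rewrite inE; apply: contra nfree; apply/fintype.subsetP.
have [k ke] : exists k, e k = i.
  exists (cast_ord cE (enum_rank_in iE i)).
  by rewrite /e cast_ord_comp cast_ord_id enum_rankK_in.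
move: hy => /rowP/(_ k); rewrite !mxE ke.
by rewrite /eqn (negbTE nfree).
Qed.

End Chain.
End Submanifold.

(** * Coordinates on a graph *)

(** This serves to replace a semialgebraic set by a single one of its basic pieces along an
    ultrafilter. *)
Lemma ultra_has (T : Type) (U : set_system T) (A : eqType) (S : seq A)
    (P : A -> set T) : UltraFilter U ->
  U [set t | exists2 s, s \in S & P s t] -> exists2 s, s \in S & U (P s).
Proof.
move=> UU; elim: S => [|s S IH] US.
  by have [t []] := filter_ex US.
have [Ps|nPs] := in_ultra_setVsetC (P s) UU; first by exists s; rewrite ?mem_head.
have [|s' s'S Us'] := IH; last by exists s' => //; rewrite inE s'S orbT.
apply: filterS (filterI US nPs) => t /= [[s' + Ps'] nPst].
by rewrite inE => /orP[/eqP s's|s'S]; [move: Ps'; rewrite s's|exists s'].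
Qed.

(** Write P = S (X - c) with S(c) nonzero: S keeps its sign near c while X - c changes sign. *)
Lemma simple_root_sign (R : realType) (P : {poly R}) c e : 0 < e ->
  P.[c] = 0 -> P^`().[c] != 0 ->
  exists2 h, 0 < h < e & P.[c - h] * P.[c + h] < 0.
Proof.
move=> e0 /eqP/factor_theorem[S SE]; rewrite SE derivM derivXsubC mulr1 !hornerE.
rewrite subrr mulr0 add0r => Sc; have Sc0 : 0 < `|S.[c]| by rewrite normr_gt0.
have [d d0 hd] := @poly_cont R c S _ Sc0.
have sgS y : `|y - c| < d -> Num.sg S.[y] = Num.sg S.[c] by move=> /hd/sgr_near.
exists (Num.min (e / 2) (d / 2)).
  rewrite lt_min !divr_gt0 //= gt_min; apply/orP; left; lra.
set h := Num.min _ _; have h0 : 0 < h by rewrite lt_min !divr_gt0.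
have hd2 : h < d by rewrite gt_min; apply/orP; right; lra.
rewrite -sgr_lt0 !hornerE !sgrM !sgS; last 2 first.
- by rewrite (_ : c + h - c = h) ?gtr0_norm //; ring.
- by rewrite (_ : c - h - c = - h) ?normrN ?gtr0_norm //; ring.
rewrite (_ : c - h - c = - h); last by ring.
rewrite (_ : c + h - c = h); last by ring.
rewrite sgrN (gtr0_sg h0) mulr1 mulrN1 mulNr oppr_lt0 -expr2 sqr_sg.
by rewrite Sc.
Qed.

Section Graph.
Variables (R : realType) (n : nat).

Definition update (z : 'rV[R]_n) (m : nat) (c : R) : 'rV[R]_n :=
  \row_i (if i == m :> nat then c else z 0 i).

Lemma coords_update z m c j : (m < n)%N ->
  coords (update z m c) j = if j == m then c else coords z j.
Proof.
move=> mn; rewrite /coords; case: insubP => [k _ <-|]; first by rewrite mxE.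
by rewrite -leqNgt => nj; case: eqP => // jm; move: nj; rewrite jm leqNgt mn.
Qed.

Lemma eq_tower_eval_update z m c i (p : tower R i) : (m < n)%N -> (i <= m)%N ->
  tower_eval (coords (update z m c)) i p = tower_eval (coords z) i p.
Proof.
move=> mn im; apply: eq_tower_eval => j ji.
by rewrite coords_update // ltn_eqF // (leq_trans ji).
Qed.

Lemma tower_eval_update z m c (p : {poly tower R m}) : (m < n)%N ->
  tower_eval (coords (update z m c)) m.+1 p =
  (map_poly (tower_eval (coords z) m) p).[c].
Proof.
move=> mn; rewrite tower_evalS coords_update // eqxx; congr (_.[_]).
by apply/polyP => j; rewrite !coef_map /= eq_tower_eval_update.
Qed.

Variables (T : Type) (U : set_system T) (v : T -> nat -> R).
Hypothesis U_ultra : UltraFilter U.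

Local Notation dep := (dependent U v).
Local Notation rel := (min_rel U v).

(* Moving the free coordinate j0, one can solve the later relations one after
   the other because the minimal relations have simple roots at a. *)
Lemma move_free_coordinate (a : 'rV[R]_n) j0 :
  (forall i, (i < n)%N -> dep i -> tower_eval (coords a) i.+1 (rel i) = 0 /\
     tower_eval (coords a) i.+1 (rel i)^`() != 0) ->
  (j0 < n)%N -> ~ dep j0 ->
  forall e, 0 < e -> exists z, [/\ ball a e z, coords z j0 != coords a j0,
    forall i, (i < j0)%N -> coords z i = coords a i &
    forall i, (i < n)%N -> dep i -> tower_eval (coords z) i.+1 (rel i) = 0].
Proof.
move=> areg j0n ndep.
suff : forall m, (j0 < m <= n)%N -> forall e, 0 < e -> exists z,
    [/\ ball a e z, coords z j0 != coords a j0,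
    forall i, (i < j0)%N -> coords z i = coords a i &
    forall i, (i < m)%N -> dep i -> tower_eval (coords z) i.+1 (rel i) = 0].
  by apply; rewrite j0n leqnn.
have ball_update e z m c : 0 < e -> (m < n)%N -> ball a e z -> `|c - coords a m| < e ->
    ball a e (update z m c).
  move=> e0 mn [_ az] ca; split=> // i j; rewrite ord1 mxE.
  case: eqP => [jm|_]; last exact: az.
  by rewrite -ball_normE /= distrC; move: ca; rewrite -jm coordsE.
elim=> [//|m IH]; rewrite ltnS leq_eqVlt => /andP[/orP[/eqP jm|jm] mn] e e0.
  (* At the start only the free coordinate is moved; the relations of smaller index do not involve
     it. *)
  subst m; exists (update a j0 (coords a j0 + e / 2)); split.
  - apply: ball_update => //; first exact: ballxx.
    by rewrite addrC addKr ger0_norm ?ltW ?divr_gt0 //; lra.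
  - rewrite coords_update // eqxx -subr_eq0 addrC addKr; apply: lt0r_neq0; lra.
  - by move=> i ij; rewrite coords_update // ltn_eqF.
  move=> i; rewrite ltnS leq_eqVlt => /orP[/eqP->//|ij] di.
  by rewrite eq_tower_eval_update //; case: (areg i) => //; apply: ltn_trans ij _.
have IHm : (j0 < m <= n)%N by rewrite jm ltnW.
have [dm|ndm] := pselect (dep m); last first.
  have [z [az zj zl zr]] := IH IHm e e0; exists z; split=> // i.
  by rewrite ltnS leq_eqVlt => /orP[/eqP->//|]; apply: zr.
pose P (z : 'rV[R]_n) : {poly R} := map_poly (tower_eval (coords z) m) (rel m).
have PE z c : (P z).[c] = tower_eval (coords (update z m c)) m.+1 (rel m).
  by rewrite tower_eval_update.
have [Pa0 Pa'] : (P a).[coords a m] = 0 /\ (P a)^`().[coords a m] != 0.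
  by have [r0 r1] := areg m mn dm; rewrite deriv_map; split.
have [h /andP[h0 he] sgn] := simple_root_sign e0 Pa0 Pa'.
(* The sign change between the two ends is an open polynomial condition on z. It therefore survives
   the motion of the earlier coordinates, and the intermediate value theorem gives the new
   coordinate m. *)
have [q hq] : polynomial_fun (fun z : 'rV[R]_n =>
    - ((P z).[coords a m - h] * (P z).[coords a m + h])).
  have pP c : polynomial_fun (fun z : 'rV[R]_n => (P z).[c]).
    have [p hp] : polynomial_fun (fun z : 'rV[R]_n => \sum_(j < size (rel m))
        tower_eval (coords z) m (rel m)`_j * c ^+ j).
      apply: polynomial_fun_sum => j; apply: polynomial_funM.
        exact: polynomial_fun_tower.
      exact: polynomial_fun_cst.
    exists p => z; rewrite -hp (@horner_coef_wide _ (size (rel m))) ?size_poly //.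
    by apply: eq_bigr => j _; rewrite coef_map.
  have [p hp] := polynomial_funM (polynomial_fun_cst n (-1)) (polynomial_funM
    (pP (coords a m - h)) (pP (coords a m + h))).
  by exists p => z; rewrite -hp mulN1r.
have /nbhs_ballP[d /= d0 hd] : nbhs a [set z : 'rV[R]_n |
    0 < - ((P z).[coords a m - h] * (P z).[coords a m + h])].
  apply: open_nbhs_nbhs; split; last by rewrite /= oppr_gt0.
  by apply: open_polynomial_gt0; exists q.
have [|z [az zj zl zr]] := IH IHm (Num.min e d); first by rewrite lt_min e0.
have /hd : ball a d z by apply: le_ball az; rewrite ge_min lexx orbT.
rewrite /= oppr_gt0 => sgnz.
have [|c] := @poly_ivtoo _ (P z) (coords a m - h) (coords a m + h) _ sgnz; first by lra.
rewrite in_itv /= => /andP[c1 c2] /eqP Pzc.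
exists (update z m c); split.
- apply: ball_update => //; first by apply: le_ball az; rewrite ge_min lexx.
  by rewrite ltr_norml; apply/andP; split; lra.
- by rewrite coords_update // ltn_eqF.
- move=> i ij; rewrite coords_update // ltn_eqF ?zl //; exact: ltn_trans ij jm.
move=> i; rewrite ltnS leq_eqVlt => /orP[/eqP->|im] di; first by rewrite -PE.
by rewrite eq_tower_eval_update // zr.
Qed.

End Graph.

(** If the coordinate j were free, moving it with all smaller coordinates fixed would give two
    points of [G] with the same first d coordinates. *)
Lemma graph_dependent (R : realType) d M (G : set 'rV[R]_(d + M)) (T : Type)
    (U : set_system T) (w : T -> 'rV[R]_(d + M)) :
  UltraFilter U -> semialgebraic G ->
  (forall a b, G a -> G b -> lsubmx a = lsubmx b -> a = b) ->
  U [set t | G (w t)] ->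
  forall j, (d <= j < d + M)%N -> dependent U (fun t => coords (w t)) j.
Proof.
move=> UU [S GE] Ginj Gw j0 /andP[dj jn]; apply: contrapT => ndep.
pose v t := coords (w t).
have [[ps qs] sS /= Us] : exists2 s, s \in S &
    U [set t | basic_semialgebraic s.1 s.2 (w t)].
  by apply: ultra_has; apply: filterS Gw => t /=; rewrite GE.
have [t0 [[b0 b1] reg0]] := filter_ex (filterI Us (ae_regular v UU (d + M))).
pose a := w t0.
pose O1 : set 'rV[R]_(d + M) := [set y | forall q : 'I_(size qs),
  0 < meval (fun i => y 0 i) (nth 0 qs q)].
pose O2 : set 'rV[R]_(d + M) := [set y | forall i : 'I_(d + M),
  dependent U v i -> tower_eval (coords y) i (lead_coef (min_rel U v i)) != 0].
have oO : open (O1 `&` O2).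
  apply: openI.
    apply: open_bigcap_fin => q; apply: open_polynomial_gt0.
    by exists (nth 0 qs q).
  apply: (@open_bigcap_fin _ _ _ (fun i : 'I_(d + M) => [set y | dependent U v i ->
      tower_eval (coords y) i (lead_coef (min_rel U v i)) != 0])) => i.
  have [di|ndi] := pselect (dependent U v i); last first.
    by rewrite (_ : mkset _ = setT); [exact: openT|apply/seteqP; split=> y // _ /ndi].
  rewrite (_ : mkset _ = [set y |
    tower_eval (coords y) i (lead_coef (min_rel U v i)) != 0]).
    by apply: open_polynomial_neq0; apply: polynomial_fun_tower.
  by apply/seteqP; split=> y /=; [apply|].
have /nbhs_ballP[e /= e0 he] : nbhs a (O1 `&` O2).
  apply: open_nbhs_nbhs; split=> //; split=> [q|i di].
    by apply: b1; apply: mem_nth.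
  by have [[_]] := reg0 i (ltn_ord i) di.
have [|z [az zj zl zr]] := @move_free_coordinate R _ T U v a j0 _ jn ndep e e0.
  by move=> i lti di; have [[]] := reg0 i lti di.
have [zO1 zO2] := he z az.
have Gz : G z.
  rewrite GE; exists (ps, qs) => //=; split=> [p pps|q qqs]; last first.
    have ltq : (index q qs < size qs)%N by rewrite index_mem.
    by have := zO1 (Ordinal ltq); rewrite /= nth_index.
  have [P hP] := tower_fun_meval p (leqnn (d + M)).
  have -> : meval (fun i => z 0 i) p = tower_eval (coords z) (d + M) P.
    by rewrite hP; apply: meval_eq => i; rewrite coordsE.
  apply: (@ae_zero_regular R T U v UU (d + M)) => [|j ltj dj'].
    apply: filterS Us => t /= [h0 _]; rewrite hP -[RHS](h0 p pps).
    by apply: meval_eq => i; rewrite /v coordsE.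
  by split; [apply: zr|apply: (zO2 (Ordinal ltj))].
move: zj; rewrite (Ginj z a) ?eqxx //; first by rewrite GE; exists (ps, qs).
apply/rowP => i; rewrite !mxE.
have := zl (lshift M i); rewrite !coordsE; apply.
exact: leq_trans (ltn_ord i) dj.
Qed.

(** * Growth of filtrations *)

Lemma leq_expn a b r : (a <= b)%N -> (a ^ r <= b ^ r)%N.
Proof. by case: r => [|r] ab; rewrite ?expn0 ?leq_exp2r. Qed.

Section Growth.
Variables (K : fieldType) (S : Type) (F : set_system S).
Hypothesis F_proper : ProperFilter F.
Implicit Types (V : nat -> set (S -> K)) (f g w : S -> K).

Record filtration V : Prop := Filtration {
  filtration_mono : forall a b, (a <= b)%N -> V a `<=` V b;
  filtration_cst : forall c, V 0%N (fun=> c);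
  filtrationD : forall a f g, V a f -> V a g -> V a (fun s => f s + g s);
  filtrationM : forall a b f g, V a f -> V b g -> V (a + b)%N (fun s => f s * g s)
}.

(** Modulo equality along [F], the dimension of [V n] is O(n^r); r thus bounds the Gelfand-Kirillov
    dimension. Spanning families make it possible to avoid the quotient space. *)
Definition growth V r := exists C : nat, forall n, exists (I : finType) (h : I -> S -> K),
  (#|I| <= C * n.+1 ^ r)%N /\
  forall f, V n f -> exists l : I -> K, F [set s | f s = \sum_i l i * h i s].

Definition constants (n : nat) : set (S -> K) := [set f | exists c, f = fun=> c].

Definition adjoin w V n : set (S -> K) :=
  [set f | exists2 g : nat -> S -> K, forall l, V n (g l) &
     forall s, f s = \sum_(l < n.+1) g l s * w s ^+ l].

Lemma filtration_constants : filtration constants.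
Proof.
split.
- by move=> a b _ f [c ->]; exists c.
- by move=> c; exists c.
- by move=> a f g [c ->] [c' ->]; exists (c + c').
- by move=> a b f g [c ->] [c' ->]; exists (c * c').
Qed.

Lemma growth_constants : growth constants 0.
Proof.
exists 1%N => n; exists unit, (fun _ _ => 1); split=> [|_ [c ->]].
  by rewrite card_unit.
exists (fun=> c); apply: filterS filterT => s _ /=.
by rewrite (bigD1 tt) //= big1 ?addr0 ?mulr1 // => -[].
Qed.

Section Adjoin.
Variables (w : S -> K) (V : nat -> set (S -> K)).
Hypothesis V_filtration : filtration V.

Let Vcst n c : V n (fun=> c).
Proof.
apply: (filtration_mono V_filtration (leq0n n)).
exact: (filtration_cst V_filtration).
Qed.

Lemma filtration_sum n I (r : seq I) (P : pred I) (f : I -> S -> K) :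
  (forall i, P i -> V n (f i)) -> V n (fun s => \sum_(i <- r | P i) f i s).
Proof.
move=> Vf; elim: r => [|i r IH].
  by under eq_fun do rewrite big_nil; apply: Vcst.
under eq_fun do rewrite big_cons; case: (boolP (P i)) => // Pi.
by apply: filtrationD => //; apply: Vf.
Qed.

Lemma filtrationX a f n : V a f -> V (a * n)%N (fun s => f s ^+ n).
Proof.
move=> Vf; elim: n => [|n IH]; first by under eq_fun do rewrite expr0.
by under eq_fun do rewrite exprS; rewrite mulnS; apply: filtrationM.
Qed.

Let adjoin_poly n f (g : nat -> S -> K) :
  (forall s, f s = \sum_(l < n.+1) g l s * w s ^+ l) <->
  forall s, f s = (\poly_(l < n.+1) g l s).[w s].
Proof. by split=> h s; rewrite h horner_poly. Qed.

Lemma filtration_adjoin : filtration (adjoin w V).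
Proof.
split.
- move=> a b ab f [g Vg fE]; exists (fun l s => if (l < a.+1)%N then g l s else 0).
    move=> l; case: (l < a.+1)%N; last exact: Vcst.
    exact: (filtration_mono V_filtration ab).
  move=> s; rewrite fE (@big_ord_widen _ _ _ a.+1 b.+1 (fun l => g l s * w s ^+ l)) // big_mkcond.
  by apply: eq_bigr => i _; case: ifP => _ //; rewrite mul0r.
- move=> c; exists (fun l s => c *+ (l == 0)%N) => [l|s] //.
  by rewrite big_ord_recl big1 ?addr0 ?mulr1 // => i _; rewrite mulr0n mul0r.
- move=> a f f' [g Vg fE] [g' Vg' fE'].
  exists (fun l s => g l s + g' l s) => [l|s]; first exact: filtrationD.
  by rewrite fE fE' -big_split; apply: eq_bigr => i _; rewrite mulrDl.
move=> a b f f' [g Vg /adjoin_poly fE] [g' Vg' /adjoin_poly fE'].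
pose p s := \poly_(l < a.+1) g l s; pose p' s := \poly_(l < b.+1) g' l s.
exists (fun l s => \sum_(i < l.+1) (p s)`_i * (p' s)`_(l - i)) => [l|s].
  apply: filtration_sum => i _; apply: filtrationM => //.
    by under eq_fun do rewrite coef_poly; case: (i < a.+1)%N.
  by under eq_fun do rewrite coef_poly; case: (l - i < b.+1)%N.
rewrite fE fE' -/(p s) -/(p' s) -hornerM (@horner_coef_wide _ (a + b).+1).
  by apply: eq_bigr => i _; rewrite coefM.
apply: leq_trans (size_polyMleq _ _) _.
have sp : (size (p s) <= a.+1)%N by apply: size_poly.
have sp' : (size (p' s) <= b.+1)%N by apply: size_poly.
apply: (@leq_trans (a.+1 + b.+1).-1); last by rewrite addSn addnS.
by rewrite -!subn1 leq_sub2r // leq_add.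
Qed.

Lemma sub_adjoin n f : V n f -> adjoin w V n f.
Proof.
move=> Vf; exists (fun l s => if l == 0%N then f s else 0) => [l|s].
  by case: (l == 0%N).
by rewrite big_ord_recl big1 ?addr0 ?mulr1 // => i _; rewrite mul0r.
Qed.

Lemma mem_adjoin : adjoin w V 1%N w.
Proof.
exists (fun l s => (l == 1%N)%:R) => [l|s]; first exact: Vcst.
by rewrite !big_ord_recl big_ord0 /= mul0r add0r mul1r addr0 expr1.
Qed.

(** The n + 1 powers of w multiply the size of a spanning family by n + 1. *)
Lemma growth_adjoin r : growth V r -> growth (adjoin w V) r.+1.
Proof.
move=> [C hC]; exists C => n; have [I [h [cI hh]]] := hC n.
exists ('I_n.+1 * I)%type, (fun (i : 'I_n.+1 * I) s => h i.2 s * w s ^+ i.1); split.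
  by rewrite card_prod card_ord expnS mulnCA leq_mul2l cI orbT.
move=> f [g Vg fE]; have /choice[l hl] (j : 'I_n.+1) := hh (g j) (Vg j).
exists (fun i => l i.1 i.2); apply: filterS (filter_forall _ hl) => s /= hs.
rewrite fE -(pair_bigA _ (fun (j : 'I_n.+1) i => l j i * (h i s * w s ^+ j))) /=.
by apply: eq_bigr => j _; rewrite hs mulr_suml; apply: eq_bigr => i _; rewrite mulrA.
Qed.

(* Multiplication by a power of the leading coefficient c e lowers the degree in
   w below e, at the price of a bounded multiple of the filtration index. *)
Lemma growth_algebraic r (c : nat -> S -> K) e D : growth V r ->
  (forall l, V D (c l)) ->
  F [set s | \sum_(l < e.+1) c l s * w s ^+ l = 0] -> F [set s | c e s != 0] ->
  growth (adjoin w V) r.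
Proof.
move=> [C hC] Vc rel lc.
(* In degree 0 the relation would say that the leading coefficient vanishes. *)
case: e rel lc => [|e] rel lc.
  have [s [/= + /negP[]]] := filter_ex (filterI rel lc).
  by rewrite big_ord_recl big_ord0 addr0 mulr1 => ->.
have red a : exists2 f : nat -> S -> K, forall l, V (D * a)%N (f l) &
    F [set s | c e.+1 s ^+ a * w s ^+ a = \sum_(l < e.+1) f l s * w s ^+ l].
  elim: a => [|a [f Vf IH]].
    exists (fun l s => (l == 0%N)%:R) => [l|]; first exact: Vcst.
    apply: filterS filterT => s _ /=.
    by rewrite big_ord_recl big1 ?addr0 // => i _; rewrite mul0r.
  exists (fun l s => (if l is l'.+1 then c e.+1 s * f l' s else 0) +
    -1 * (f e s * c l s)).
    move=> l; apply: filtrationD => //.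
      rewrite mulnS; case: l => [|l]; first exact: Vcst.
      exact: filtrationM.
    rewrite -[(D * _)%N]add0n mulnSr; apply: filtrationM => //.
    exact: filtrationM.
  apply: filterS (filterI IH rel) => s /= [hs].
  rewrite big_ord_recr /= => /eqP; rewrite addr_eq0 => /eqP top.
  have E2 : \sum_(l < e.+1) -1 * (f e s * c l s) * w s ^+ l =
      f e s * (c e.+1 s * w s ^+ e.+1).
    transitivity (- f e s * \sum_(l < e.+1) c l s * w s ^+ l).
      by rewrite mulr_sumr; apply: eq_bigr => l _; ring.
    by rewrite top; ring.
  rewrite !exprS mulrACA hs.
  under [RHS]eq_bigr => l _ do rewrite mulrDl.
  rewrite big_split /= E2 [X in _ = X + _]big_ord_recl /= mul0r add0r.
  rewrite [X in _ * X = _]big_ord_recr /= mulrDr.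
  congr (_ + _); last by rewrite exprS; ring.
  by rewrite mulr_sumr; apply: eq_bigr => l _; rewrite /bump /= add1n exprS; ring.
have /choice[f /all_and2[Vf hf]] (a : nat) : exists f : nat -> S -> K,
    (forall l, V (D * a)%N (f l)) /\
    F [set s | c e.+1 s ^+ a * w s ^+ a = \sum_(l < e.+1) f l s * w s ^+ l].
  by have [f0 ? ?] := red a; exists f0.
exists (e.+1 * (C * D.+1 ^ r))%N => n.
have [I [h [cI hh]]] := hC (D.+1 * n)%N.
exists ('I_e.+1 * I)%type, (fun (i : 'I_e.+1 * I) s => h i.2 s * w s ^+ i.1 / c e.+1 s ^+ n);
  split.
  rewrite card_prod card_ord -mulnA leq_mul2l -mulnA -expnMn; apply/orP; right.
  apply: leq_trans cI _; rewrite leq_mul2l; apply/orP; right.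
  by apply: leq_expn; nia.
move=> u [g Vg uE].
(* The product of u by c^n is the sum of the g_a c^(n-a) (c^a w^a), and [red] rewrites the last
   factor in lower powers of w. [G l] collects the coefficient of w^l; its index is D (n - a) + n +
   D a = (D + 1) n. *)
pose G (l : nat) s := \sum_(a < n.+1) c e.+1 s ^+ (n - a) * (g a s * f a l s).
have VG l : V (D.+1 * n)%N (G l).
  apply: filtration_sum => a _.
  have -> : (D.+1 * n = D * (n - a) + (n + D * a))%N.
    by have := ltn_ord a; rewrite ltnS => an; rewrite mulSn; nia.
  apply: filtrationM => //; first exact: filtrationX.
  exact: filtrationM.
have /choice[l hl] (j : 'I_e.+1) := hh (G j) (VG j).
have FF : Filter F by typeclasses eauto.
have hfn := @filter_forall S 'I_n.+1 (fun a s =>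
  c e.+1 s ^+ a * w s ^+ a = \sum_(l < e.+1) f a l s * w s ^+ l) F FF (fun a => hf a).
exists (fun i => l i.1 i.2).
have hln := filter_forall FF hl.
apply: filterS (filterI lc (filterI hln hfn)) => s /= [cs [hs fs]].
have cn0 : c e.+1 s ^+ n != 0 by rewrite expf_neq0.
rewrite -(pair_bigA _ (fun (j : 'I_e.+1) i => l j i * (h i s * w s ^+ j / c e.+1 s ^+ n))) /=.
apply: (mulfI cn0); rewrite mulr_sumr.
have -> : \sum_(j < e.+1) c e.+1 s ^+ n * (\sum_i l j i * (h i s * w s ^+ j / c e.+1 s ^+ n)) =
    \sum_(j < e.+1) G j s * w s ^+ j.
  apply: eq_bigr => j _; rewrite hs mulr_suml mulr_sumr; apply: eq_bigr => i _.
  by field.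
under [RHS]eq_bigr => j _ do rewrite mulr_suml.
rewrite exchange_big /= uE mulr_sumr; apply: eq_bigr => a _.
have an : (a <= n)%N by rewrite -ltnS.
transitivity (c e.+1 s ^+ (n - a) * g a s * (c e.+1 s ^+ a * w s ^+ a)).
  have -> : c e.+1 s ^+ n = c e.+1 s ^+ (n - a) * c e.+1 s ^+ a.
    by rewrite -exprD subnK.
  by ring.
by rewrite fs mulr_sumr; apply: eq_bigr => j _; rewrite !mulrA.
Qed.

(** The monomials with exponents below n number n^p, where p = [#|J|] exceeds r, and they lie in a
    space of dimension O(n^r); for large n they are linearly dependent. *)
Lemma growth_dependence r (J : finType) (y : J -> S -> K) D : growth V r ->
  (forall j, V D (y j)) -> (r < #|J|)%N ->
  exists n (mu : {ffun J -> 'I_n} -> K), (exists gam, mu gam != 0) /\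
    F [set s | \sum_gam mu gam * \prod_j y j s ^+ gam j = 0].
Proof.
move=> [C hC] Vy rJ; set p := #|J| in rJ.
(* With n > C (p D + 1)^r one gets C ((p D + 1) n)^r < n^(r+1) <= n^p. *)
pose n := (C * (p * D).+1 ^ r).+1.
have [I [h [cI hh]]] := hC (p * (D * n))%N.
have Vmon (gam : {ffun J -> 'I_n}) : V (p * (D * n))%N (fun s => \prod_j y j s ^+ gam j).
  have : forall r : seq J, V (size r * (D * n))%N (fun s => \prod_(j <- r) y j s ^+ gam j).
    elim=> [|j s' IH]; first by under eq_fun do rewrite big_nil.
    under eq_fun do rewrite big_cons; rewrite mulSn; apply: filtrationM => //.
    apply: (filtration_mono V_filtration (_ : D * gam j <= D * n)%N).
      by rewrite leq_mul2l ltnW ?orbT.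
    exact: filtrationX.
  move=> /(_ (enum J)); rewrite -cardE -/p.
  by under eq_fun do rewrite big_enum.
have /choice[l hl] (gam : {ffun J -> 'I_n}) := hh _ (Vmon gam).
pose A : 'M[K]_(#|{: {ffun J -> 'I_n}}|, #|I|) :=
  \matrix_(a, b) l (enum_val a) (enum_val b).
have ltc : (#|I| < #|{: {ffun J -> 'I_n}}|)%N.
  rewrite card_ffun card_ord -/p; apply: leq_ltn_trans cI _.
  apply: (@leq_ltn_trans (C * ((p * D).+1 * n) ^ r)).
    by rewrite leq_mul2l leq_expn ?orbT // /n; nia.
  rewrite expnMn mulnA; apply: (@leq_trans (n ^ r.+1)); last first.
    by rewrite leq_pexp2l.
  by rewrite expnS ltn_mul2r expn_gt0 /n /= ltnSn.
have [u u0 uA] : exists2 u : 'rV_#|{: {ffun J -> 'I_n}}|, u != 0 & u *m A = 0.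
  have : ~~ row_free A.
    by rewrite /row_free neq_ltn (leq_ltn_trans (rank_leq_col A) ltc).
  move=> nf; apply: contrapT => nex; move: nf => /negP; apply.
  apply: inj_row_free => u uA; apply/eqP; apply: contraT => u0.
  by exfalso; apply: nex; exists u.
exists n, (fun gam => u 0 (enum_rank gam)); split.
  have /existsP[a ua] : [exists a, u 0 a != 0].
    apply: contraT => /existsPn h0; move: u0 => /negP[]; apply/eqP/rowP => a.
    by rewrite mxE; apply/eqP; move: (h0 a); rewrite negbK.
  by exists (enum_val a); rewrite enum_valK.
apply: filterS (filter_forall _ hl) => s /= hs.
under eq_bigr => gam _ do rewrite hs mulr_sumr.
rewrite exchange_big /= big1 // => i _.
move: uA => /rowP/(_ (enum_rank i)); rewrite !mxE => uA.
transitivity ((\sum_a u 0 a * A a (enum_rank i)) * h i s); last by rewrite uA mul0r.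
rewrite mulr_suml (reindex (@enum_val _ (mem {ffun J -> 'I_n}))) /=; last first.
  by exists enum_rank => a _; rewrite ?enum_valK ?enum_rankK.
by apply: eq_bigr => a _; rewrite mxE enum_valK enum_rankK mulrA.
Qed.

End Adjoin.
End Growth.

(** * Ultrafilters and dimension *)

(* Compactness of the space of ultrafilters. *)
Lemma ultrafilter_cover (T : Type) (A : set T) (P : set T -> Prop) :
  P set0 -> (forall B C, P B -> P C -> P (B `|` C)) ->
  (forall B C, B `<=` C -> P C -> P B) ->
  (forall U : set_system T, UltraFilter U -> U A -> exists2 B, U B & P B) -> P A.
Proof.
move=> P0 PU Psub Pultra; apply: contrapT => nPA.
(* If [P A] fails, the sets whose complement in [A] satisfies [P] form a proper filter; an
   ultrafilter above it contradicts [Pultra]. *)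
pose G : set_system T := [set B | P (A `\` B)].
have G_proper : ProperFilter G.
  split; first by rewrite /G /= setD0.
  split.
  - by rewrite /G /= setDT.
  - by move=> B C; rewrite /G /= setDIr; apply: PU.
  - by move=> B C BC; rewrite /G /=; apply: Psub; apply: setDS.
have [U [UU GU]] := ultraFilterLemma G_proper.
have UA : U A by apply: GU; rewrite /G /= setDv.
have [B UB PB] := Pultra U UU UA.
have UnB : U (~` B) by apply: GU; rewrite /G /= setDE setCK; apply: Psub PB => x [].
by have [x []] := filter_ex (filterI UB UnB).
Qed.

Section Dimension.
Variables (R : realType) (d : nat) (X : set 'rV[R]_d).
Hypothesis X_semialgebraic : semialgebraic X.

Lemma real_dim0_cases : real_dim0 X = d \/ exists V U : set 'rV[R]_d,
  [/\ nbhs (0 : 'rV[R]_d) U, X `&` U `<=` V & analytic_dim0 V = real_dim0 X].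
Proof.
rewrite /real_dim0; elim/big_ind: _ => [|a b ha hb|p /asboolP[V [U [_ _ nU XU dV]]]].
- by left.
- by rewrite /minn; case: ifP.
- by right; exists V, U.
Qed.

(** If the dimension is less than d, it is attained by some V, and some neighbourhood of 0 contains
    no submanifold of V of dimension one more. Too many free coordinates would produce one by
    [free_submanifold]. The set [O] must not depend on the ultrafilter. *)
Lemma exists_small_free : exists2 O : set 'rV[R]_d, open O & O 0 /\
  forall (T : Type) (U : set_system T) (v : T -> nat -> R) (x : T -> 'rV[R]_d),
    UltraFilter U -> (forall t i, (i < d)%N -> v t i = coords (x t) i) ->
    U [set t | X (x t) /\ O (x t)] -> (#|free_coords d U v| <= real_dim0 X)%N.
Proof.
have full : (d <= real_dim0 X)%N -> exists2 O : set 'rV[R]_d, open O & O 0 /\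
  forall (T : Type) (U : set_system T) (v : T -> nat -> R) (x : T -> 'rV[R]_d),
    UltraFilter U -> (forall t i, (i < d)%N -> v t i = coords (x t) i) ->
    U [set t | X (x t) /\ O (x t)] -> (#|free_coords d U v| <= real_dim0 X)%N.
  move=> dX; exists setT; first exact: openT.
  split=> // T U v x _ _ _; apply: leq_trans dX.
  by rewrite -[leqRHS]card_ord max_card.
have [dE|[V [U0 [nU0 XU0 dV]]]] := real_dim0_cases; first by apply: full; rewrite dE.
have [dX|ltd] := leqP d (real_dim0 X); first exact: full.
have [U1 nU1 hU1] : exists2 U1, nbhs (0 : 'rV[R]_d) U1 & ~ exists M,
    [/\ M !=set0, analytic_submanifold (real_dim0 X).+1 M & M `<=` V `&` U1].
  apply: contrapT => nex.
  have ltd1 : ((real_dim0 X).+1 < d.+1)%N by rewrite ltnS.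
  have : ((real_dim0 X).+1 <= analytic_dim0 V)%N.
    apply: (@leq_bigmax_cond _ _ (fun p : 'I_d.+1 => p : nat) (Ordinal ltd1)).
    apply/asboolP => U nU; apply: contrapT => nM; apply: nex; exists U => //.
  by rewrite dV ltnn.
exists (interior (U0 `&` U1)); first exact: open_interior.
split; first exact: filterI.
move=> T U v x UU vx UX; rewrite leqNgt; apply/negP => lt.
have [S XE] := X_semialgebraic.
have [[ps qs] sS /= Us] : exists2 s, s \in S &
    U [set t | basic_semialgebraic s.1 s.2 (x t)].
  by apply: ultra_has; apply: filterS UX => t [+ _]; rewrite XE.
have Ub : U [set t | basic_semialgebraic ps qs (x t) /\ interior (U0 `&` U1) (x t)].
  by apply: filterS (filterI Us UX) => t [h [_ ?]].
have [M [M0 Msub MB]] := free_submanifold UU vx Ub (@open_interior _ _) lt.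
apply: hU1; exists M; split=> // y /MB[by_ /interior_subset[U0y U1y]]; split=> //.
by apply: XU0; split=> //; rewrite XE; exists (ps, qs).
Qed.

End Dimension.

(** * Nonvanishing of polynomials and polynomials with varying coefficients *)

Section PolynomialFamilies.
Variable K : numFieldType.

Lemma polynomial_fun_line q (f : 'rV[K]_q -> K) (a b : 'rV[K]_q) :
  polynomial_fun f -> exists p : {poly K}, forall c, f (a + c *: b) = p.[c].
Proof.
move=> [p hp]; exists (\sum_(m <- msupp p) (mcoeff m p)%:P *
  \prod_(i < q) ((a 0 i)%:P + (b 0 i)%:P * 'X) ^+ m i) => c.
rewrite hp mevalE horner_sum; apply: eq_bigr => m _.
rewrite hornerM hornerC horner_prod; congr (_ * _); apply: eq_bigr => i _.
by rewrite !hornerE !mxE mulrC.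
Qed.

Lemma poly_nonroot (p : {poly K}) : p != 0 -> exists c, p.[c] != 0.
Proof.
move=> p0; apply: contrapT => nex.
pose s : seq K := [seq i%:R | i <- iota 0 (size p)].
have : (size s < size p)%N.
  apply: max_poly_roots => //.
    apply/allP => x _; apply/eqP; apply/eqP; apply: contraT => nx.
    by exfalso; apply: nex; exists x.
  by rewrite map_inj_uniq ?iota_uniq // => i j /eqP; rewrite eqr_nat => /eqP.
by rewrite size_map size_iota ltnn.
Qed.

(** On the line through a and b both functions become nonzero polynomials in one variable, whose
    product has a nonroot. *)
Lemma polynomial_fun_common q (f g : 'rV[K]_q -> K) a b :
  polynomial_fun f -> polynomial_fun g -> f a != 0 -> g b != 0 ->
  exists z, f z != 0 /\ g z != 0.
Proof.
move=> pf pg fa gb.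
have [p hp] := polynomial_fun_line a (b - a) pf.
have [r hr] := polynomial_fun_line a (b - a) pg.
have p0 : p != 0.
  by apply: contraNneq fa => pE; have := hp 0; rewrite scale0r addr0 pE horner0 => ->.
have r0 : r != 0.
  by apply: contraNneq gb => rE; have := hr 1; rewrite scale1r subrKC rE horner0 => ->.
have [|c] := @poly_nonroot (p * r); first by rewrite mulf_neq0.
rewrite hornerM mulf_eq0 negb_or -hp -hr => /andP[? ?].
by exists (a + c *: (b - a)).
Qed.

(** If the sum vanished identically, scaling one variable at a time by an arbitrary c would separate
    its exponents; after all variables only the term of [gam0] remains. *)
Lemma monomials_independent (J : finType) n (mu : {ffun J -> 'I_n} -> K) gam0 :
  mu gam0 != 0 -> exists v : J -> K, \sum_gam mu gam * \prod_j v j ^+ gam j != 0.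
Proof.
move=> mu0; apply: contrapT => nex.
have all0 v : \sum_gam mu gam * \prod_j v j ^+ gam j = 0.
  by apply/eqP; apply: contraT => nz; exfalso; apply: nex; exists v.
have split0 (s : seq J) v : \sum_(gam : {ffun J -> 'I_n} | all (fun j => gam j == gam0 j) s)
    mu gam * \prod_j v j ^+ gam j = 0.
  elim: s v => [|j s IH] v; first exact: all0.
  pose p : {poly K} := \sum_(gam : {ffun J -> 'I_n} | all (fun j => gam j == gam0 j) s)
    (mu gam * \prod_i v i ^+ gam i) *: 'X^(gam j).
  have p0 : p = 0.
    apply/eqP; apply: contraT => /poly_nonroot[c] /negP[]; apply/eqP.
    rewrite -[RHS](IH (fun i => if i == j then c * v i else v i)) horner_sum.
    apply: eq_bigr => gam _; rewrite !hornerE -mulrA; congr (_ * _).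
    rewrite (bigD1 j) //= [RHS](bigD1 j) //= eqxx exprMn.
    rewrite [X in _ = _ * X](eq_bigr (fun i => v i ^+ gam i)); first by ring.
    by move=> i /negbTE ->.
  transitivity p`_(gam0 j); last by rewrite p0 coef0.
  rewrite coef_sum big_mkcond [RHS]big_mkcond /=.
  apply: eq_bigr => gam _; rewrite coefZ coefXn.
  have -> : (gam0 j == gam j :> nat) = (gam j == gam0 j) by rewrite eq_sym.
  by case: (gam j == gam0 j) => /=; case: ifP => _; rewrite ?mulr1 ?mulr0.
have := split0 (enum J) (fun=> 1); rewrite (bigD1 gam0) /=; last by apply/allP.
rewrite [X in _ + X]big1 ?addr0.
  rewrite big1 ?mulr1 => [|j _]; last by rewrite expr1n.
  by move/eqP; rewrite (negbTE mu0).
move=> gam /andP[/allP h /eqP gam_neq]; exfalso; apply: gam_neq; apply/ffunP => j.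
by apply/eqP; apply: h; rewrite mem_enum.
Qed.

(** With the uniform size bound, this is a polynomial in q + 1 variables whose last variable is
    singled out. *)
Definition polynomial_family q (g : 'rV[K]_q -> {poly K}) :=
  (exists B, forall z, (size (g z) <= B)%N) /\
  forall l, polynomial_fun (fun z => (g z)`_l).

Lemma polynomial_familyM q (g h : 'rV[K]_q -> {poly K}) :
  polynomial_family g -> polynomial_family h ->
  polynomial_family (fun z => g z * h z).
Proof.
move=> [[B gB] pg] [[B' hB] ph]; split.
  exists (B + B')%N => z; apply: leq_trans (size_polyMleq _ _) _.
  by move: (gB z) (hB z); lia.
move=> l; have [p hp] : polynomial_fun (fun z =>
    \sum_(j < l.+1) (g z)`_j * (h z)`_(l - j)).
  by apply: polynomial_fun_sum => j; apply: polynomial_funM.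
by exists p => z; rewrite -hp coefM.
Qed.

Lemma polynomial_familyM_neq0 q (g h : 'rV[K]_q -> {poly K}) a b :
  polynomial_family g -> polynomial_family h -> g a != 0 -> h b != 0 ->
  exists z, g z * h z != 0.
Proof.
move=> [_ pg] [_ ph]; rewrite -!lead_coef_eq0 !lead_coefE => ga hb.
have [z [gz hz]] := polynomial_fun_common (pg _) (ph _) ga hb.
exists z; rewrite mulf_neq0 //.
  by apply: contraNneq gz => ->; rewrite coef0.
by apply: contraNneq hz => ->; rewrite coef0.
Qed.

(** The exponent e is the least one whose coefficient is not identically zero in z. *)
Lemma polynomial_family_div q (g : 'rV[K]_q -> {poly K}) a :
  polynomial_family g -> g a != 0 ->
  exists e h, [/\ polynomial_family h, exists z, (h z)`_0 != 0 &
    forall z, g z = h z * 'X^e].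
Proof.
move=> [[B gB] pg] ga.
have exl : exists l, `[< exists z, (g z)`_l != 0 >].
  exists (size (g a)).-1; apply/asboolP; exists a.
  by rewrite -lead_coefE lead_coef_eq0.
case: (ex_minnP exl) => e /asboolP[z0 gz0] emin.
exists e, (fun z => \poly_(l < B) (g z)`_(l + e)); split.
- split; first by exists B => z; apply: size_poly.
  move=> l; have [lB|lB] := ltnP l B.
    by have [p hp] := pg (l + e)%N; exists p => z; rewrite coef_poly lB hp.
  have [p hp] := @polynomial_fun_cst K q 0; exists p => z.
  by rewrite coef_poly ltnNge lB -hp.
- exists z0; rewrite coef_poly add0n; case: ltnP => //; rewrite leqn0 => /eqP B0.
  by move: gz0 (gB z0); rewrite B0 leqn0 size_poly_eq0 => + /eqP gz; rewrite gz coef0 eqxx.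
move=> z; apply/polyP => i; rewrite coefMXn; case: ltnP => [ie|ei].
  apply/eqP; apply: contraT => gi; move: ie; rewrite ltnNge => /negP[].
  by apply: emin; apply/asboolP; exists z.
rewrite coef_poly subnK //; case: ltnP => // Bi.
rewrite nth_default // (leq_trans (gB z)) // (leq_trans Bi) // leq_subr //.
Qed.

End PolynomialFamilies.

(** * Algebraic dependence *)

Section FiltrationMembership.
Variables (K : fieldType) (S : Type) (V : nat -> set (S -> K)).
Hypothesis V_filtration : filtration V.

Definition in_filtration (f : S -> K) := exists D, V D f.

Lemma in_filtration_cst c : in_filtration (fun=> c).
Proof. by exists 0%N; apply: (filtration_cst V_filtration). Qed.

Lemma in_filtrationD f g : in_filtration f -> in_filtration g ->
  in_filtration (fun s => f s + g s).
Proof.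
move=> [a Vf] [b Vg]; exists (maxn a b); apply: (filtrationD V_filtration).
  exact: (filtration_mono V_filtration (leq_maxl a b)).
exact: (filtration_mono V_filtration (leq_maxr a b)).
Qed.

Lemma in_filtrationM f g : in_filtration f -> in_filtration g ->
  in_filtration (fun s => f s * g s).
Proof. by move=> [a Vf] [b Vg]; exists (a + b)%N; apply: (filtrationM V_filtration). Qed.

Lemma in_filtrationX f n : in_filtration f -> in_filtration (fun s => f s ^+ n).
Proof. by move=> [a Vf]; exists (a * n)%N; apply: (filtrationX V_filtration). Qed.

Lemma in_filtration_sum I (r : seq I) (f : I -> S -> K) :
  (forall i, in_filtration (f i)) -> in_filtration (fun s => \sum_(i <- r) f i s).
Proof.
move=> hf; elim: r => [|i r IH].
  by under eq_fun do rewrite big_nil; apply: in_filtration_cst.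
by under eq_fun do rewrite big_cons; apply: in_filtrationD.
Qed.

Lemma in_filtration_finite (I : finType) (f : I -> S -> K) :
  (forall i, in_filtration (f i)) -> exists D, forall i, V D (f i).
Proof.
move=> /choice[D VD]; exists (\max_i D i) => i.
exact: (filtration_mono V_filtration (leq_bigmax i)).
Qed.

End FiltrationMembership.

Section Adjunctions.
Variables (K : fieldType) (S : Type) (F : set_system S).
Hypothesis F_proper : ProperFilter F.

Lemma growth_adjoin_seq (ws : seq (S -> K)) : exists V,
  [/\ filtration V, growth F V (size ws) &
      forall i, (i < size ws)%N -> V 1%N (nth (fun=> 0) ws i)].
Proof.
elim: ws => [|w ws [V [fV gV wV]]].
  exists (@constants K S); split=> //; first exact: filtration_constants.
  exact: growth_constants.
exists (adjoin w V); split; first exact: filtration_adjoin.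
  exact: growth_adjoin.
move=> [|i] /= ilt; first exact: mem_adjoin.
by apply: sub_adjoin => //; apply: wV.
Qed.

End Adjunctions.

(** * The relation between L, L F / F_j and F_j along an ultrafilter *)

Section Relation.
Variables (R : realType) (s : scalars).
Local Notation K := (scalar_field R s).

Definition embed : {rmorphism R -> K} :=
  match s return {rmorphism R -> scalar_field R s} with
  | RealScalars => idfun
  | ComplexScalars => real_complex R
  end.

Lemma realify_coord m (j : 'I_m) : exists c : 'I_(real_size s m) -> K,
  forall y : 'rV[K]_m, y 0 j = \sum_i c i * embed (realify y 0 i).
Proof.
rewrite /embed /realify; case: s => /=.
  exists (fun i => (i == j)%:R) => y; rewrite (bigD1 j) //= eqxx mul1r big1 ?addr0 //.
  by move=> i /negbTE->; rewrite mul0r.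
exists (fun i => match fintype.split i with inl a => (a == j)%:R
  | inr b => (b == j)%:R * (0 +i* 1)%C end) => y.
rewrite big_split_ord /= (bigD1 j) //= big1 ?addr0; last first.
  move=> i /negbTE ij; rewrite (unsplitK (inl i)) ij mul0r //.
rewrite (bigD1 j) //= big1 ?addr0; last first.
  move=> i /negbTE ij; rewrite (unsplitK (inr i)) ij !mul0r //.
rewrite (unsplitK (inl j)) (unsplitK (inr j)) eqxx !mul1r row_mxEl row_mxEr !mxE.
by case: (y 0 j) => a b; apply/eqP; rewrite eq_complex /=; apply/andP; split; apply/eqP; ring.
Qed.

Variables (N m k n : nat) (D : set 'rV[K]_N) (F : 'rV[K]_N -> 'rV[K]_m).
Hypothesis F_semialgebraic : semialgebraic (map_graph D F).
Hypothesis n_le_k : (n <= k)%N.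

Let dN := real_size s N.
Let dm := real_size s m.

Definition graph_coords (x : 'rV[K]_N) : nat -> R :=
  coords (row_mx (realify x) (realify (F x))).

Variable U : set_system 'rV[K]_N.
Hypothesis U_ultra : UltraFilter U.
Hypothesis U_D : U D.
Hypothesis U_free : (#|free_coords dN U graph_coords| <= n)%N.

Local Notation S := ('rV[K]_N * 'M[K]_(m, k))%type.
Local Notation dep := (dependent U graph_coords).

(** With L universally quantified inside the filter, its entries act as indeterminates, and a
    relation along the filter holds for every L at almost every x. *)
Definition param_filter : set_system S := [set A | U [set x | forall L, A (x, L)]].

Lemma param_filter_proper : ProperFilter param_filter.
Proof.
split.
  move=> U0; have [x /(_ 0)] := filter_ex (U0 : U _); exact.
split.
- by apply: filterS U_D => x _ L.
- move=> A B; rewrite /param_filter /= => UA UB.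
  by apply: filterS (filterI UA UB) => x [hA hB] L; split.
- by move=> A B AB; rewrite /param_filter /=; apply: filterS => x hA L; apply: AB.
Qed.

Let coord_fun j : S -> K := fun t => embed (graph_coords t.1 j).

Lemma in_filtration_tower V i (p : tower R i) : filtration V ->
  (forall j, (j < i)%N -> V 1%N (coord_fun j)) ->
  in_filtration V (fun t => embed (tower_eval (graph_coords t.1) i p)).
Proof.
move=> fV; elim: i p => [|i IH] p Vi.
  exact: (in_filtration_cst fV (embed (p : R))).
have : in_filtration V (fun t => \sum_(j < size (p : {poly tower R i}))
   embed (tower_eval (graph_coords t.1) i (p : {poly tower R i})`_j) * coord_fun i t ^+ j).
  apply: in_filtration_sum => // j; apply: in_filtrationM => //.
    by apply: IH => l li; apply: Vi; lia.
  by apply: in_filtrationX => //; exists 1%N; apply: Vi.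
move=> [a Va]; exists a; move: Va; congr (V a _); apply/funext => t.
rewrite (tower_eval_sum _ (leqnn _)) rmorph_sum.
by apply: eq_bigr => j _; rewrite rmorphM rmorphXn.
Qed.

(** The m k entries of L are adjoined first, then the coordinates in order. A dependent coordinate
    is algebraic over the previous ones and costs nothing by [growth_algebraic]; a free one raises
    the growth by one. *)
Lemma growth_coords i : (i <= dN + dm)%N -> exists V r,
  [/\ filtration V, growth param_filter V r,
      (r <= m * k + \sum_(j < i) ~~ `[< dep j >])%N,
      forall l j, V 1%N (fun t => t.2 l j) &
      forall j, (j < i)%N -> V 1%N (coord_fun j)].
Proof.
have pF := param_filter_proper.
elim: i => [_|i IH ilt].
  pose ws : seq (S -> K) := [seq (fun t : S => t.2 ij.1 ij.2) | ij : 'I_m * 'I_k].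
  have sws : size ws = (m * k)%N by rewrite size_map -cardE card_prod !card_ord.
  have [V [fV gV wV]] := growth_adjoin_seq pF ws.
  exists V, (size ws); split=> //; first by rewrite sws leq_addr.
  move=> l j; have lt : (index (l, j) (enum {: 'I_m * 'I_k}) < size ws)%N.
    by rewrite size_map index_mem mem_enum.
  by have := wV _ lt; rewrite (nth_map (l, j)) ?index_mem ?mem_enum // nth_index ?mem_enum.
have [V [r [fV gV rle Vt Vc]]] := IH (ltnW ilt).
have Vadj : forall j, (j < i.+1)%N -> adjoin (coord_fun i) V 1%N (coord_fun j).
  move=> j; rewrite ltnS leq_eqVlt => /orP[/eqP->|/Vc Vj]; first exact: mem_adjoin.
  exact: sub_adjoin.
have [di|ndi] := pselect (dep i); last first.
  exists (adjoin (coord_fun i) V), r.+1; split=> //; first exact: filtration_adjoin.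
  - exact: growth_adjoin.
  - rewrite big_ord_recr /=; have -> : `[< dep i >] = false by apply/asboolP.
    by rewrite /= addnA addn1 ltnS.
  - by move=> l j; apply: sub_adjoin.
exists (adjoin (coord_fun i) V), r; split=> //; first exact: filtration_adjoin.
- have [Q [Q0 /(not_ae_zero graph_coords U_ultra) Ql]] := di.
  have [D0 VD0] : exists D0, forall l : 'I_(size Q),
      V D0 (fun t => embed (tower_eval (graph_coords t.1) i Q`_l)).
    by apply: in_filtration_finite => // l; apply: in_filtration_tower.
  have Qn0 : Q != 0.
    apply/eqP => QE; have [x /=] := filter_ex Ql.
    by rewrite QE lead_coef0 rmorph0 eqxx.
  have sQ : size Q = (size Q).-1.+1 by rewrite prednK // size_poly_gt0.
  apply: (@growth_algebraic _ _ _ pF _ _ fV r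
    (fun l t => embed (tower_eval (graph_coords t.1) i Q`_l)) (size Q).-1 D0) => //.
  + move=> l; have [lQ|Ql'] := ltnP l (size Q); first exact: (VD0 (Ordinal lQ)).
    rewrite nth_default //; under eq_fun do rewrite rmorph0 rmorph0.
    exact: (filtration_mono fV (leq0n _) (filtration_cst fV 0)).
  + apply: filterS Q0 => x /= Qx L; rewrite -sQ.
    transitivity (embed (tower_eval (graph_coords x) i.+1 Q)); last by rewrite Qx rmorph0.
    rewrite (tower_eval_sum _ (leqnn _)) rmorph_sum.
    by apply: eq_bigr => j _; rewrite rmorphM rmorphXn.
  + by apply: filterS Ql => x /= Qx L; rewrite fmorph_eq0 -lead_coefE.
- by apply: leq_trans rle _; rewrite big_ord_recr /= addnA leq_addr.
- by move=> l j; apply: sub_adjoin.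
Qed.

Lemma map_graph_functional (a b : 'rV[R]_(dN + dm)) : map_graph D F a -> map_graph D F b ->
  lsubmx a = lsubmx b -> a = b.
Proof.
by move=> [x _ <-] [y _ <-]; rewrite !row_mxKl => /realify_inj ->.
Qed.

(** The coordinates of F x are dependent by [graph_dependent], so only free coordinates of x are
    counted. *)
Lemma count_free : (\sum_(j < dN + dm) ~~ `[< dep j >] <= n)%N.
Proof.
rewrite big_split_ord /= [X in (_ + X <= _)%N]big1 ?addn0.
  apply: leq_trans _ U_free; rewrite -sum1_card [leqRHS]big_mkcond /=.
  by apply: leq_sum => j _; rewrite inE; case: ifP.
move=> j _; apply/eqP; rewrite eqb0 negbK; apply/asboolP.
apply: (graph_dependent U_ultra F_semialgebraic map_graph_functional).
  by apply: filterS U_D => x Dx; exists x.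
by rewrite /= leq_addr ltn_add2l ltn_ord.
Qed.

(** The m k + k + 1 functions L, L F / F_j and F_j lie in a filtration of growth r <= m k + n <= m k
    + k, so [growth_dependence] applies; the powers of F_j are then singled out. *)
Lemma generic_relation (j : 'I_m) : U [set x | F x 0 j != 0] ->
  exists g : 'rV[K]_(m * k + k) -> {poly K},
  [/\ polynomial_family g, exists z, g z != 0 & U [set x | forall L : 'M[K]_(m, k),
    (g (row_mx (mxvec L) ((F x 0 j)^-1 *: (F x *m L)))).[F x 0 j] = 0]].
Proof.
move=> Fj; have pF := param_filter_proper.
have [V0 [r [fV0 gV0 rle Vt Vc]]] := growth_coords (leqnn _).
have {rle} rlt : (r < m * k + k.+1)%N.
  rewrite addnS ltnS; apply: leq_trans rle _; rewrite leq_add2l.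
  exact: leq_trans count_free n_le_k.
have inF0 l : in_filtration V0 (fun t : S => F t.1 0 l).
  have [c cE] := realify_coord l.
  have : in_filtration V0 (fun t : S => \sum_i c i * embed (realify (F t.1) 0 i)).
    apply: in_filtration_sum => // i; apply: in_filtrationM => //.
      exact: in_filtration_cst.
    exists 1%N; have := Vc (rshift dN i : nat); rewrite /= ltn_add2l ltn_ord => /(_ isT).
    congr (V0 _ _); apply/funext => t; rewrite /coord_fun /graph_coords.
    by rewrite -[(dN + i)%N]/(rshift dN i : nat) coordsE row_mxEr.
  by move=> [a Va]; exists a; move: Va; congr (V0 a _); apply/funext => t; rewrite cE.
pose w : S -> K := fun t => (F t.1 0 j)^-1.
pose V := adjoin w V0.
have fV : filtration V by apply: filtration_adjoin.
have inF l : in_filtration V (fun t : S => F t.1 0 l).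
  by have [a Va] := inF0 l; exists a; apply: sub_adjoin.
have gV : growth param_filter V r.
  have [a Va] := inF0 j.
  (* The inverse w of F_j satisfies the relation F_j w - 1 = 0 of degree 1, so adjoining it does not
     raise the growth. *)
  apply: (@growth_algebraic _ _ _ pF _ _ fV0 r
    (fun l t => if l == 0%N then -1 else if l == 1%N then F t.1 0 j else 0) 1 a) => //.
  - move=> [|[|l]] //=; apply: (filtration_mono fV0 (leq0n _)); exact: filtration_cst.
  - apply: filterS Fj => x /= Fx L; rewrite !big_ord_recl big_ord0 /= /w /=.
    by rewrite expr0 expr1 mulr1 addr0 divff // addrC subrr.
  - by apply: filterS Fj => x Fx L.
pose q := (m * k + k)%N.
pose z (t : S) : 'rV[K]_q := row_mx (mxvec t.2) ((F t.1 0 j)^-1 *: (F t.1 *m t.2)).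
pose y (i : 'I_q.+1) (t : S) : K := if unlift ord0 i is Some l then z t 0 l else F t.1 0 j.
have [a Va] : exists a, forall i, V a (y i).
  apply: in_filtration_finite => // i; rewrite /y.
  case: (unlift ord0 i) => [l|]; last exact: inF.
  case: (split_ordP l) => l' ->.
    under eq_fun do rewrite row_mxEl.
    case: (mxvec_indexP l') => l1 l2; under eq_fun do rewrite mxvecE.
    by exists 1%N; apply: sub_adjoin.
  under eq_fun do rewrite row_mxEr mxE.
  apply: in_filtrationM => //; first by exists 1%N; apply: mem_adjoin.
  under eq_fun do rewrite mxE; apply: in_filtration_sum => // l1.
  by apply: in_filtrationM => //; exists 1%N; apply: sub_adjoin.
have [|n0 [mu [[gam0 mu0] rel]]] := growth_dependence pF fV gV Va.
  by rewrite card_ord /q -addnS.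
pose g (z : 'rV[K]_q) : {poly K} := \sum_(gam : {ffun 'I_q.+1 -> 'I_n0})
  (mu gam * \prod_(i < q) z 0 i ^+ gam (lift ord0 i)) *: 'X^(gam ord0).
have gE zz c : (g zz).[c] = \sum_(gam : {ffun 'I_q.+1 -> 'I_n0}) mu gam *
    \prod_i (if unlift ord0 i is Some l then zz 0 l else c) ^+ gam i.
  rewrite horner_sum; apply: eq_bigr => gam _; rewrite !hornerE big_ord_recl unlift_none.
  rewrite -mulrA [X in mu gam * X]mulrC; congr (_ * (_ * _)).
  by apply: eq_bigr => i _; rewrite liftK.
exists g; split.
- split.
    exists n0 => zz; apply: leq_trans (size_sum _ _ _) _; apply/bigmax_leqP => gam _.
    apply: leq_trans (size_scale_leq _ _) _; rewrite size_polyXn; exact: ltn_ord.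
  move=> l; have [p hp] : polynomial_fun (fun zz : 'rV[K]_q =>
      \sum_(gam : {ffun 'I_q.+1 -> 'I_n0}) (mu gam * (l == gam ord0)%:R) *
        \prod_(i < q) zz 0 i ^+ gam (lift ord0 i)).
    apply: polynomial_fun_sum => gam; apply: polynomial_funM.
      exact: polynomial_fun_cst.
    by apply: polynomial_fun_prod => i; apply: polynomial_funX; apply: polynomial_fun_coord.
  exists p => zz; rewrite -hp coef_sum; apply: eq_bigr => gam _.
  by rewrite coefZ coefXn mulrAC.
- have [vv hvv] := monomials_independent mu0.
  exists (\row_i vv (lift ord0 i)).
  apply: contraNneq hvv => g0; apply/eqP.
  have : (g (\row_i vv (lift ord0 i))).[vv ord0] = 0 by rewrite g0 horner0.
  rewrite gE => gv0; rewrite -[RHS]gv0; apply: eq_bigr => gam _; congr (_ * _).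
  by apply: eq_bigr => i _; case: unliftP => [l|] ->; rewrite ?mxE.
move: rel; rewrite /param_filter /=; apply: filterS => x hx L.
rewrite gE -[RHS](hx L).
by apply: eq_bigr => gam _; congr (_ * _); apply: eq_bigr => i _.
Qed.

End Relation.

(** * Comparison of exponents *)

Section Comparison.
Variables (R : realType) (s : scalars).
Local Notation K := (scalar_field R s).

Lemma knorm2Z d (a : K) (x : 'rV[K]_d) : knorm2 (a *: x) = abs2 a * knorm2 x.
Proof.
by rewrite /knorm2 mulr_sumr; apply: eq_bigr => j _; rewrite mxE abs2M.
Qed.

(** A point of norm at least r is at distance at least r / 2 from x, hence no nearer than the point
    0 of [Z1]. *)
Lemma dist_to_local d (Z1 Z2 : set 'rV[K]_d) r x : 0 < r -> Z1 0 -> Z2 0 ->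
  (forall z, knorm z < r -> Z2 z -> Z1 z) -> knorm x < r / 2 ->
  dist_to Z1 x <= dist_to Z2 x.
Proof.
move=> r0 Z10 Z20 Z21 xr; apply: (le_dist_to Z20) => z Z2z.
have [zr|rz] := ltP (knorm z) r; first exact: dist_to_le (Z21 z zr Z2z).
apply: le_trans (dist_to_le x Z10) _; rewrite subr0.
rewrite !knormE; apply: ler_wsqrtr.
have := knorm2D x (z - x); rewrite subrKC -(knorm2N (z - x)) opprB.
have : r ^+ 2 <= knorm2 z by rewrite -sqr_knorm ler_pXn2r ?nnegrE ?knorm_ge0 // ltW.
move: xr; rewrite knorm_lt ?divr_gt0 // => xr.
have rE : (r / 2) ^+ 2 = r ^+ 2 / 4 by field.
rewrite rE in xr; lra.
Qed.

Variables (N : nat) (X D : set 'rV[K]_N).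

Definition near0 (P : 'rV[K]_N -> Prop) :=
  exists2 r, 0 < r & forall x, X x -> knorm x < r -> P x.

Lemma near0_and P Q : near0 P -> near0 Q -> near0 (fun x => P x /\ Q x).
Proof.
move=> [r r0 hP] [r' r'0 hQ]; exists (Num.min r r'); first by rewrite lt_min r0.
by move=> x Xx; rewrite lt_min => /andP[xr xr']; split; [apply: hP|apply: hQ].
Qed.

Lemma near0_sub (P Q : 'rV[K]_N -> Prop) : (forall x, P x -> Q x) -> near0 P -> near0 Q.
Proof. by move=> PQ [r r0 hP]; exists r => // x Xx xr; apply/PQ/hP. Qed.

Lemma near0_forall (I : finType) (P : I -> 'rV[K]_N -> Prop) :
  (forall i, near0 (P i)) -> near0 (fun x => forall i, P i x).
Proof.
move=> nP; suff : near0 (fun x => forall i, i \in enum I -> P i x).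
  by apply: near0_sub => x h i; apply: h; rewrite mem_enum.
elim: (enum I) => [|i l IH]; first by exists 1.
apply: near0_sub (near0_and (nP i) IH) => x [Pi Pl] j.
by rewrite inE => /orP[/eqP->//|/Pl].
Qed.

Hypothesis D_sub : D `<=` X.

Lemma zeros_near0 m k (G : 'rV[K]_N -> 'rV[K]_m) (H : 'rV[K]_N -> 'rV[K]_k) :
  zeros D G 0 -> zeros D H 0 -> near0 (fun x => G x = 0 <-> H x = 0) ->
  near0 (fun x => dist_to (zeros D G) x = dist_to (zeros D H) x).
Proof.
move=> G0 H0 [r r0 hr]; exists (r / 2); first by rewrite divr_gt0.
move=> x Xx xr; apply/eqP; rewrite eq_le; apply/andP; split.
  apply: (dist_to_local r0) => // z zr [Dz Hz]; split=> //.
  by apply/hr => //; apply: D_sub.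
apply: (dist_to_local r0) => // z zr [Dz Hz]; split=> //.
by apply/hr => //; apply: D_sub.
Qed.

Lemma loj_exponents_sub m k (G : 'rV[K]_N -> 'rV[K]_m) (H : 'rV[K]_N -> 'rV[K]_k) C :
  0 < C -> zeros D G 0 -> zeros D H 0 -> near0 (fun x => G x = 0 <-> H x = 0) ->
  near0 (fun x => knorm (G x) <= C * knorm (H x)) ->
  loj_exponents X D G `<=` loj_exponents X D H.
Proof.
move=> C0 G0 H0 /(zeros_near0 G0 H0) nz nC eta [c [e [c0 e0 hc]]].
have [r r0 hr] := near0_and nz nC.
exists (c / C), (Num.min e r); split; first by rewrite divr_gt0.
  by rewrite lt_min e0.
move=> x Xx; rewrite lt_min => /andP[xe xr]; have [Dx le] := hc x Xx xe.
have [<- leC] := hr x Xx xr; split=> //.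
by rewrite mulrAC ler_pdivrMr // [leRHS]mulrC; apply: le_trans leC.
Qed.

Lemma limit_point_zeros m k (G : 'rV[K]_N -> 'rV[K]_m) (H : 'rV[K]_N -> 'rV[K]_k) :
  near0 (fun x => G x = 0 <-> H x = 0) ->
  limit_point (X `\` zeros D G) 0 -> limit_point (X `\` zeros D H) 0.
Proof.
move=> [r r0 hr] lp U U0.
have [|x [x0 [Xx nGx] [Ux /= xr]]] := lp (U `&` [set x : 'rV[K]_N | knorm x < r]).
  apply: filterI => //; apply/knorm_nbhsP; exists r => // y.
  by rewrite subr0.
exists x; split=> //; split=> // -[Dx Hx]; apply: nGx; split=> //.
exact/hr.
Qed.

End Comparison.

(** * Exponents of F and of its linear compositions *)

Section LinearComposition.
Variables (R : realType) (s : scalars).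
Local Notation K := (scalar_field R s).
Variables (N m k : nat) (X D : set 'rV[K]_N) (F : 'rV[K]_N -> 'rV[K]_m).
Hypothesis X_closed : closed X.
Hypothesis X0 : X 0.
Hypothesis D_nbhd : is_nbhd_in X D.
Hypothesis F_continuous : {within D, continuous F}.
Hypothesis F_semialgebraic : semialgebraic (map_graph D F).
Hypothesis F0 : F 0 = 0.
Variable L : 'M[K]_(m, k).

Let D_sub : D `<=` X. Proof. by case: D_nbhd. Qed.

(** Results on compositions thus apply to F itself, with the identity matrix. *)
Lemma lin_comp1 : lin_comp 1%:M F = F.
Proof. by apply/funext => x; rewrite /lin_comp mulmx1. Qed.

Lemma exists_loj_exponent k' (M : 'M[K]_(m, k')) :
  exists l, is_loj_exponent X D (lin_comp M F) l.
Proof.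
have [lp|nlp] := pselect (limit_point (X `\` zeros D (lin_comp M F)) 0).
  have [l [h1 h2]] := exists_exponent X_closed X0 D_nbhd F_continuous
    F_semialgebraic F0 lp.
  by exists l; split=> // /(_ lp).
by exists 0; split=> // /nlp.
Qed.

Let zF : zeros D F 0.
Proof. by rewrite -lin_comp1; apply: (zeros0 X0 D_nbhd F0). Qed.

Let zLF : zeros D (lin_comp L F) 0.
Proof. exact: (zeros0 X0 D_nbhd F0). Qed.

Lemma knorm_lin_comp : exists2 C, 0 < C & forall x, knorm (lin_comp L F x) <= C * knorm (F x).
Proof.
have [C C0 hC] := knorm2_mulmx L; exists (Num.sqrt C); first by rewrite sqrtr_gt0.
by move=> x; rewrite !knormE -sqrtrM ?(ltW C0) //; apply: ler_wsqrtr; apply: hC.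
Qed.

Lemma same_zeros_near0P : same_zeros_near0 X D F L <->
  near0 X (fun x => F x = 0 <-> lin_comp L F x = 0).
Proof.
have [r0 r00 hr0] := domain_radius D_nbhd.
split=> [[U [UX [W /knorm_nbhsP[e e0 hW] XW]] UE]|[r r_gt0 hr]].
  exists (Num.min e r0) => [|x Xx]; first by rewrite lt_min e0.
  rewrite lt_min => /andP[xe xr]; have Dx := hr0 x Xx xr.
  have Ux : U x by apply: XW; split=> //; apply: hW; rewrite subr0.
  split=> h.
    by have [[_ ?] _] : (zeros D (lin_comp L F) `&` U) x by rewrite -UE.
  by have [[_ ?] _] : (zeros D F `&` U) x by rewrite UE.
exists (X `&` [set x | knorm x < r]).
  split; first by move=> x [].
  exists [set x | knorm x < r] => //.
  by apply/knorm_nbhsP; exists r => // y; rewrite subr0.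
by apply/seteqP; split=> x [[Dx Zx] [Xx xr]]; split=> //; split=> //; apply/hr.
Qed.

(** Since |L F| <= C |F| and the zeros agree near 0, each exponent admissible for L F is admissible
    for F. *)
Lemma exponent_le : same_zeros_near0 X D F L -> exists lF lLF : R,
  [/\ is_loj_exponent X D F lF, is_loj_exponent X D (lin_comp L F) lLF & lF <= lLF].
Proof.
move=> /same_zeros_near0P nz; have [lF hF] := exists_loj_exponent 1%:M.
have [lL hL] := exists_loj_exponent L; rewrite lin_comp1 in hF.
exists lF, lL; split=> //.
have nz' : near0 X (fun x => lin_comp L F x = 0 <-> F x = 0).
  by apply: near0_sub nz => x [? ?]; split.
have [lp|nlp] := pselect (limit_point (X `\` zeros D F) 0); last first.
  have nlpL : ~ limit_point (X `\` zeros D (lin_comp L F)) 0.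
    by move=> /(limit_point_zeros nz').
  by rewrite (proj2 hF nlp) (proj2 hL nlpL).
have lpL := limit_point_zeros nz lp.
have [_ minF] := proj1 hF lp; have [inL _] := proj1 hL lpL.
apply: minF; have [C C0 hC] := knorm_lin_comp.
apply: (loj_exponents_sub D_sub C0 zLF zF nz') inL.
by exists 1.
Qed.

(** This is the lower half of the comparison of |L F| with |F|, the upper half being
    [knorm_lin_comp]: the directions of F x stay away from the kernel of L. *)
Definition proper_on := exists2 c, 0 < c &
  near0 X (fun x => D x /\ c * knorm2 (F x) <= knorm2 (lin_comp L F x)).

Lemma same_exponent : proper_on ->
  same_zeros_near0 X D F L /\ same_loj_exponent X D F L.
Proof.
move=> [c c0 hc].
have nz : near0 X (fun x => F x = 0 <-> lin_comp L F x = 0).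
  apply: near0_sub hc => x [Dx le]; split=> [Fx|Lx].
    by rewrite /lin_comp Fx mul0mx.
  apply: knorm2_eq0; apply/eqP; rewrite eq_le knorm2_ge0 andbT.
  by move: le; rewrite Lx knorm20 pmulr_rle0.
split; first exact/same_zeros_near0P.
have nz' : near0 X (fun x => lin_comp L F x = 0 <-> F x = 0).
  by apply: near0_sub nz => x [? ?]; split.
have [C C0 hC] := knorm_lin_comp.
have eqloj : loj_exponents X D F = loj_exponents X D (lin_comp L F).
  apply/seteqP; split; last first.
    by apply: (loj_exponents_sub D_sub C0 zLF zF nz'); exists 1.
  apply: (@loj_exponents_sub _ _ _ _ _ D_sub _ _ _ _ (Num.sqrt c^-1)) => //.
    by rewrite sqrtr_gt0 invr_gt0.
  apply: near0_sub hc => x [_ le].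
  rewrite !knormE -sqrtrM ?invr_ge0 ?(ltW c0) //; apply: ler_wsqrtr.
  by rewrite mulrC ler_pdivlMr // mulrC.
have [l hl] := exists_loj_exponent 1%:M; rewrite lin_comp1 in hl.
exists l => //; split=> [lp|nlp].
  by rewrite -eqloj; apply: (proj1 hl); apply: limit_point_zeros nz' lp.
by apply: (proj2 hl) => lp; apply: nlp; apply: limit_point_zeros nz lp.
Qed.

End LinearComposition.

(** * Generic linear mappings *)

Section Tends.
Variables (R : realType) (s : scalars) (Y : Type) (rho : Y -> R).
Local Notation K := (scalar_field R s).
Implicit Types (f g : Y -> K) (l : K).

(** The limit is taken as [rho] tends to 0, uniformly in y; it will be used for pairs of a value F_j
    and a vector L F / F_j. *)
Definition tends f l := forall e, 0 < e ->
  exists2 d, 0 < d & forall y, rho y < d -> abs2 (f y - l) < e.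

Lemma tends_cst l : tends (fun=> l) l.
Proof. by move=> e e0; exists 1 => // y _; rewrite subrr abs20. Qed.

Lemma tendsD f g l l' : tends f l -> tends g l' -> tends (fun y => f y + g y) (l + l').
Proof.
move=> hf hg e e0; have e40 : 0 < e / 4 by rewrite divr_gt0.
have [d d0 hd] := hf _ e40; have [d' d'0 hd'] := hg _ e40.
exists (Num.min d d') => [|y]; first by rewrite lt_min d0.
rewrite lt_min => /andP[/hd h /hd' h']; rewrite opprD addrACA.
apply: le_lt_trans (abs2D _ _) _; lra.
Qed.

Lemma tendsM f g l l' : tends f l -> tends g l' -> tends (fun y => f y * g y) (l * l').
Proof.
move=> hf hg e e0.
pose A := abs2 l + abs2 l' + 1; have A0 : 0 < A by rewrite ltr_wpDl // addr_ge0 ?abs2_ge0.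
pose h := Num.min 1 (e / (12 * A)); have h0 : 0 < h.
  by rewrite lt_min ltr01 divr_gt0 // mulr_gt0.
have [d d0 hd] := hf _ h0; have [d' d'0 hd'] := hg _ h0.
exists (Num.min d d') => [|y]; first by rewrite lt_min d0.
rewrite lt_min => /andP[/hd + /hd']; set u := f y - l; set u' := g y - l' => hu hu'.
have -> : f y * g y - l * l' = u * u' + (l * u' + u * l') by rewrite /u /u'; ring.
have hA : h * (12 * A) <= e.
  by rewrite -ler_pdivlMr ?mulr_gt0 // ge_min lexx orbT.
have h1 : h <= 1 by rewrite ge_min lexx.
apply: le_lt_trans (abs2D _ _) _.
have B1 : abs2 (u * u') <= h.
  rewrite abs2M -[h]mulr1; apply: ler_pM; rewrite ?abs2_ge0 ?ltW //.
  exact: lt_le_trans hu' h1.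
have B2 := abs2D (l * u') (u * l'); rewrite !abs2M in B2.
have B3 : abs2 l * abs2 u' <= abs2 l * h by rewrite ler_wpM2l ?abs2_ge0 // ltW.
have B4 : abs2 u * abs2 l' <= h * abs2 l' by rewrite ler_wpM2r ?abs2_ge0 // ltW.
apply: lt_le_trans hA.
have := abs2_ge0 l; have := abs2_ge0 l'; rewrite /A; nra.
Qed.

Lemma tendsX f l n : tends f l -> tends (fun y => f y ^+ n) (l ^+ n).
Proof.
move=> hf; elim: n => [|n IH]; first exact: tends_cst.
have -> : (fun y => f y ^+ n.+1) = (fun y => f y * f y ^+ n).
  by apply/funext => y; rewrite exprS.
by rewrite exprS; apply: tendsM.
Qed.

Lemma tends_sum I (r : seq I) (f : I -> Y -> K) (l : I -> K) :
  (forall i, tends (f i) (l i)) ->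
  tends (fun y => \sum_(i <- r) f i y) (\sum_(i <- r) l i).
Proof.
move=> hf; elim: r => [|i r IH].
  by under eq_fun do rewrite big_nil; rewrite big_nil; apply: tends_cst.
by under eq_fun do rewrite big_cons; rewrite big_cons; apply: tendsD.
Qed.

Lemma tends_prod I (r : seq I) (f : I -> Y -> K) (l : I -> K) :
  (forall i, tends (f i) (l i)) ->
  tends (fun y => \prod_(i <- r) f i y) (\prod_(i <- r) l i).
Proof.
move=> hf; elim: r => [|i r IH].
  by under eq_fun do rewrite big_nil; rewrite big_nil; apply: tends_cst.
by under eq_fun do rewrite big_cons; rewrite big_cons; apply: tendsM.
Qed.

Lemma tends_polynomial_fun q (p : 'rV[K]_q -> K) (z : Y -> 'rV[K]_q)
  (z0 : 'rV[K]_q) :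
  polynomial_fun p -> (forall i, tends (fun y => z y 0 i) (z0 0 i)) ->
  tends (fun y => p (z y)) (p z0).
Proof.
move=> [P hP] hz.
have -> : (fun y => p (z y)) = (fun y => \sum_(m <- msupp P)
    mcoeff m P * \prod_(i < q) z y 0 i ^+ m i).
  by apply/funext => y; rewrite hP mevalE.
rewrite hP mevalE; apply: tends_sum => m; apply: tendsM; first exact: tends_cst.
by apply: tends_prod => i; apply: tendsX.
Qed.

Lemma tends_neq0 f l : tends f l -> l != 0 ->
  exists2 d, 0 < d & forall y, rho y < d -> f y != 0.
Proof.
move=> hf l0; have al0 : 0 < abs2 l.
  by rewrite lt_def abs2_ge0 andbT; apply: contraNneq l0 => /abs2_eq0/eqP.
have [d d0 hd] := hf _ al0; exists d => // y /hd; apply: contraTneq => ->.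
by rewrite sub0r abs2N ltxx.
Qed.

End Tends.

Section GenericProjection.
Variables (R : realType) (s : scalars).
Local Notation K := (scalar_field R s).
Variables (N m k : nat) (X D : set 'rV[K]_N) (F : 'rV[K]_N -> 'rV[K]_m).
Hypothesis X_closed : closed X.
Hypothesis X0 : X 0.
Hypothesis X_semialgebraic : semialgebraic (@realify R s N @` X).
Hypothesis D_nbhd : is_nbhd_in X D.
Hypothesis F_continuous : {within D, continuous F}.
Hypothesis F_semialgebraic : semialgebraic (map_graph D F).
Hypothesis F0 : F 0 = 0.
Hypothesis dim_le_k : (real_dim0 (@realify R s N @` X) <= k)%N.

(** [ultrafilter_cover] glues the relations found along the ultrafilters: on a union of two sets the
    product of the two families vanishes, and it is not identically zero. *)
Lemma relation_near0 (j : 'I_m) : exists g : 'rV[K]_(m * k + k) -> {poly K},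
  [/\ polynomial_family g, exists z, g z != 0 &
    near0 X (fun x => F x 0 j != 0 -> forall L : 'M[K]_(m, k),
      (g (row_mx (mxvec L) ((F x 0 j)^-1 *: (F x *m L)))).[F x 0 j] = 0)].
Proof.
have [Om oOm [Om0 hfree]] := exists_small_free X_semialgebraic.
pose A : set 'rV[K]_N := [set x | [/\ X x, D x, Om (realify x) & F x 0 j != 0]].
pose rel (g : 'rV[K]_(m * k + k) -> {poly K}) x := forall L : 'M[K]_(m, k),
  (g (row_mx (mxvec L) ((F x 0 j)^-1 *: (F x *m L)))).[F x 0 j] = 0.
have [g [pg g0 Ag]] : exists g, [/\ polynomial_family g, exists z, g z != 0 &
    forall x, A x -> rel g x].
  apply: (ultrafilter_cover (P := fun B => exists g, [/\ polynomial_family g,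
     exists z, g z != 0 & forall x, B x -> rel g x])).
  - exists (fun=> 1); split=> //; last by exists 0; rewrite oner_eq0.
    split; first by exists 1%N => z; rewrite size_poly1.
    by move=> l; have [p hp] := @polynomial_fun_cst K (m * k + k) (1 : {poly K})`_l; exists p.
  - move=> B C [g [pg [a ga] Bg]] [h [ph [b hb] Ch]].
    exists (fun z => g z * h z); split; first exact: polynomial_familyM.
      exact: polynomial_familyM_neq0 ga hb.
    move=> x [/Bg gx|/Ch hx] L; rewrite hornerM; first by rewrite gx mul0r.
    by rewrite hx mulr0.
  - by move=> B C BC [g [pg g0 Cg]]; exists g; split=> // x /BC/Cg.
  move=> U UU UA.
  have vx x i : (i < real_size s N)%N -> graph_coords F x i = coords (realify x) i.
    move=> lti; have := coordsE (row_mx (realify x) (realify (F x)))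
      (lshift (real_size s m) (Ordinal lti)).
    by rewrite row_mxEl -(coordsE (realify x) (Ordinal lti)).
  have free_le : (#|free_coords (real_size s N) U (graph_coords F)| <=
      real_dim0 (@realify R s N @` X))%N.
    apply: (hfree _ U _ (@realify R s N)) => //.
    by apply: filterS UA => x [Xx _ Ox _]; split=> //; exists x.
  have UD : U D by apply: filterS UA => x [].
  have UF : U [set x | F x 0 j != 0] by apply: filterS UA => x [].
  have [g [pg g0 Ug]] := generic_relation F_semialgebraic dim_le_k UU UD free_le UF.
  exists [set x | rel g x] => //; by exists g.
exists g; split=> //.
have [r r0 hr] := domain_radius D_nbhd.
have /(@knorm_nbhsP R RealScalars)[e e0 he] : nbhs (0 : 'rV[R]_(real_size s N)) Om.
  exact: open_nbhs_nbhs.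
exists (Num.min r e) => [|x Xx]; first by rewrite lt_min r0.
rewrite lt_min => /andP[xr xe] Fx; apply: Ag; split=> //; first exact: hr.
by apply: he; rewrite subr0.
Qed.

(** If |L F| were too small against |F_j| at some x near 0, the relation for [L + M] would make [h]
    vanish at a point close to (L + M, c, 0), where it is nonzero; [f] is the value of [h] at that
    limit point. *)
Lemma coordinate_estimate (j : 'I_m) : exists f : 'rV[K]_(m * k) -> K,
  [/\ polynomial_fun f, exists v, f v != 0 & forall L, f (mxvec L) != 0 ->
    exists2 c, 0 < c & near0 X (fun x => c * abs2 (F x 0 j) <= knorm2 (lin_comp L F x))].
Proof.
have [g [pg [a ga] gnear]] := relation_near0 j.
have [e [h [ph [z0 hz0] gh]]] := polynomial_family_div pg ga.
(* Row j of [M] is c and its other rows are 0, so (L + M) F / F_j = c + L F / F_j. *)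
pose c := rsubmx z0; pose M : 'M[K]_(m, k) := delta_mx j 0 *m c.
pose f (v : 'rV[K]_(m * k)) := (h (row_mx (v + mxvec M) c))`_0.
exists f; split.
- have [p hp] := proj2 ph 0%N.
  have [p' hp'] : polynomial_fun (fun v : 'rV[K]_(m * k) =>
      meval (fun i => row_mx (v + mxvec M) c 0 i) p).
    apply: (@polynomial_fun_comp _ _ _ p (fun i v => row_mx (v + mxvec M) c 0 i)) => i.
    case: (split_ordP i) => l ->.
      have [p' hp'] := polynomial_funD (polynomial_fun_coord K l)
        (polynomial_fun_cst _ (mxvec M 0 l)).
      by exists p' => v; rewrite -hp' row_mxEl mxE.
    have [p' hp'] := polynomial_fun_cst (m * k) (c 0 l).
    by exists p' => v; rewrite -hp' row_mxEr.
  by exists p' => v; rewrite -hp' /f hp.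
- by exists (lsubmx z0 - mxvec M); rewrite /f subrK hsubmxK.
move=> L fL; pose z1 : 'rV[K]_(m * k + k) := row_mx (mxvec (L + M)) c.
pose rho (y : K * 'rV[K]_k) := abs2 y.1 + knorm2 y.2.
pose z (y : K * 'rV[K]_k) : 'rV[K]_(m * k + k) := row_mx (mxvec (L + M)) (c + y.2).
have tends1 : tends rho (fun y => y.1) 0.
  move=> e' e'0; exists e' => // y; apply: le_lt_trans.
  by rewrite subr0 lerDl knorm2_ge0.
have tends2 i : tends rho (fun y => z y 0 i) (z1 0 i).
  rewrite /z /z1; case: (split_ordP i) => l ->.
    by under eq_fun do rewrite row_mxEl; rewrite row_mxEl; apply: tends_cst.
  under eq_fun do rewrite row_mxEr mxE; rewrite row_mxEr.
  suff : tends rho (fun y => c 0 l + y.2 0 l) (c 0 l + 0) by rewrite addr0.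
  apply: tendsD; first exact: tends_cst.
  move=> e' e'0; exists e' => // y; apply: le_lt_trans; rewrite subr0.
  by apply: le_trans (abs2_le_knorm2 _ l) _; rewrite lerDr abs2_ge0.
have [d d0 hd] : exists2 d, 0 < d & forall y, rho y < d -> (h (z y)).[y.1] != 0.
  apply: (@tends_neq0 _ _ _ _ _ (h z1).[0]); last first.
    by rewrite horner_coef0; move: fL; rewrite /f /z1 linearD.
  have [[B hB] pc] := ph.
  have -> : (fun y : K * 'rV[K]_k => (h (z y)).[y.1]) =
      (fun y => \sum_(l < B) (h (z y))`_l * y.1 ^+ l).
    by apply/funext => y; rewrite (horner_coef_wide _ (hB _)).
  rewrite (horner_coef_wide _ (hB _)); apply: tends_sum => l.
  apply: tendsM; last exact: tendsX.
  by apply: (tends_polynomial_fun (pc l)).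
(* [rho] is a sum of two terms, |F_j|^2 and |L F / F_j|^2, and each is kept below d / 2. *)
exists (d / 2); first by rewrite divr_gt0.
have [r r0 hr] : near0 X (fun x => knorm2 (F x) < d / 2).
  have d20 : 0 < d / 2 by rewrite divr_gt0.
  have [r r0 hr] := near_zeros X0 D_nbhd F_continuous F0 1%:M d20.
  by exists r => // x Xx xr; have [_] := hr x Xx xr; rewrite lin_comp1.
have [r' r'0 hr'] := gnear.
exists (Num.min r r') => [|x Xx]; first by rewrite lt_min r0.
rewrite lt_min => /andP[xr xr'].
have [->|Fx] := eqVneq (F x 0 j) 0; first by rewrite abs20 mulr0 knorm2_ge0.
rewrite leNgt; apply/negP => lt.
pose u := (F x 0 j)^-1 *: (F x *m L).
have uc : (F x 0 j)^-1 *: (F x *m (L + M)) = c + u.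
  rewrite mulmxDr scalerDr addrC; congr (_ + _).
  rewrite /M mulmxA -colE; apply/rowP => i; rewrite !mxE big_ord1 !mxE.
  by rewrite mulrA mulVf // mul1r.
have inv1 : abs2 (F x 0 j)^-1 * abs2 (F x 0 j) = 1.
  rewrite -abs2M mulVf // /abs2; case: (s) => /=; first by rewrite expr1n.
  by rewrite expr1n expr0n addr0.
have ainv : 0 < abs2 (F x 0 j)^-1.
  rewrite lt_def abs2_ge0 andbT; apply/eqP => a0; move: inv1; rewrite a0 mul0r.
  by move/eqP; rewrite eq_sym oner_eq0.
have ltu : knorm2 u < d / 2.
  have : abs2 (F x 0 j)^-1 * knorm2 (F x *m L) <
      abs2 (F x 0 j)^-1 * (d / 2 * abs2 (F x 0 j)) by rewrite ltr_pM2l.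
  by rewrite [ltRHS]mulrCA inv1 mulr1 /u knorm2Z.
have ltF : abs2 (F x 0 j) < d / 2 by apply: le_lt_trans (hr x Xx xr); apply: abs2_le_knorm2.
have /negP : (h (z (F x 0 j, u))).[F x 0 j] != 0.
  by apply: (hd (F x 0 j, u)); rewrite /rho /= [ltRHS]splitr ltrD.
apply.
have := hr' x Xx xr' Fx (L + M); rewrite uc gh hornerM hornerXn -/(z (F x 0 j, u)).
by move/eqP; rewrite mulf_eq0 expf_eq0 (negbTE Fx) andbF orbF.
Qed.

(** The product of the polynomials of all coordinates is used; summing the estimates of the |F_j|^2
    bounds |F|^2. *)
Lemma generic_proper : exists f : 'rV[K]_(m * k) -> K,
  [/\ polynomial_fun f, exists v, f v != 0 &
    forall L : 'M[K]_(m, k), f (mxvec L) != 0 -> proper_on X D F L].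
Proof.
have /choice[f fP] := coordinate_estimate.
exists (fun v => \prod_j f j v); split.
- by apply: polynomial_fun_prod => j; case: (fP j).
- elim: (index_enum _) => [|j l [v hv]]; first by exists 0; rewrite big_nil oner_eq0.
  have [pj [a fa] _] := fP j.
  have pl : polynomial_fun (fun v => \prod_(i <- l) f i v).
    by apply: polynomial_fun_prod => i; case: (fP i).
  have [z [z1 z2]] := polynomial_fun_common pj pl fa hv.
  by exists z; rewrite big_cons mulf_neq0.
move=> L fL.
have /choice[c hc] (j : 'I_m) : exists c, 0 < c /\
    near0 X (fun x => c * abs2 (F x 0 j) <= knorm2 (lin_comp L F x)).
  have [_ _ /(_ L)] := fP j; case; last by move=> c c0 hc; exists c.
  by apply: contraNneq fL => f0; rewrite (bigD1 j) //= f0 mul0r.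
(* The summand 1 keeps the constant positive when m = 0. *)
pose C := 1 + \sum_j (c j)^-1.
have C0 : 0 < C.
  by rewrite ltr_wpDr // sumr_ge0 // => j _; rewrite invr_ge0 ltW //; case: (hc j).
exists C^-1; first by rewrite invr_gt0.
have nD : near0 X D by have [r r0 hr] := domain_radius D_nbhd; exists r.
apply: near0_sub (near0_and nD (near0_forall (fun j => proj2 (hc j)))) => x [Dx hx].
split=> //; rewrite mulrC ler_pdivrMr // mulrC /C mulrDl mul1r.
rewrite -[leLHS]add0r lerD ?knorm2_ge0 // mulr_suml; apply: ler_sum => j _.
by rewrite mulrC ler_pdivlMr; [rewrite mulrC; apply: hx|case: (hc j)].
Qed.

(** Since |L A F| <= C |L F|, a lower estimate for L A passes to L; this transfers genericity to
    normalised mappings. *)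
Lemma proper_on_mulmx (L : 'M[K]_(m, k)) (A : 'M[K]_k) :
  proper_on X D F (L *m A) -> proper_on X D F L.
Proof.
move=> [c c0 hc]; have [C C0 hC] := knorm2_mulmx A.
exists (c / C); first by rewrite divr_gt0.
apply: near0_sub hc => x [Dx le]; split=> //.
rewrite mulrAC ler_pdivrMr // [leRHS]mulrC; apply: le_trans (hC _).
by rewrite /lin_comp -mulmxA.
Qed.

Hypothesis k_le_m : (k <= m)%N.

Definition top (L : 'M[K]_(m, k)) : 'M[K]_k := rowsub (widen_ord k_le_m) L.

Lemma polynomial_fun_det_top : polynomial_fun (fun v : 'rV[K]_(m * k) => \det (top (vec_mx v))).
Proof.
have [p hp] : polynomial_fun (fun v : 'rV[K]_(m * k) => \sum_(sg : 'S_k) (-1) ^+ sg *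
    \prod_i v 0 (mxvec_index (widen_ord k_le_m i) (sg i))).
  apply: polynomial_fun_sum => sg; apply: polynomial_funM; first exact: polynomial_fun_cst.
  by apply: polynomial_fun_prod => i; apply: polynomial_fun_coord.
exists p => v; rewrite -hp; apply: eq_bigr => sg _; congr (_ * _).
by apply: eq_bigr => i _; rewrite !mxE.
Qed.

Lemma Delta_top (L : 'M[K]_(m, k)) : top L = 1%:M -> Delta L.
Proof.
move=> tL j i jk; move: tL => /matrixP/(_ (Ordinal jk) i); rewrite !mxE => <-.
by congr (L _ _); apply/val_inj.
Qed.

(** The polynomial f of [generic_proper] could vanish on all of [Delta]. For z with f z nonzero and
    top block A invertible, it is replaced by L -> f (L A), which is nonzero at the normalised
    matrix z A^-1. *)
Lemma generic_proper_Delta : exists f : 'rV[K]_(m * k) -> K,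
  [/\ polynomial_fun f, exists2 L, Delta L & f (mxvec L) != 0 &
    forall L : 'M[K]_(m, k), f (mxvec L) != 0 -> proper_on X D F L].
Proof.
have [f [pf [v fv] hf]] := generic_proper.
have det1 : \det (top (vec_mx (mxvec (pid_mx k : 'M[K]_(m, k))))) != 0.
  rewrite mxvecK (_ : top _ = 1%:M) ?det1 ?oner_eq0 //.
  by apply/matrixP => i j; rewrite !mxE /= ltn_ord andbT.
have [z [fz dz]] := polynomial_fun_common pf polynomial_fun_det_top fv det1.
pose A := top (vec_mx z); have Au : A \in unitmx by rewrite unitmxE unitfE.
exists (fun v => f (mxvec (vec_mx v *m A))); split.
- have [p hp] := pf.
  have [p' hp'] : polynomial_fun (fun v : 'rV[K]_(m * k) =>
      meval (fun i => mxvec (vec_mx v *m A) 0 i) p).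
    apply: (@polynomial_fun_comp _ _ _ p (fun i v => mxvec (vec_mx v *m A) 0 i)) => i.
    case: (mxvec_indexP i) => a b.
    have [p' hp'] : polynomial_fun (fun v : 'rV[K]_(m * k) =>
        \sum_l v 0 (mxvec_index a l) * A l b).
      apply: polynomial_fun_sum => l; apply: polynomial_funM.
        exact: polynomial_fun_coord.
      exact: polynomial_fun_cst.
    exists p' => v'; rewrite -hp' mxvecE mxE; apply: eq_bigr => l _.
    by rewrite !mxE.
  by exists p' => v'; rewrite -hp' hp.
- exists (vec_mx z *m invmx A); last by rewrite mxvecK mulmxKV // vec_mxK.
  apply: Delta_top; rewrite -(mulmxV Au); apply/matrixP => i j; rewrite !mxE.
  by apply: eq_bigr => l _; rewrite !mxE.
by move=> L; rewrite mxvecK => /hf; apply: proper_on_mulmx.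
Qed.

(** On the line from L to L1 the function is a nonzero polynomial in c, and it cannot vanish at more
    distinct small values of c than its degree. *)
Lemma exists_near_neq0 (f : 'rV[K]_(m * k) -> K) (L L1 : 'M[K]_(m, k)) B :
  polynomial_fun f -> f (mxvec L1) != 0 -> nbhs L B ->
  exists c, f (mxvec (L + c *: (L1 - L))) != 0 /\ B (L + c *: (L1 - L)).
Proof.
move=> pf fL1 /nbhs_ballP[e /= e0 hB].
have [p hp] := polynomial_fun_line (mxvec L) (mxvec (L1 - L)) pf.
have lineE c : f (mxvec (L + c *: (L1 - L))) = p.[c].
  by rewrite linearD linearZ hp.
have p0 : p != 0.
  apply: contraNneq fL1 => pE; have := lineE 1.
  by rewrite scale1r subrKC pE horner0 => ->.
have [d d0 hd] := abs2_lt_norm e0.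
pose M := 1 + \sum_i \sum_j abs2 ((L1 - L) i j).
have sum0 i : 0 <= \sum_j abs2 ((L1 - L) i j) by apply: sumr_ge0 => j _; apply: abs2_ge0.
have M0 : 0 < M by rewrite ltr_wpDr // sumr_ge0.
have leM i j : abs2 ((L1 - L) i j) <= M.
  apply: (@le_trans _ _ (\sum_j abs2 ((L1 - L) i j))).
    by rewrite (bigD1 j) //= lerDl sumr_ge0 // => j' _; apply: abs2_ge0.
  apply: (@le_trans _ _ (\sum_i \sum_j abs2 ((L1 - L) i j))); last by rewrite lerDr.
  by rewrite [leRHS](bigD1 i) //= lerDl sumr_ge0.
(* Starting the denominators at 2 makes |t i|^2 < d / M strict already for i = 0. *)
pose t (i : nat) : R := Num.sqrt (d / M) / i.+2%:R.
have dM0 : 0 < d / M by rewrite divr_gt0.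
have sdM : 0 < Num.sqrt (d / M) by rewrite sqrtr_gt0.
pose sq := [seq embed R s (t i) | i <- iota 0 (size p)].
have [c csq pc] : exists2 c, c \in sq & p.[c] != 0.
  apply: contrapT => nex.
  have : (size sq < size p)%N.
    apply: max_poly_roots => //.
      apply/allP => c csq; apply: contraT => nc; exfalso; apply: nex.
      by exists c.
    rewrite map_inj_uniq ?iota_uniq // => i j /fmorph_inj /mulfI.
    move=> /(_ (lt0r_neq0 sdM)) /invr_inj /eqP.
    by rewrite eqr_nat => /eqP[].
  by rewrite size_map size_iota ltnn.
exists c; split; first by rewrite lineE.
apply: hB; split=> // i j; rewrite -ball_normE /= distrC.
have -> : (L + c *: (L1 - L)) i j - L i j = c * (L1 - L) i j.
  by rewrite [in LHS]mxE addrAC subrr add0r mxE.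
apply: hd; rewrite abs2M.
have {csq} ltc : abs2 c < d / M.
  move: csq => /mapP[l _ ->].
  have -> : abs2 (embed R s (t l)) = t l ^+ 2.
    by rewrite /abs2 /embed; case: (s) => //=; rewrite expr0n addr0.
  rewrite /t expr_div_n sqr_sqrtr ?(ltW dM0) //.
  rewrite gtr_pMr // invf_lt1 ?exprn_gt0 ?ltr0n // exprn_egt1 // ltr1n //.
apply: (@le_lt_trans _ _ (abs2 c * M)); first by rewrite ler_wpM2l ?abs2_ge0.
by rewrite -ltr_pdivlMr.
Qed.

(** The exceptional set is the zero set of f. Density follows by moving any L of [A] slightly
    towards [L1], which does not leave [A]. *)
Lemma for_generic_proper (A : set 'M[K]_(m, k)) (f : 'rV[K]_(m * k) -> K) L1 :
  polynomial_fun f -> A L1 -> f (mxvec L1) != 0 ->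
  (forall L c, A L -> A (L + c *: (L1 - L))) ->
  (forall L : 'M[K]_(m, k), f (mxvec L) != 0 -> proper_on X D F L) ->
  for_generic A (fun L => same_zeros_near0 X D F L /\ same_loj_exponent X D F L).
Proof.
move=> pf AL1 fL1 Aline hf; have [p hp] := pf.
exists [set L | f (mxvec L) = 0]; split.
- exists [:: p]; apply/seteqP; split=> L /=.
    by move=> fL q; rewrite inE => /eqP ->; rewrite -hp.
  by move=> h; rewrite hp; apply: h; rewrite inE.
- move=> L AL B nB; have [c [fc Bc]] := exists_near_neq0 pf fL1 nB.
  exists (L + c *: (L1 - L)); split=> //; split; first exact: Aline.
  by apply/eqP.
move=> L [_ /= /eqP fL]; apply: same_exponent => //; exact: hf.
Qed.

End GenericProjection.

Theorem theorem3p2 (R : realType) (s : scalars) (N m n k : nat)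
    (X D : set 'rV[scalar_field R s]_N)
    (F : 'rV[scalar_field R s]_N -> 'rV[scalar_field R s]_m)
    (X_closed : closed X)
    (X_semialgebraic : semialgebraic (@realify R s N @` X))
    (X0 : X 0)
    (X_acc0 : limit_point X 0)
    (X_dim : real_dim0 (@realify R s N @` X) = n)
    (D_nbhd : is_nbhd_in X D)
    (F_continuous : {within D, continuous F})
    (F_semialgebraic : semialgebraic (map_graph D F))
    (F0 : F 0 = 0)
    (n_le_k : (n <= k)%N) (k_le_m : (k <= m)%N) :
  [/\ forall L : 'M[scalar_field R s]_(m, k), same_zeros_near0 X D F L ->
        exists lF lLF : R,
          [/\ is_loj_exponent X D F lF,
              is_loj_exponent X D (lin_comp L F) lLF & lF <= lLF],
      for_generic [set: 'M[scalar_field R s]_(m, k)]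
        (fun L => same_zeros_near0 X D F L /\ same_loj_exponent X D F L)
    & for_generic (@Delta R s m k)
        (fun L => same_zeros_near0 X D F L /\ same_loj_exponent X D F L)].
Proof.
rewrite -X_dim in n_le_k.
(* One polynomial serves both generic statements, because it is nonzero at a point of [Delta]. *)
have [f [pf [L1 DL1 fL1] hf]] := generic_proper_Delta X0 X_semialgebraic D_nbhd
  F_continuous F_semialgebraic F0 n_le_k k_le_m.
split.
- by move=> L; apply: exponent_le.
- exact: (for_generic_proper X_closed X0 D_nbhd F_continuous F_semialgebraic F0 pf _ fL1).
apply: (for_generic_proper X_closed X0 D_nbhd F_continuous F_semialgebraic F0 pf DL1 fL1) => //.
(* The normalised mappings form an affine subspace, which contains the line through any two of its
   points. *)
by move=> L c DL j i jk; rewrite !mxE DL // DL1 // subrr mulr0 addr0.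
Qed.
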